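(* Let $[a,b]\subseteq(0,2)$, let $\alpha:\mathbb{R}\to[a,b]$ be continuous, and let $$Y(t)=\int\Big((t-x)_+^{h-1/\alpha(x)}-(-x)_+^{h-1/\alpha(x)}\Big)dM_\alpha(x),\qquad t\in\mathbb{R}$$ (linear fractional $\alpha(x)$-multistable motion). If $$\frac1a-\frac1b<h<1+\frac1b-\frac1a,$$ then $Y$ is $h$-localisable at each $u\in\mathbb{R}$ with local form $$Y_u'=\Big\{\int\Big((t-z)_+^{h-1/\alpha(u)}-(-z)_+^{h-1/\alpha(u)}\Big)dM_{\alpha(u)}(z):t\in\mathbb{R}\Big\},$$ which is linear fractional $\alpha(u)$-stable motion. Furthermore, if $1/a<h<1+1/b-1/a$, then $Y$ has a continuous version and is strongly localisable at each $u\in\mathbb{R}$.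
   Context: Integrals without limits are over $\mathbb{R}$. For real $y$ and $\gamma$, $(y)_+^\gamma=y^\gamma$ if $y>0$ and $0$ if $y\le0$; when the exponent $h-1/\alpha$ is $0$ the difference $(t-x)_+^{0}-(-x)_+^{0}$ is taken to be $\mathbf{1}_{[0,t]}(x)$ if $t\ge0$ and $-\mathbf{1}_{[t,0]}(x)$ if $t<0$. For measurable $\alpha:\mathbb{R}\to[a,b]$ with $0<a\le b\le 2$, $\mathcal{F}_\alpha$ is the space of measurable $g:\mathbb{R}\to\mathbb{R}$ with $\int|g(x)|^{\alpha(x)}dx<\infty$. The $\alpha(x)$-multistable integral is a stochastic process $\{I(g):g\in\mathcal{F}_\alpha\}$ with $$\mathbb{E}\Big(\exp i\sum_{j=1}^d\theta_jI(g_j)\Big)=\exp\Big\{-\int\Big|\sum_{j=1}^d\theta_jg_j(x)\Big|^{\alpha(x)}dx\Big\}$$ for all $d\in\mathbb{N}$, $g_1,\dots,g_d\in\mathcal{F}_\alpha$, $\theta_1,\dots,\theta_d\in\mathbb{R}$ (such a process exists). One writes $\int g\,dM_\alpha:=I(g)$, where $M_\alpha(A)=I(\mathbf{1}_A)$ is the $\alpha(x)$-multistable measure. $M_{\alpha(u)}$ denotes the same object for the constant index function equal to $\alpha(u)$ ($\alpha(u)$-stable measure). Under the first condition on $h$ the integrand defining $Y(t)$ lies in $\mathcal{F}_\alpha$, so $Y$ is well defined. A process $Y=\{Y(t):t\in\mathbb{R}\}$ is $h$-localisable at $u$ with local form $Y_u'=\{Y_u'(t):t\in\mathbb{R}\}$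 if $r^{-h}(Y(u+rt)-Y(u))\to Y_u'(t)$ in finite-dimensional distributions (as processes in $t$) as $r\to0$, $r>0$, the limit being non-trivial. If $Y$ and $Y_u'$ have versions in $C(\mathbb{R})$ (continuous functions on $\mathbb{R}$) and this convergence occurs in distribution with respect to the metric of uniform convergence on bounded intervals, $Y$ is strongly localisable at $u$. *)

(* Defs.v *)
(* MathComp-Analysis, over an arbitrary R : realType. *)
From HB Require Import structures.
From mathcomp Require Import all_boot all_order all_algebra.
From mathcomp Require Import all_classical all_reals all_analysis.
From mathcomp.real_closed Require Import complex.

Set Implicit Arguments.
Unset Strict Implicit.
Unset Printing Implicit Defensive.

Import Order.TTheory GRing.Theory Num.Theory.
Import numFieldNormedType.Exports.

Local Open Scope classical_set_scope.
Local Open Scope ring_scope.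

Section multistable_integral.
Context {R : realType}.

Definition Fspace (alpha : R -> R) : set (R -> R) :=
  [set g : R -> R | measurable_fun setT g /\
    (\int[@lebesgue_measure R]_x (`|g x| `^ alpha x)%:E < +oo)%E].

Definition expi (y : R) : R[i] := Complex (cos y) (sin y).

Definition cexpectation {d} {T : measurableType d} (P : probability T R)
    (Z : T -> R[i]) : R[i] :=
  Complex (fine 'E_P[fun w => complex.Re (Z w)])
          (fine 'E_P[fun w => complex.Im (Z w)]).

(* [I g] is the integral of [g] against M_alpha for [g] in [Fspace alpha];
   nothing is assumed on the values of [I] outside [Fspace alpha]. *)
Definition multistable_integral {d} {T : measurableType d}
    (P : probability T R) (alpha : R -> R) (I : (R -> R) -> {RV P >-> R}) :=
  forall (n : nat) (g : 'I_n -> R -> R) (theta : 'I_n -> R),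
    (forall j, Fspace alpha (g j)) ->
    cexpectation P (fun w => expi (\sum_(j < n) theta j * I (g j) w)) =
    (expR (- \int[@lebesgue_measure R]_x
               (`|\sum_(j < n) theta j * g j x| `^ alpha x)))%:C%C.

Definition pos_powR (y gamma : R) : R := if 0 < y then y `^ gamma else 0.

Definition lf_kernel (alpha : R -> R) (h t x : R) : R :=
  let gamma := h - (alpha x)^-1 in
  if gamma == 0 then
    if 0 <= t then \1_(`[0, t] : set R) x else - \1_(`[t, 0] : set R) x
  else pos_powR (t - x) gamma - pos_powR (- x) gamma.

(* Linear fractional alpha(x)-multistable motion; for constant alpha, linear
   fractional alpha-stable motion. *)
Definition lf_motion {d} {T : measurableType d} {P : probability T R}
    (alpha : R -> R) (h : R) (I : (R -> R) -> {RV P >-> R}) (t : R) :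
    {RV P >-> R} :=
  I (lf_kernel alpha h t).

End multistable_integral.

Definition bounded_intervals (R : realType) : set (set R) :=
  [set A | exists c d : R, A = [set` `[c, d]]].

(* C(R), with the topology of uniform convergence on bounded intervals. *)
Definition CR (R : realType) : Type := continuousType R R.

Definition eval_CR (R : realType) (f : CR R) : R -> R :=
  (f : continuousType R R).

HB.instance Definition _ (R : realType) :=
  Topological.copy (CR R)
    (initial_topology
      (@eval_CR R : CR R -> {family @bounded_intervals R, R -> R})).

Section localisability.
Context {R : realType}.

Definition rescale (h u r : R) (f : R -> R) (t : R) : R :=
  r `^ (- h) * (f (u + r * t) - f u).

Lemma continuous_rescale (h u r : R) (f : CR R) :
  continuous (rescale h u r (eval_CR f)).
Proof.
move=> t; apply: cvgM; first exact: cvg_cst.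
apply: cvgB; last exact: cvg_cst.
apply: (@continuous_comp _ _ _ (fun s => u + r * s) (eval_CR f)).
  by apply: cvgD; [exact: cvg_cst | apply: cvgM; [exact: cvg_cst | exact: cvg_id]].
exact: (@cts_fun _ _ (f : continuousType R R)).
Qed.

Definition rescale_CR (h u r : R) (f : CR R) : CR R :=
  mkcts (@continuous_rescale h u r f).

Context {d d' : measure_display} {T : measurableType d} {T' : measurableType d'}
  (P : probability T R) (P' : probability T' R).

(* Convergence in distribution, as r -> 0+, of E-valued random elements. It is
   used for E = R^n and E = C(R): on both, coordinatewise measurable maps are
   Borel, so the expectations below are those of bounded random variables. *)
Definition cvg_in_distr {E : topologicalType} (X : R -> T -> E)
    (Z : T' -> E) :=
  forall f : E -> R, continuous f -> (exists M : R, forall e, `|f e| <= M) ->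
    ('E_P[fun w => f (X r w)])%E @[r --> 0^'+] --> ('E_P'[fun w => f (Z w)])%E.

Definition cvg_fdd (X : R -> R -> T -> R) (Z : R -> T' -> R) :=
  forall (n : nat) (t : 'I_n -> R),
    cvg_in_distr (fun r w => \row_(i < n) X r (t i) w)
                 (fun w => \row_(i < n) Z (t i) w).

Definition nontrivial_process (Z : R -> {RV P' >-> R}) :=
  exists t : R, ~ {ae P', forall w, Z t w = 0}.

Definition localisable (h : R) (Y : R -> {RV P >-> R}) (u : R)
    (Z : R -> {RV P' >-> R}) :=
  cvg_fdd (fun r t w => rescale h u r (Y ^~ w) t) Z /\ nontrivial_process Z.

End localisability.

Section strong_localisability.
Context {R : realType}.

Definition continuous_version {d} {T : measurableType d} (P : probability T R)
    (Y : R -> {RV P >-> R}) (Yc : T -> CR R) :=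
  forall t : R, measurable_fun setT (fun w => eval_CR (Yc w) t) /\
    {ae P, forall w, eval_CR (Yc w) t = Y t w}.

Definition strongly_localisable {d d'} {T : measurableType d}
    {T' : measurableType d'} (P : probability T R) (P' : probability T' R)
    (h : R) (Y : R -> {RV P >-> R}) (u : R) (Z : R -> {RV P' >-> R}) :=
  localisable h Y u Z /\
  exists (Yc : T -> CR R) (Zc : T' -> CR R),
    [/\ continuous_version Y Yc, continuous_version Z Zc &
        cvg_in_distr P P' (fun r w => rescale_CR h u r (Yc w)) Zc].

End strong_localisability.

(* Main.v *)
Require Import Defs.
From HB Require Import structures.
From mathcomp Require Import all_boot all_order all_algebra.
From mathcomp Require Import all_classical all_reals all_analysis.
From mathcomp Require Import measurable_realfun.
From mathcomp Require Import ring lra zify.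
Set Implicit Arguments.
Unset Strict Implicit.
Unset Printing Implicit Defensive.
Import Order.TTheory GRing.Theory Num.Theory.
Import numFieldNormedType.Exports.
Local Open Scope classical_set_scope.
Local Open Scope ring_scope.

(* For p in [a, 2] and 0 < h < 1 the increment
   |(t-x)_+^(h-1/p) - (s-x)_+^(h-1/p)|^p is dominated, uniformly in p, by an
   integrable function, so the kernels lie in F_alpha. Substituting x = u + r z
   turns the characteristic functions of r^(-h) (Y(u+rt) - Y(u)) into integrals
   with index function alpha(u + r z), which converge by dominated convergence and
   the continuity of alpha. The same bounds give
     P(|Y(t) - Y(s)| > lam) <= K (|t-s|^h / lam)^a   for lam >= 2 |t-s|^h,
   an estimate invariant under the rescaling; it yields tightness, hence
   finite-dimensional convergence (a multivariate Levy continuity theorem, proved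
   by approximating a bounded continuous function on a box by trigonometric
   polynomials). If a h > 1, dyadic chaining with this tail gives a continuous
   version and a modulus of continuity valid outside a small event for all r at
   once, so interpolation on a dyadic grid reduces convergence in C(R) to the
   finite-dimensional one. *)

(** * Lebesgue integrals of powers *)

(** What is known of [I] is an identity between joint characteristic functions; linearity is not
    assumed. Increments of the motion are therefore reached through finite linear combinations of
    kernels, and tail estimates through expectations of cosines. The obstacle is the variable
    exponent: the integral of [|c * g x| ^ alpha x] does not scale in [c]. When the scale of the
    base is at most 1, the exponent can be lowered to [a]; this is the origin of the power [a] in
    the tail bound and of the restriction on [lam], whose factor 2 bounds [pi / 2]. The tail
    constant depends on [a] and [h] only, so it serves the motion, all its rescalings and the stable
    limit at once. Random paths in [CR] are measurable coordinate by coordinate, so the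
    measurability of a continuous functional of the path is proved along with its convergence, as a
    limit of functions of finitely many coordinates. *)

Section lebesgue_affine.
Context {R : realType}.
Notation mu := (@lebesgue_measure R).

(** Both sides are measures in [A], so agreement on the intervals []x, y]] suffices. For negative
    [k] the preimage is half-open at the other end, which leaves its length unchanged. *)
Lemma lebesgue_measure_affine (s k : R) (k0 : k != 0) (A : set R) :
  measurable A ->
  (`|k|%:E * pushforward mu (fun z : measurableTypeR R => (s + k * z)%R : measurableTypeR R) A = mu A)%E.
Proof.
move=> mA.
have mf : measurable_fun setT (fun z : measurableTypeR R => (s + k * z)%R : measurableTypeR R).
  by apply: measurable_funD => //; exact: measurable_funM.
pose nk := NngNum (normr_ge0 k).
pose m := mscale nk (pushforward mu (fun z : measurableTypeR R => (s + k * z)%R : measurableTypeR R)).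
suff H : forall A, measurable A -> mu A = m mf A by rewrite (H _ mA).
apply: lebesgue_measure_unique => _ [[x y]] _ <-.
change (mu `]x, y] = `|k|%:E * mu ((fun z : R => (s + k * z)%R) @^-1` `]x, y]))%E.
have [kp|kn] := ltP 0 k.
  rewrite [X in (_ * mu X)%E](_ : _ = `](x - s) / k, (y - s) / k]%classic); last first.
    apply/seteqP; split => z /=; rewrite !in_itv/= ltr_pdivrMr// ler_pdivlMr//;
    by rewrite ltrBlDl lerBrDl [z * k]mulrC.
  rewrite !lebesgue_measure_itv/= !lte_fin ltr_pM2r ?invr_gt0// ltrD2r.
  case: ifPn => _; last by rewrite mule0.
  rewrite gtr0_norm// -!EFinD -EFinM; congr EFin.
  by field; lra.
have {}kn : k < 0 by rewrite lt_neqAle k0.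
rewrite [X in (_ * mu X)%E](_ : _ = `[(y - s) / k, (x - s) / k[%classic); last first.
  apply/seteqP; split => z /=; rewrite !in_itv/= ltr_ndivlMr// ler_ndivrMr//;
  by rewrite andbC ltrBlDl lerBrDl [z * k]mulrC.
rewrite !lebesgue_measure_itv/= !lte_fin ltr_nM2r ?invr_lt0// ltrD2r.
case: ifPn => _; last by rewrite mule0.
rewrite ltr0_norm// -!EFinD -EFinM; congr EFin.
by field; lra.
Qed.

Lemma ge0_integral_affine (s k : R) (f : R -> \bar R) : k != 0 ->
  measurable_fun setT f -> (forall x, 0 <= f x)%E ->
  (\int[mu]_x f x = `|k|%:E * \int[mu]_z f (s + k * z)%R)%E.
Proof.
move=> k0 mf f0.
have mg : measurable_fun setT (fun z : measurableTypeR R => (s + k * z)%R : measurableTypeR R).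
  by apply: measurable_funD => //; exact: measurable_funM.
pose nk := NngNum (normr_ge0 k).
pose m := mscale nk (pushforward mu (fun z : measurableTypeR R => (s + k * z)%R : measurableTypeR R)).
rewrite (eq_measure_integral (m mg)).
  rewrite ge0_integral_mscale//=.
  by rewrite ge0_integral_pushforward//= preimage_setT.
by move=> A mA _; rewrite /m /mscale /= -(lebesgue_measure_affine s k0).
Qed.

End lebesgue_affine.

Section integral_powR.
Context {R : realType}.
Notation mu := (@lebesgue_measure R).

Lemma measurable_powRl (e : R) (D : set R) : measurable_fun D (fun x : R => x `^ e).
Proof.
by apply: measurable_funTS; exact: measurable_powR.
Qed.

Lemma integral_powR_segment (e x y : R) : e + 1 != 0 -> 0 < x -> x < y ->
  (\int[mu]_(t in `[x, y]) (t `^ e)%:E =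
   ((y `^ (e + 1) - x `^ (e + 1)) / (e + 1))%:E)%E.
Proof.
move=> e1 x0 xy.
have dF (t : R) : 0 < t -> is_derive t 1 (fun t => t `^ (e + 1) / (e + 1)) (t `^ e).
  move=> t0.
  have dp : derivable (fun t => t `^ (e + 1)) t 1.
    by apply: derivable_powR; rewrite in_itv/= t0.
  apply: DeriveDef.
    by apply: derivableM => //; exact: derivable_cst.
  rewrite deriveM// derive_cst scaler0 add0r.
  rewrite -derive1E powR_derive1 ?in_itv/= ?t0//.
  rewrite /GRing.scale/= addrK.
  by field.
have cpow (t g : R) : 0 < t -> {for t, continuous (fun t => t `^ g)}.
  move=> t0; apply: differentiable_continuous; apply/derivable1_diffP.
  by apply: derivable_powR; rewrite in_itv/= t0.
rewrite (@continuous_FTC2 _ _ (fun t => t `^ (e + 1) / (e + 1)))//.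
- by rewrite -EFinD -mulrBl.
- apply: continuous_in_subspaceT => t; rewrite inE/= in_itv/= => /andP[xt _].
  by apply: cpow; exact: lt_le_trans xt.
- have cF (t : R) : 0 < t -> {for t, continuous (fun t => t `^ (e + 1) / (e + 1))}.
    move=> t0; apply: differentiable_continuous; apply/derivable1_diffP.
    by have := dF t t0; case.
  split => [t||].
  + by rewrite in_itv/= => /andP[xt _]; have := dF t (lt_trans x0 xt); case.
  + by apply: cvg_at_right_filter; exact: cF.
  + by apply: cvg_at_left_filter; apply: cF; lra.
- move=> t; rewrite in_itv/= => /andP[xt _].
  rewrite derive1E; have [_ ->] := dF t (lt_trans x0 xt) => //.
Qed.

Lemma integral_powR_near0 (e : R) : -1 < e ->
  (\int[mu]_(t in `]0%R, 1%R]) (t `^ e)%:E < +oo)%E.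
Proof.
move=> e1.
(* Monotone convergence along segments that avoid the singularity; the shift by 2 keeps them
   nondegenerate. *)
pose F n : set R := `[n.+2%:R^-1, 1]%classic.
have UF : \bigcup_n F n = `]0, 1]%classic.
  apply/seteqP; split => t /=.
    move=> [n _]; rewrite /F /= !in_itv/= => /andP[nt ->]; rewrite andbT.
    by apply: lt_le_trans nt; rewrite invr_gt0.
  rewrite in_itv/= => /andP[t0 t1].
  have [n nt] : exists n : nat, n.+2%:R^-1 <= t.
    exists (Num.truncn t^-1).
    rewrite invf_ple ?posrE//.
    rewrite (le_trans (ltW (truncnS_gt _)))// ler_nat//.
  by exists n => //; rewrite /F /= in_itv/= nt.
have cv : (\int[mu]_(x in F i) (x `^ e)%:E)%E @[i --> \oo] --> (\int[mu]_(t in \bigcup_i F i) (t `^ e)%:E)%E.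
  apply: ge0_nondecreasing_set_cvg_integral.
  - apply/nondecreasing_seqP => n; apply/subsetPset => t; rewrite /F/= !in_itv/= => /andP[nt ->].
    by rewrite andbT (le_trans _ nt)// lef_pV2 ?posrE// ler_nat.
  - by move=> i; exact: measurable_itv.
  - by move=> i; apply: measurableT_comp => //; exact: measurable_powRl.
  - by move=> i t _; rewrite lee_fin powR_ge0.
rewrite UF in cv; apply: (@le_lt_trans _ _ ((e + 1)^-1%:E)); last exact: ltry.
apply: (cvge_to_le cv); near=> n.
rewrite integral_powR_segment; last 3 first.
- by rewrite gt_eqF//; lra.
- by rewrite invr_gt0.
- by rewrite invf_lt1// ltr1n.
rewrite lee_fin powR1 ler_pdivrMr; last by lra.
rewrite mulVf; last by rewrite gt_eqF//; lra.
by rewrite gerBl powR_ge0.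
Unshelve. all: by end_near. Qed.

Lemma integral_powR_tail (e : R) : e < -1 ->
  (\int[mu]_(t in `[1%R, +oo[) (t `^ e)%:E < +oo)%E.
Proof.
move=> e1.
pose F n : set R := `[1, n.+2%:R]%classic.
have UF : \bigcup_n F n = `[1%R, +oo[%classic.
  apply/seteqP; split => t /=.
    by move=> [n _]; rewrite /F /= !in_itv/= => /andP[-> _].
  rewrite in_itv/= andbT => t1.
  exists (Num.truncn t) => //; rewrite /F /= in_itv/= t1/=.
  by rewrite (le_trans (ltW (truncnS_gt _)))// ler_nat.
have cv : (\int[mu]_(x in F i) (x `^ e)%:E)%E @[i --> \oo] --> (\int[mu]_(t in \bigcup_i F i) (t `^ e)%:E)%E.
  apply: ge0_nondecreasing_set_cvg_integral.
  - apply/nondecreasing_seqP => n; apply/subsetPset => t; rewrite /F/= !in_itv/= => /andP[-> nt].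
    by rewrite (le_trans nt)// ler_nat.
  - by move=> i; exact: measurable_itv.
  - by move=> i; apply: measurableT_comp => //; exact: measurable_powRl.
  - by move=> i t _; rewrite lee_fin powR_ge0.
rewrite UF in cv; apply: (@le_lt_trans _ _ ((- (e + 1))^-1%:E)); last exact: ltry.
apply: (cvge_to_le cv); near=> n.
rewrite integral_powR_segment; last 3 first.
- by rewrite lt_eqF//; lra.
- by [].
- by rewrite ltr1n.
rewrite lee_fin powR1; have := powR_ge0 (n.+2%:R : R) (e + 1).
set v := powR _ _ => v0.
have -> : (v - 1) / (e + 1) = (1 - v) / (- (e + 1)) by field; lra.
by rewrite ler_piMl ?invr_ge0//; lra.
Unshelve. all: by end_near. Qed.

End integral_powR.

(** * Inequalities for powers with exponents between 0 and 2 *)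

Section powR_extra.
Context {R : realType}.

Lemma measurable_fun_powR2 d (T : measurableType d) (f g : T -> R) :
  measurable_fun setT f -> measurable_fun setT g ->
  measurable_fun setT (fun x => f x `^ g x).
Proof.
move=> mf mg; rewrite /powR; apply: measurable_fun_ifT.
- exact: (measurable_fun_eqr mf (measurable_cst _)).
- have -> : (fun x => (g x == 0)%:R) = (fun x => if g x == 0 then 1 else 0 : R).
    by apply/funext => x; case: (g x == 0).
  apply: measurable_fun_ifT => //.
  exact: (measurable_fun_eqr mg (measurable_cst _)).
- apply: measurableT_comp => //; apply: measurable_funM => //.
  by apply: measurableT_comp => //; exact: measurable_ln.
Qed.

Lemma ler_powR_homo (p x y : R) : 0 <= p -> 0 <= x -> x <= y -> x `^ p <= y `^ p.
Proof.
by move=> p0 x0 xy; apply: ge0_ler_powR => //; rewrite nnegrE// (le_trans x0).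
Qed.

Lemma powR_le1_exp (x p q : R) : 0 <= x <= 1 -> 0 < p -> p <= q -> x `^ q <= x `^ p.
Proof.
move=> /andP[x0 x1] p0 pq; move: x0; rewrite le_eqVlt => /predU1P[<-|x0].
  by rewrite !powR0// gt_eqF//; lra.
by apply: ger_powR => //; rewrite x0.
Qed.

(** For nonnegative arguments the difference is at most the larger one, so no constant appears,
    whatever the exponent. *)
Lemma powR_norm_subr_le (p x y : R) : 0 <= p -> 0 <= x -> 0 <= y ->
  `|x - y| `^ p <= x `^ p + y `^ p.
Proof.
move=> p0 x0 y0; have := powR_ge0 x p; have := powR_ge0 y p.
have [xy|yx] := leP x y.
  rewrite ler0_norm ?subr_le0// opprB.
  have : (y - x) `^ p <= y `^ p by apply: ler_powR_homo => //; lra.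
  lra.
rewrite gtr0_norm ?subr_gt0//.
have : (x - y) `^ p <= x `^ p by apply: ler_powR_homo => //; lra.
lra.
Qed.

(** [|x + y|] is at most twice the larger norm, and [2 ^ p <= 4]; this treats exponents below and
    above 1 alike. *)
Lemma powR_norm_addr_le (p x y : R) : 0 <= p <= 2 ->
  `|x + y| `^ p <= 4 * (`|x| `^ p + `|y| `^ p).
Proof.
move=> /andP[p0 p2].
have H (u v : R) : `|u| <= `|v| -> `|u + v| `^ p <= 4 * `|v| `^ p.
  move=> uv; rewrite (@le_trans _ _ ((2 * `|v|) `^ p))//.
    apply: ler_powR_homo => //.
    by rewrite (le_trans (ler_normD _ _))//; lra.
  rewrite powRM// ler_wpM2r ?powR_ge0//.
  rewrite (@le_trans _ _ (2 `^ 2))//; first by apply: ler_powR => //; lra.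
  by rewrite powR_mulrn//; lra.
have := powR_ge0 `|x| p; have := powR_ge0 `|y| p => ? ?.
have [/H|/ltW/H] := leP `|x| `|y|; last rewrite addrC.
all: lra.
Qed.

Lemma powR_norm_sum_le (n : nat) (p : R) (x : 'I_n -> R) : 0 < p <= 2 ->
  `|\sum_(i < n) x i| `^ p <= 4 ^+ n * \sum_(i < n) `|x i| `^ p.
Proof.
move=> /andP[p0 p2]; elim: n x => [|n IH] x.
  by rewrite !big_ord0 normr0 powR0 ?mulr0// gt_eqF.
rewrite !big_ord_recl (le_trans (powR_norm_addr_le _ _ _))//=.
  by rewrite (ltW p0) p2.
rewrite exprS -mulrA ler_pM2l// mulrDr lerD//.
by rewrite ler_peMl ?powR_ge0// exprn_ege1//; lra.
Qed.

End powR_extra.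

(** * The fractional kernel and its integrable bound *)

Section fractional_increment.
Context {R : realType}.
Implicit Types (a p h s t x y c : R).

(** The index is frozen at a number [p], so that bounds uniform in [p] and limits in [p] can be
    stated. With [s = 0] and [p = alpha x] this is [lf_kernel] away from the points 0 and [t]. *)
Definition frac_incr p h t s x : R :=
  pos_powR (t - x) (h - p^-1) - pos_powR (s - x) (h - p^-1).

Lemma frac_incrN p h t s x : frac_incr p h t s x = - frac_incr p h s t x.
Proof. by rewrite /frac_incr opprB. Qed.

Lemma pos_powRM k y g : 0 < k -> pos_powR (k * y) g = k `^ g * pos_powR y g.
Proof.
move=> k0; rewrite /pos_powR pmulr_rgt0//; case: ifPn => y0; last by rewrite mulr0.
by rewrite powRM// ltW.
Qed.

(** Self-similarity for a frozen index. After raising to the power [p] the factor is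
    [k ^ (h * p - 1)], and the Jacobian [k] completes it to [k ^ (h * p)]. *)
Lemma frac_incr_affine p h s k t1 t2 z : 0 < k ->
  frac_incr p h (s + k * t1) (s + k * t2) (s + k * z) =
  k `^ (h - p^-1) * frac_incr p h t1 t2 z.
Proof.
move=> k0; rewrite /frac_incr mulrBr -!pos_powRM//.
by congr (pos_powR _ _ - pos_powR _ _); ring.
Qed.

(* [frac_dom a h] dominates [`|frac_incr p h 1 0| `^ p] for all [p] in [a, 2]
   at once: the power singularities at 0 and 1 and the decay at -oo are worst
   at [p = a]. *)
Definition near_dom a h y : R := (y `^ Num.min (h * a - 1) 0) * \1_(`]0, 1] : set R) y.
Definition tail_dom a h y : R := (y `^ (a * (h - 1) - 1)) * \1_(`[1, +oo[ : set R) y.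
Definition frac_dom a h z : R :=
  (3 + (1 + a^-1) ^+ 2) * (near_dom a h (1 - z) + near_dom a h (- z) + tail_dom a h (- z)).

Lemma frac_dom_ge0 a h z : 0 <= frac_dom a h z.
Proof.
by rewrite mulr_ge0 ?addr_ge0 ?sqr_ge0// mulr_ge0 ?powR_ge0// indicE.
Qed.

Lemma measurable_near_dom a h : measurable_fun setT (near_dom a h).
Proof.
apply: measurable_funM; first exact: measurable_powR.
exact: measurable_indic.
Qed.

Lemma measurable_tail_dom a h : measurable_fun setT (tail_dom a h).
Proof.
apply: measurable_funM; first exact: measurable_powR.
exact: measurable_indic.
Qed.

Lemma measurable_frac_dom a h : measurable_fun setT (frac_dom a h).
Proof.
apply: measurable_funM => //; apply: measurable_funD; first apply: measurable_funD.
- by apply: measurableT_comp; [exact: measurable_near_dom|exact: measurable_funB].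
- by apply: measurableT_comp; [exact: measurable_near_dom|exact: measurable_funN].
- by apply: measurableT_comp; [exact: measurable_tail_dom|exact: measurable_funN].
Qed.

(** Both bounds on [h] enter here: [0 < h] puts the exponent at the singularities above -1, and
    [h < 1] puts the exponent of the tail below -1. *)
Lemma integral_frac_dom_lty a h : 0 < a -> 0 < h < 1 ->
  (\int[@lebesgue_measure R]_z (frac_dom a h z)%:E < +oo)%E.
Proof.
move=> a0 /andP[h0 h1].
have near_lty : (\int[@lebesgue_measure R]_z (near_dom a h z)%:E < +oo)%E.
  rewrite [ltLHS](_ : _ = (\int[lebesgue_measure]_(t in `]0%R, 1%R]) (t `^ Num.min (h * a - 1) 0)%:E)%E).
    apply: integral_powR_near0; rewrite lt_min; apply/andP; split; last by lra.
    by have := mulr_gt0 h0 a0; lra.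
  rewrite [RHS]integral_mkcond; apply: eq_integral => z _.
  by rewrite /near_dom epatch_indic -EFinM.
have tail_lty : (\int[@lebesgue_measure R]_z (tail_dom a h z)%:E < +oo)%E.
  rewrite [ltLHS](_ : _ = (\int[lebesgue_measure]_(t in `[1%R, +oo[) (t `^ (a * (h - 1) - 1))%:E)%E).
    apply: integral_powR_tail.
    have : 0 < a * (1 - h) by rewrite mulr_gt0// subr_gt0.
    by lra.
  rewrite [RHS]integral_mkcond; apply: eq_integral => z _.
  by rewrite /tail_dom epatch_indic -EFinM.
have n0 z : (0%:E <= (near_dom a h z)%:E)%E.
  by rewrite lee_fin mulr_ge0// ?powR_ge0// indicE.
have t0 z : (0%:E <= (tail_dom a h z)%:E)%E.
  by rewrite lee_fin mulr_ge0// ?powR_ge0// indicE.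
have mn : measurable_fun setT (EFin \o near_dom a h).
  by apply/measurable_EFinP; exact: measurable_near_dom.
have mt : measurable_fun setT (EFin \o tail_dom a h).
  by apply/measurable_EFinP; exact: measurable_tail_dom.
have m1 : measurable_fun setT (fun z : R => (near_dom a h (1 - z))%:E).
  by apply/measurable_EFinP/measurableT_comp; [exact: measurable_near_dom|exact: measurable_funB].
have m2 : measurable_fun setT (fun z : R => (near_dom a h (- z))%:E).
  by apply/measurable_EFinP/measurableT_comp; [exact: measurable_near_dom|exact: measurable_funN].
have m3 : measurable_fun setT (fun z : R => (tail_dom a h (- z))%:E).
  by apply/measurable_EFinP/measurableT_comp; [exact: measurable_tail_dom|exact: measurable_funN].
rewrite /frac_dom; under eq_integral do rewrite EFinM !EFinD.
rewrite ge0_integralZl//; last 3 first.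
- by apply: emeasurable_funD => //; exact: emeasurable_funD.
- by move=> z _; rewrite !adde_ge0.
- by rewrite lee_fin addr_ge0// sqr_ge0.
rewrite ge0_integralD//; last 2 first.
- by move=> z _; rewrite adde_ge0.
- exact: emeasurable_funD.
rewrite ge0_integralD//.
rewrite lte_mul_pinfty// ?lee_fin ?addr_ge0 ?sqr_ge0//.
have N1 : (-1 : R) != 0 by rewrite oppr_eq0 oner_eq0.
have near1_lty : (\int[@lebesgue_measure R]_z (near_dom a h (1 - z))%:E < +oo)%E.
  move: near_lty; rewrite (ge0_integral_affine 1 N1)// normrN1 mul1e.
  by under eq_integral do rewrite mulN1r.
have near0_lty : (\int[@lebesgue_measure R]_z (near_dom a h (- z))%:E < +oo)%E.
  move: near_lty; rewrite (ge0_integral_affine 0 N1)// normrN1 mul1e.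
  by under eq_integral do rewrite mulN1r add0r.
have tail0_lty : (\int[@lebesgue_measure R]_z (tail_dom a h (- z))%:E < +oo)%E.
  move: tail_lty; rewrite (ge0_integral_affine 0 N1)// normrN1 mul1e.
  by under eq_integral do rewrite mulN1r add0r.
by apply: lte_add_pinfty tail0_lty; exact: lte_add_pinfty.
Qed.

Lemma frac_incr01_le a h p z : 0 < a -> 0 < h < 1 -> a <= p <= 2 ->
  `|frac_incr p h 1 0 z| `^ p <= frac_dom a h z.
Proof.
move=> a0 /andP[h0 h1] /andP[ap p2].
have p0 : 0 < p by lra.
have Ep : (h - p^-1) * p = h * p - 1 by field; lra.
have e0le y : 0 < y <= 1 -> y `^ (h * p - 1) <= near_dom a h y.
  move=> y01; rewrite /near_dom indicE mem_set/= ?mulr1; last by rewrite in_itv.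
  apply: ger_powR => //.
  rewrite ge_min; apply/orP; left; rewrite lerD2r ler_pM2l//.
have near0 y : 0 < y <= 1 -> 1 <= near_dom a h y.
  move=> y01; rewrite /near_dom indicE mem_set/= ?mulr1; last by rewrite in_itv.
  rewrite -[leLHS](powRr0 y); apply: ger_powR => //.
  by rewrite ge_min lexx orbT.
(* Of the constant in [frac_dom], the summand 3 serves the neighbourhoods of the singularities; the
   square serves the tail, where [|h - 1/p| <= 1 + 1/a] is raised to a power [p <= 2]. *)
have C3 : 3 <= 3 + (1 + a^-1) ^+ 2 by rewrite lerDl sqr_ge0.
have n0 y : 0 <= near_dom a h y by rewrite mulr_ge0// ?powR_ge0// indicE.
have t0 y : 0 <= tail_dom a h y by rewrite mulr_ge0// ?powR_ge0// indicE.
have [z1|z1] := leP 1 z.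
  rewrite /frac_incr /pos_powR ltNge subr_le0 z1/= ltNge subr_le0.
  rewrite (le_trans ler01)//= subrr normr0 powR0 ?frac_dom_ge0// gt_eqF//.
have [z0|z0] := leP 0 z.
  rewrite /frac_incr /pos_powR subr_gt0 z1 subr_gt0 ltNge z0/= subr0.
  rewrite ger0_norm ?powR_ge0// -powRrM Ep.
  apply: (le_trans (e0le _ _)); first lra.
  rewrite /frac_dom; set C := (3 + _ in leRHS).
  rewrite (@le_trans _ _ (1 * (near_dom a h (1 - z) + near_dom a h (- z) + tail_dom a h (- z))))//.
    by rewrite mul1r; have := n0 (- z); have := t0 (- z); lra.
  by rewrite ler_wpM2r// ?addr_ge0//; rewrite /C; lra.
rewrite /frac_incr /pos_powR subr_gt0 z1 subr_gt0 z0 sub0r.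
(* For [- z <= 1] the power of [1 - z] is at most 2 because [h * p - 1 <= 1]. Since [near_dom] is at
   least 1 there (the reason for the minimum with 0 in its exponent), three copies of it suffice. *)
have [y1|y1] := leP (- z) 1.
  apply: (le_trans (powR_norm_subr_le _ _ _)); [lra|exact: powR_ge0|exact: powR_ge0|].
  rewrite -!powRrM Ep.
  have H1 : (1 - z) `^ (h * p - 1) <= 2.
    rewrite (@le_trans _ _ ((1 - z) `^ 1))//; last by rewrite powRr1; lra.
    apply: ler_powR; first lra.
    have : h * p <= 1 * 2 by apply: ler_pM => //; lra.
    lra.
  have H2 := e0le (- z); have H3 := near0 (- z).
  rewrite /frac_dom (@le_trans _ _ (3 * near_dom a h (- z)))//.
    have := H2 ltac:(lra); have := H3 ltac:(lra); lra.
  apply: ler_pM => //; have := n0 (1 - z); have := t0 (- z); lra.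
set y := - z in y1 *; have -> : 1 - z = y + 1 by rewrite /y addrC.
set g := h - p^-1 in Ep *.
have pi0 : 0 < p^-1 by rewrite invr_gt0.
have ai0 : 0 < a^-1 by rewrite invr_gt0.
have g1 : g < 1 by rewrite /g; lra.
have ng : `|g| <= 1 + a^-1.
  have : p^-1 <= a^-1 by rewrite lef_pV2 ?posrE.
  by rewrite /g ler_norml; lra.
(* Far to the left the two powers nearly cancel: the mean value theorem gains one power of [y], and
   since [g - 1 < 0] the derivative is largest at the left end. *)
have mvt : `|(y + 1) `^ g - y `^ g| <= (1 + a^-1) * y `^ (g - 1).
  have dp x : x \in `]y, y + 1[ -> is_derive x 1 (fun t => t `^ g) (g * x `^ (g - 1)).
    rewrite in_itv/= => /andP[yx _]; have x0 : 0 < x by lra.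
    apply: DeriveDef; first by apply: derivable_powR; rewrite in_itv/= x0.
    by rewrite -derive1E powR_derive1 ?in_itv/= ?x0.
  have cp : {within `[y, y + 1], continuous (fun t => t `^ g)}.
    apply: derivable_within_continuous => x; rewrite in_itv/= => /andP[yx _].
    by apply: derivable_powR; rewrite in_itv/=; lra.
  have [|x + ->] := MVT _ dp cp; first lra.
  rewrite in_itv/= => /andP[yx _].
  have -> : y + 1 - y = 1 by ring.
  rewrite mulr1 normrM [`|_ `^ _|]ger0_norm ?powR_ge0//.
  apply: ler_pM => //; first exact: powR_ge0.
  have -> : g - 1 = - (1 - g) by ring.
  rewrite !powRN lef_pV2 ?posrE ?powR_gt0//; [|lra|lra].
  by apply: ler_powR_homo; lra.
have A0 : 0 <= 1 + a^-1 by lra.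
rewrite (@le_trans _ _ (((1 + a^-1) * y `^ (g - 1)) `^ p))//.
  by apply: ler_powR_homo => //; lra.
rewrite powRM ?powR_ge0// -powRrM.
rewrite /frac_dom (@le_trans _ _ ((3 + (1 + a^-1) ^+ 2) * tail_dom a h y))//; last first.
  by rewrite ler_wpM2l//; [lra|have := n0 (1 - z); have := n0 (- z); lra].
apply: ler_pM; [exact: powR_ge0|exact: powR_ge0| |].
  rewrite (@le_trans _ _ ((1 + a^-1) `^ 2))//.
    by apply: ler_powR => //; lra.
  by rewrite powR_mulrn//; lra.
rewrite /tail_dom indicE mem_set/= ?mulr1; last by rewrite in_itv/=; lra.
apply: ler_powR; first lra.
rewrite mulrBl Ep mul1r.
have : (p - a) * (1 - h) >= 0 by rewrite mulr_ge0; lra.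
lra.
Qed.

(** The affine map taking [s] to 0 and [t] to 1 reduces this to [frac_incr01_le]. The division by
    [t - s] will be cancelled by the Jacobian on integration. *)
Lemma frac_incr_le a h p c s t x : 0 < a -> 0 < h < 1 -> a <= p <= 2 -> s < t ->
  `|c * frac_incr p h t s x| `^ p <=
  (`|c| * (t - s) `^ h) `^ p / (t - s) * frac_dom a h ((x - s) / (t - s)).
Proof.
move=> a0 h01 p12 st.
have p0 : 0 < p by lra.
set k := t - s; have k0 : 0 < k by rewrite subr_gt0.
set z := (x - s) / k.
have -> : frac_incr p h t s x = k `^ (h - p^-1) * frac_incr p h 1 0 z.
  rewrite -(frac_incr_affine _ _ s)//; congr (frac_incr p h _ _ _).
  - by rewrite /k; ring.
  - by ring.
  - by rewrite /z; field; lra.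
rewrite mulrA normrM [in leLHS]powRM//.
rewrite ler_pM ?powR_ge0 ?frac_incr01_le//.
rewrite normrM [`|_ `^ _|]ger0_norm ?powR_ge0//.
rewrite !powRM ?powR_ge0// -!powRrM -mulrA ler_wpM2l ?powR_ge0//.
have -> : (h - p^-1) * p = h * p - 1 by field; lra.
by rewrite powRB ?(gt_eqF k0) ?implybT// powRr1// ltW.
Qed.

End fractional_increment.

(** * Integrals of kernel increments under a variable index *)

Section fractional_integrals.
Context {R : realType}.
Implicit Types (a p h s t x y c : R).
Notation mu := (@lebesgue_measure R).

Lemma ae_off_points (s : seq R) (Q : R -> Prop) :
  (forall x, x \notin s -> Q x) -> {ae mu, forall x, Q x}.
Proof.
move=> sQ; exists [set` s]; split.
- have : finite_set [set` s] by [].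
  by move=> /finite_set_countable; exact: countable_measurable.
- by apply: countable_lebesgue_measure0; exact: finite_set_countable.
- by move=> x /= nQ; apply/negPn/negP => /sQ.
Qed.

(** The delicate case is a base tending to 0, where the logarithm is lost: eventually the exponent
    is at least [p / 2] and the base is at most 1 and at most [e ^ (2 / p)], whose power [p / 2] is
    [e]. *)
Lemma cvg_powR2 {T : Type} {F : set_system T} {FF : Filter F}
    (f g : T -> R) (x p : R) : (forall w, 0 <= f w) -> 0 <= x -> 0 < p ->
  f w @[w --> F] --> x -> g w @[w --> F] --> p ->
  (f w `^ g w) @[w --> F] --> x `^ p.
Proof.
move=> f0 x0 p0 fx gp; move: x0; rewrite le_eqVlt => /predU1P[x0|x0]; last first.
  have E : x `^ p = expR (p * ln x) by rewrite /powR gt_eqF.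
  rewrite E; apply: (@cvg_trans _ ((fun w => expR (g w * ln (f w))) @ F)).
    apply: near_eq_cvg; near=> w.
    have fw0 : 0 < f w by near: w; exact: (cvgr_gt x).
    by rewrite /powR gt_eqF.
  apply: continuous_cvg; first exact: continuous_expR.
  apply: cvgM => //; apply: continuous_cvg => //; exact: continuous_ln.
rewrite -x0 powR0 ?gt_eqF//; apply/cvgr0Pnorm_le => e e0.
have e1 : 0 < e `^ (2 / p) by apply: powR_gt0.
near=> w.
rewrite ger0_norm ?powR_ge0//.
have fw1 : f w <= 1 by near: w; apply: (cvgr_le x) => //; rewrite -x0 ltr01.
have fw2 : f w <= e `^ (2 / p) by near: w; apply: (cvgr_le x) => //; rewrite -x0.
have gw : p / 2 <= g w by near: w; apply: (cvgr_ge p) => //; lra.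
rewrite (@le_trans _ _ (f w `^ (p / 2)))//.
  by apply: powR_le1_exp => //; [rewrite f0|lra].
rewrite (@le_trans _ _ ((e `^ (2 / p)) `^ (p / 2)))//.
  by apply: ler_powR_homo => //; lra.
rewrite -powRrM (_ : 2 / p * (p / 2) = 1); last by field; lra.
by rewrite powRr1// ltW.
Unshelve. all: by end_near. Qed.

(** There is no jump at exponent 0: [pos_powR] is constantly 0 for a nonpositive base and an
    exponential of the exponent for a positive one. *)
Lemma cvg_frac_incr {T : Type} {F : set_system T} {FF : Filter F}
    (f : T -> R) p h t s x : 0 < p -> f w @[w --> F] --> p ->
  frac_incr (f w) h t s x @[w --> F] --> frac_incr p h t s x.
Proof.
move=> p0 fp; have H y : pos_powR y (h - (f w)^-1) @[w --> F] --> pos_powR y (h - p^-1).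
  rewrite /pos_powR; case: ifPn => y0; last exact: cvg_cst.
  under eq_fun do rewrite /powR gt_eqF//.
  rewrite /powR gt_eqF//; apply: continuous_cvg; first exact: continuous_expR.
  apply: cvgM; last exact: cvg_cst.
  by apply: cvgB; [exact: cvg_cst|apply: cvgV => //; rewrite gt_eqF].
exact: cvgB.
Qed.

Lemma measurable_frac_incr (alpha : R -> R) h t s :
  measurable_fun setT alpha -> (forall x, 0 < alpha x) ->
  measurable_fun setT (fun x => frac_incr (alpha x) h t s x).
Proof.
move=> ma a0; have H y : measurable_fun setT (fun x => pos_powR (y - x) (h - (alpha x)^-1)).
  have mB : measurable_fun setT (fun x : R => y - x) by exact: measurable_funB.
  apply: measurable_fun_ifT => //; first exact: measurable_fun_ltr.
  apply: measurable_fun_powR2 => //; apply: measurable_funB => //.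
  rewrite (_ : (fun x => (alpha x)^-1) = (fun x => alpha x `^ (-1))).
    exact: measurable_fun_powR2.
  by apply/funext => x; rewrite powR_inv1// ltW.
exact: measurable_funB.
Qed.

Lemma lf_kernelE (alpha : R -> R) h t x : x \notin [:: 0; t] ->
  lf_kernel alpha h t x = frac_incr (alpha x) h t 0 x.
Proof.
rewrite !inE negb_or /lf_kernel /frac_incr sub0r => /andP[x0 xt].
case: ifPn => // /eqP ->; rewrite /pos_powR !powRr0 subr_gt0 oppr_gt0.
rewrite !indicE !mem_setE !in_itv/=.
have [t0|t0] := leP 0 t.
  rewrite [0 <= x]le_eqVlt [x <= t]le_eqVlt (negbTE xt) eq_sym (negbTE x0)/=.
  by have [xl|xl|xl] := ltgtP x 0; have [xl'|xl'|xl'] := ltgtP x t => //=; lra.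
rewrite [x <= 0]le_eqVlt [t <= x]le_eqVlt (negbTE x0) eq_sym (negbTE xt)/=.
by have [xl|xl|xl] := ltgtP x 0; have [xl'|xl'|xl'] := ltgtP x t => //=; lra.
Qed.

Lemma measurable_lf_kernel (alpha : R -> R) h t :
  measurable_fun setT alpha -> (forall x, 0 < alpha x) ->
  measurable_fun setT (lf_kernel alpha h t).
Proof.
move=> ma a0; rewrite /lf_kernel.
have mV : measurable_fun setT (fun x => h - (alpha x)^-1).
  apply: measurable_funB => //.
  rewrite (_ : (fun x => (alpha x)^-1) = (fun x => alpha x `^ (-1))).
    exact: measurable_fun_powR2.
  by apply/funext => x; rewrite powR_inv1// ltW.
apply: measurable_fun_ifT.
- exact: measurable_fun_eqr.
- case: (0 <= t); first exact: measurable_indic.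
  by apply: measurable_funN; exact: measurable_indic.
- have := measurable_frac_incr h t 0 ma a0; rewrite /frac_incr.
  by under eq_fun do rewrite sub0r.
Qed.

Lemma integral_frac_dom_affine a h s t : s < t ->
  (\int[mu]_x (frac_dom a h ((x - s) / (t - s)))%:E =
   (t - s)%:E * \int[mu]_z (frac_dom a h z)%:E)%E.
Proof.
move=> st; have k0 : 0 < t - s by rewrite subr_gt0.
have mG : measurable_fun setT (fun x => (frac_dom a h ((x - s) / (t - s)))%:E).
  apply/measurable_EFinP/measurableT_comp; first exact: measurable_frac_dom.
  by apply: measurable_funM => //; exact: measurable_funB.
rewrite (ge0_integral_affine s (lt0r_neq0 k0))//; last first.
  by move=> x; rewrite lee_fin frac_dom_ge0.
rewrite gtr0_norm//; congr (_ * _)%E; apply: eq_integral => z _.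
by congr (frac_dom _ _ _)%:E; field; lra.
Qed.

(** The smallness condition makes the scale of the increment at most 1, so the exponent [alpha x]
    may be replaced by [a]. The constant is the integral of [frac_dom] and precedes [alpha], so it
    is shared by all index functions. *)
Lemma integral_frac_incr_le a h : 0 < a -> 0 < h < 1 ->
  exists2 C, 0 <= C & forall (alpha : R -> R) c t s,
    measurable_fun setT alpha -> (forall x, a <= alpha x <= 2) ->
    `|c| * `|t - s| `^ h <= 1 ->
    (\int[mu]_x (`|c * frac_incr (alpha x) h t s x| `^ alpha x)%:E <=
      (C * (`|c| * `|t - s| `^ h) `^ a)%:E)%E.
Proof.
move=> a0 h01.
have Gfin := integral_frac_dom_lty a0 h01.
have G0 : (0 <= \int[mu]_z (frac_dom a h z)%:E)%E.
  by apply: integral_ge0 => z _; rewrite lee_fin frac_dom_ge0.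
exists (fine (\int[mu]_z (frac_dom a h z)%:E)); first exact: fine_ge0.
move=> alpha c t s ma aal.
have al0 x : 0 < alpha x by case/andP: (aal x) => + _; lra.
wlog st : s t / s < t => [W ct|].
  have [st|ts|<-] := ltgtP s t; first exact: W.
    rewrite distrC in ct *; under eq_integral do rewrite frac_incrN mulrN normrN.
    exact: W.
  under eq_integral do rewrite /frac_incr subrr mulr0 normr0 powR0 ?gt_eqF//.
  by rewrite integral0 lee_fin mulr_ge0 ?fine_ge0 ?powR_ge0.
have k0 : 0 < t - s by rewrite subr_gt0.
rewrite (gtr0_norm k0) => ct.
have mG : measurable_fun setT (fun x => (frac_dom a h ((x - s) / (t - s)))%:E).
  apply/measurable_EFinP/measurableT_comp; first exact: measurable_frac_dom.
  by apply: measurable_funM => //; exact: measurable_funB.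
have c0 : 0 <= `|c| * (t - s) `^ h by rewrite mulr_ge0 ?powR_ge0.
pose K := (`|c| * (t - s) `^ h) `^ a / (t - s).
have K0 : 0 <= K by rewrite divr_ge0 ?powR_ge0// ltW.
apply: (@le_trans _ _ (\int[mu]_x (K%:E * (frac_dom a h ((x - s) / (t - s)))%:E))%E).
  apply: ge0_le_integral => //.
  - apply/measurable_EFinP; apply: measurable_fun_powR2 => //.
    apply: measurableT_comp => //; apply: measurable_funM => //.
    exact: measurable_frac_incr.
  - exact: measurable_funeM.
  - move=> x _; rewrite -EFinM lee_fin.
    apply: (le_trans (frac_incr_le _ _ a0 h01 (aal x) st)).
    rewrite ler_wpM2r ?frac_dom_ge0// ler_wpM2r ?invr_ge0 ?(ltW k0)//.
    apply: powR_le1_exp => //; first by rewrite c0.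
    by case/andP: (aal x).
rewrite ge0_integralZl//; last by move=> x _; rewrite lee_fin frac_dom_ge0.
rewrite integral_frac_dom_affine//.
rewrite muleA -EFinM /K.
rewrite divfK ?lt0r_neq0// EFinM fineK ?ge0_fin_numE//.
by rewrite muleC.
Qed.

(** One dominating function for all [p], with no smallness condition: the scale is increased to at
    least 1 and then squared, as [p <= 2]. It serves dominated convergence with a moving index. *)
Lemma frac_incr_dominated a h c t s : 0 < a -> 0 < h < 1 ->
  exists2 D : R -> R, mu.-integrable setT (EFin \o D) &
    forall p x, a <= p <= 2 -> `|c * frac_incr p h t s x| `^ p <= D x.
Proof.
move=> a0 h01; wlog st : s t / s < t => [W|].
  have [st|ts|<-] := ltgtP s t; first exact: W.
    have [D iD DP] := W _ _ ts; exists D; first exact: iD.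
    move=> p x ap.
    by rewrite frac_incrN mulrN normrN; exact: DP.
  exists (cst 0); first exact: integrable0.
  move=> p x ap; rewrite /frac_incr subrr mulr0 normr0 powR0// gt_eqF//; lra.
have k0 : 0 < t - s by rewrite subr_gt0.
have c0 : 0 <= `|c| * (t - s) `^ h by rewrite mulr_ge0 ?powR_ge0.
pose K := (1 + `|c| * (t - s) `^ h) ^+ 2 / (t - s).
have K0 : 0 <= K by rewrite divr_ge0 ?sqr_ge0// ltW.
have mG : measurable_fun setT (fun x => (frac_dom a h ((x - s) / (t - s)))%:E).
  apply/measurable_EFinP/measurableT_comp; first exact: measurable_frac_dom.
  by apply: measurable_funM => //; exact: measurable_funB.
exists (fun x => K * frac_dom a h ((x - s) / (t - s))); last first.
  move=> p x ap; apply: (le_trans (frac_incr_le _ _ a0 h01 ap st)).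
  rewrite ler_wpM2r ?frac_dom_ge0// ler_wpM2r ?invr_ge0 ?(ltW k0)//.
  rewrite (@le_trans _ _ ((1 + `|c| * (t - s) `^ h) `^ p))//.
    by apply: ler_powR_homo; lra.
  rewrite -powR_mulrn; last lra.
  by apply: ler_powR; lra.
apply/integrableP; split; first by apply/measurable_EFinP/measurable_funM => //; apply/measurable_EFinP.
under eq_integral => x _ do
  rewrite /= ger0_norm ?(mulr_ge0 K0 (frac_dom_ge0 _ _ _))// EFinM.
rewrite ge0_integralZl//; last by move=> x _; rewrite lee_fin frac_dom_ge0.
rewrite integral_frac_dom_affine//.
rewrite muleA -EFinM lte_mul_pinfty//; first by rewrite lee_fin mulr_ge0 ?(ltW k0).
exact: integral_frac_dom_lty.
Qed.

Lemma Fspace_lf_kernel a h (alpha : R -> R) t : 0 < a -> 0 < h < 1 ->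
  measurable_fun setT alpha -> (forall x, a <= alpha x <= 2) ->
  Fspace alpha (lf_kernel alpha h t).
Proof.
move=> a0 h01 ma aal.
have al0 x : 0 < alpha x by case/andP: (aal x) => + _; lra.
split; first exact: measurable_lf_kernel.
have [D /integrableP[mD iD] DP] := frac_incr_dominated 1 t 0 a0 h01.
apply: le_lt_trans iD; apply: ae_ge0_le_integral => //.
- apply/measurable_EFinP; apply: measurable_fun_powR2 => //.
  by apply: measurableT_comp => //; exact: measurable_lf_kernel.
- exact: measurableT_comp.
- apply: (@ae_off_points [:: 0; t]) => x xt _.
  rewrite (lf_kernelE _ _ xt) lee_fin (le_trans _ (ler_norm _))//.
  by have := DP (alpha x) x (aal x); rewrite mul1r.
Qed.

End fractional_integrals.

(** * Approximation by trigonometric polynomials *)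

Section trigonometric_approximation.
Context {R : realType}.

Lemma norm_cos_subr1 (u : R) : 0 <= 1 - cos u <= `|u|.
Proof.
rewrite subr_ge0 cos_le1/=; wlog u0 : u / 0 <= u => [W|].
  have [/W//|/ltW u0] := leP 0 u.
  by rewrite -cosN -normrN; apply: W; rewrite oppr_ge0.
have [|c _ E] := MVT_segment u0 (fun x _ => is_derive_cos x).
  by apply: continuous_subspaceT => x; exact: continuous_cos.
have -> : 1 - cos u = sin c * u by move: E; rewrite cos0 subr0; lra.
rewrite ger0_norm//.
by rewrite ler_piMl// sin_le1.
Qed.

(** A quadratic error is enough: [L * sin (x / L)] then differs from [x] by at most [x ^ 2 / L]. *)
Lemma norm_id_subr_sin (u : R) : `|u - sin u| <= u ^+ 2.
Proof.
wlog u0 : u / 0 <= u => [W|].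
  have [/W//|/ltW u0] := leP 0 u.
  by have := W (- u); rewrite oppr_ge0 sinN sqrrN -opprD normrN => /(_ u0).
have dsub x : x \in `]0, u[%R -> is_derive x 1 (fun x => x - sin x) (1 - cos x).
  by move=> _; exact: is_deriveB.
have [|c + E] := MVT_segment u0 dsub.
  apply: continuous_subspaceT => x; apply: cvgB => //; exact: continuous_sin.
rewrite in_itv/= => /andP[c0 cu].
have -> : u - sin u = (1 - cos c) * u by move: E; rewrite sin0 !subr0.
have /andP[C0 C1] := norm_cos_subr1 c.
rewrite normrM ger0_norm// ger0_norm// expr2 ler_wpM2r// (le_trans C1)//.
by rewrite ger0_norm.
Qed.

(** Products are not a constructor, so convergence of expectations passes through the constructors
    by linearity. Closure under products is recovered in [trigpolyM] from the addition formulas. *)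
Inductive trigpoly n : ('rV[R]_n -> R) -> Prop :=
| trigpoly_cos (th : 'I_n -> R) : trigpoly (fun x => cos (\sum_(i < n) th i * x 0 i))
| trigpoly_sin (th : 'I_n -> R) : trigpoly (fun x => sin (\sum_(i < n) th i * x 0 i))
| trigpolyD (f g : 'rV[R]_n -> R) :
    trigpoly f -> trigpoly g -> trigpoly (fun x => f x + g x)
| trigpolyZ (c : R) (f : 'rV[R]_n -> R) : trigpoly f -> trigpoly (fun x => c * f x).

Lemma eq_trigpoly n (f g : 'rV[R]_n -> R) : f =1 g -> trigpoly f -> trigpoly g.
Proof. by move=> /funext ->. Qed.

Lemma trigpoly_cst n (c : R) : trigpoly (fun _ : 'rV[R]_n => c).
Proof.
apply: eq_trigpoly (trigpolyZ c (trigpoly_cos (fun _ : 'I_n => 0))) => x.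
by rewrite big1 ?cos0 ?mulr1// => i _; rewrite mul0r.
Qed.

Lemma trigpoly_sin_coord n (i : 'I_n) (c : R) :
  trigpoly (fun x : 'rV[R]_n => sin (c * x 0 i)).
Proof.
apply: eq_trigpoly (trigpoly_sin (fun j => if j == i then c else 0)) => x.
rewrite (bigD1 i)//= eqxx big1 ?addr0// => j /negbTE ->.
by rewrite mul0r.
Qed.

Lemma sum_coordD n (th et : 'I_n -> R) (x : 'rV[R]_n) :
  \sum_(i < n) (th i + et i) * x 0 i = \sum_(i < n) th i * x 0 i + \sum_(i < n) et i * x 0 i.
Proof. by rewrite -big_split/=; apply: eq_bigr => i _; rewrite mulrDl. Qed.

Lemma sum_coordB n (th et : 'I_n -> R) (x : 'rV[R]_n) :
  \sum_(i < n) (th i - et i) * x 0 i = \sum_(i < n) th i * x 0 i - \sum_(i < n) et i * x 0 i.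
Proof. by rewrite -sumrB/=; apply: eq_bigr => i _; rewrite mulrBl. Qed.

Lemma trigpolyM n (f g : 'rV[R]_n -> R) :
  trigpoly f -> trigpoly g -> trigpoly (fun x => f x * g x).
Proof.
move=> tf tg; elim: tf => {f} [th|th|f1 f2 _ IH1 _ IH2|c f _ IH].
- elim: tg => {g} [et|et|g1 g2 _ IH1 _ IH2|c g _ IH].
  + apply: eq_trigpoly (trigpolyZ 2^-1 (trigpolyD
      (trigpoly_cos (fun i => th i + et i)) (trigpoly_cos (fun i => th i - et i)))) => x.
    by rewrite sum_coordB sum_coordD cosB cosD; field.
  + apply: eq_trigpoly (trigpolyZ 2^-1 (trigpolyD
      (trigpoly_sin (fun i => th i + et i))
      (trigpolyZ (-1) (trigpoly_sin (fun i => th i - et i))))) => x.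
    by rewrite sum_coordB sum_coordD sinB sinD; field.
  + by apply: eq_trigpoly (trigpolyD IH1 IH2) => x; rewrite mulrDr.
  + by apply: eq_trigpoly (trigpolyZ c IH) => x; rewrite mulrCA.
- elim: tg => {g} [et|et|g1 g2 _ IH1 _ IH2|c g _ IH].
  + apply: eq_trigpoly (trigpolyZ 2^-1 (trigpolyD
      (trigpoly_sin (fun i => th i + et i)) (trigpoly_sin (fun i => th i - et i)))) => x.
    by rewrite sum_coordB sum_coordD sinB sinD; field.
  + apply: eq_trigpoly (trigpolyZ 2^-1 (trigpolyD
      (trigpoly_cos (fun i => th i - et i))
      (trigpolyZ (-1) (trigpoly_cos (fun i => th i + et i))))) => x.
    by rewrite sum_coordB sum_coordD cosB cosD; field.
  + by apply: eq_trigpoly (trigpolyD IH1 IH2) => x; rewrite mulrDr.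
  + by apply: eq_trigpoly (trigpolyZ c IH) => x; rewrite mulrCA.
- by apply: eq_trigpoly (trigpolyD IH1 IH2) => x; rewrite mulrDl.
- by apply: eq_trigpoly (trigpolyZ c IH) => x; rewrite mulrA.
Qed.

(* Expectation of [phi] at the end of a walk started at [y] that moves by
   [+- eta] along the successive coordinates in [l], with mean [eta * s i]. *)
Fixpoint walk n (eta : R) (l : seq 'I_n) (s : 'I_n -> R) (phi : 'rV[R]_n -> R)
    (y : 'rV[R]_n) : R :=
  if l is i :: l' then
    (1 + s i) / 2 * walk eta l' s phi (y + eta *: delta_mx 0 i) +
    (1 - s i) / 2 * walk eta l' s phi (y - eta *: delta_mx 0 i)
  else phi y.

Section walk_theory.
Variables (n : nat) (eta : R) (s : 'I_n -> R).
Hypothesis s1 : forall i, `|s i| <= 1.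

Let wp i : 0 <= (1 + s i) / 2. Proof. by have := s1 i; rewrite ler_norml; lra. Qed.
Let wm i : 0 <= (1 - s i) / 2. Proof. by have := s1 i; rewrite ler_norml; lra. Qed.

Lemma le_walk l (phi psi : 'rV[R]_n -> R) y : (forall z, phi z <= psi z) ->
  walk eta l s phi y <= walk eta l s psi y.
Proof.
move=> H; elim: l y => //= i l IH y.
by rewrite lerD// ler_wpM2l.
Qed.

Lemma walk_cst l c y : walk eta l s (fun=> c) y = c.
Proof. by elim: l y => //= i l IH y; rewrite !IH; field. Qed.

Lemma walkD l (phi psi : 'rV[R]_n -> R) y :
  walk eta l s (fun z => phi z + psi z) y = walk eta l s phi y + walk eta l s psi y.
Proof. by elim: l y => //= i l IH y; rewrite !IH; ring. Qed.

Lemma walkZ l c (phi : 'rV[R]_n -> R) y :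
  walk eta l s (fun z => c * phi z) y = c * walk eta l s phi y.
Proof. by elim: l y => //= i l IH y; rewrite !IH; ring. Qed.

Lemma walk_sum l m (phi : 'I_m -> 'rV[R]_n -> R) y :
  walk eta l s (fun z => \sum_(k < m) phi k z) y = \sum_(k < m) walk eta l s (phi k) y.
Proof.
elim: m phi => [|m IH] phi.
  by under [in LHS]eq_fun do rewrite big_ord0; rewrite walk_cst big_ord0.
under [in LHS]eq_fun do rewrite big_ord_recl.
by rewrite walkD IH big_ord_recl.
Qed.

Lemma norm_walk_subr_le l (phi psi : 'rV[R]_n -> R) c y :
  (forall z, `|c - phi z| <= psi z) -> `|c - walk eta l s phi y| <= walk eta l s psi y.
Proof.
move=> H; have le1 : walk eta l s (fun z => c + -1 * phi z) y <= walk eta l s psi y.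
  by apply: le_walk => z; rewrite mulN1r; have := H z; rewrite ler_norml => /andP[].
have le2 : walk eta l s (fun z => -1 * c + phi z) y <= walk eta l s psi y.
  by apply: le_walk => z; rewrite mulN1r; have := H z; rewrite ler_norml => /andP[+ _]; lra.
by move: le1 le2; rewrite !walkD walkZ !walk_cst ler_norml; lra.
Qed.

(** Squared bias plus variance: each step along [j] moves the mean by [eta * s j] and adds variance
    [eta ^ 2 * (1 - s j ^ 2)]; steps along other coordinates do nothing. *)
Lemma walk_sqr l j c y : walk eta l s (fun z => (z 0 j - c) ^+ 2) y =
  (y 0 j + eta * (count_mem j l)%:R * s j - c) ^+ 2 +
  eta ^+ 2 * (count_mem j l)%:R * (1 - s j ^+ 2).
Proof.
elim: l y => [|i l IH] y /=; first by rewrite !(mulr0, mul0r, addr0).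
rewrite !IH !mxE eqxx/=; have [->|ij] := eqVneq i j.
  by rewrite natrD/=; field.
by rewrite /= add0n; field.
Qed.

End walk_theory.

(** An average of values of [phi] inherits its bound. This keeps the approximating polynomial
    bounded outside the box as well, where the approximation says nothing. *)
Lemma norm_walk_le n eta l (s : 'I_n -> R) phi (M : R) y : (forall i, `|s i| <= 1) ->
  (forall z, `|phi z| <= M) -> `|walk eta l s phi y| <= M.
Proof.
move=> s1 H; rewrite ler_norml.
rewrite -[- M](walk_cst eta s l (- M) y) -[X in _ <= _ <= X](walk_cst eta s l M y).
by apply/andP; split; apply: le_walk => // z; have := H z; rewrite ler_norml => /andP[].
Qed.

Lemma trigpoly_walk n eta l (s : 'I_n -> 'rV[R]_n -> R) phi y :
  (forall i, trigpoly (s i)) ->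
  trigpoly (fun x => walk eta l (fun i => s i x) phi y).
Proof.
move=> ts; elim: l y => [|i l IH] y /=; first exact: trigpoly_cst.
apply: trigpolyD; apply: trigpolyM => //.
- apply: eq_trigpoly (trigpolyD (trigpoly_cst n 2^-1) (trigpolyZ 2^-1 (ts i))) => x.
  by field.
- apply: eq_trigpoly (trigpolyD (trigpoly_cst n 2^-1) (trigpolyZ (- 2^-1) (ts i))) => x.
  by field.
Qed.

Lemma rV_coord_norm_le n (x : 'rV[R]_n) i : `|x 0 i| <= `|x|.
Proof. by rewrite [`|x|]mx_normrE; exact: (le_bigmax _ (fun ij => `|x ij.1 ij.2|) (0, i)). Qed.

(** Only [x] is confined to the box: in the approximation argument [y] is an arbitrary end point of
    a walk. *)
Lemma box_unif_continuous n (f : 'rV[R]_n -> R) (K e : R) : continuous f -> 0 < e ->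
  exists2 del : R, 0 < del & forall x y : 'rV[R]_n, (forall i, `|x 0 i| <= K) ->
    (forall i, `|x 0 i - y 0 i| < del) -> `|f x - f y| <= e.
Proof.
move=> cf e0.
have cK : compact [set v : 'rV[R]_n | forall i : 'I_n, `[- K, K]%classic (v ord0 i)].
  apply: (@rV_compact _ n (fun=> `[- K, K]%classic)) => i.
  exact: segment_compact.
move/compact_near_coveringP : cK => /(_ R (0^'+) (fun del x =>
  forall y : 'rV[R]_n, (forall i, `|x 0 i - y 0 i| < del) -> `|f x - f y| <= e)).
case.
  move=> x _; have /cvgrPdist_lt /(_ (e / 2)) := cf x.
  rewrite divr_gt0// => /(_ isT) /nbhs_ballP[eta /= eta0 xeta].
  have E2 : 0 < eta / 2 by rewrite divr_gt0.
  near=> x' del => y x'y.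
  have del_eta : del < eta / 2 by near: del; exact: nbhs_right_lt.
  have bx' : ball x (eta / 2) x' by near: x'; exact: nbhsx_ballx.
  have h1 : `|f x - f x'| < e / 2.
    by apply: xeta; apply: le_ball bx'; lra.
  have h2 : `|f x - f y| < e / 2.
    apply: xeta; split => // i j; rewrite (ord1 i).
    have -> : eta = eta / 2 + eta / 2 by field.
    apply: ball_triangle (bx'.2 0 j) _.
    by rewrite /ball/=; exact: (lt_trans (x'y j)).
  have -> : f x' - f y = (f x - f y) - (f x - f x') by ring.
  by rewrite (le_trans (ler_normB _ _))//; lra.
move=> /= del0 /= del00 H.
exists (del0 / 2); first by rewrite divr_gt0.
move=> x y xK xy; apply: (H (del0 / 2)) => //=.
- by rewrite sub0r normrN gtr0_norm ?divr_gt0//; move: del00 => /=; lra.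
- by rewrite divr_gt0.
- by move=> i; rewrite /= in_itv/= -ler_norml.
Unshelve. all: by end_near. Qed.

(* Bernstein approximation in the variables [sin (x i / L)], with [L] so large
   that [L * sin (x i / L)] is close to [x i] on the box. *)
Lemma trigpoly_approx n (f : 'rV[R]_n -> R) (M K e : R) :
  continuous f -> (forall x, `|f x| <= M) -> 0 < e ->
  exists g, [/\ trigpoly g, forall x, `|g x| <= M &
    forall x : 'rV[R]_n, (forall i, `|x 0 i| <= K) -> `|f x - g x| <= e].
Proof.
move=> cf fM e0.
have M0 : 0 <= M by rewrite (le_trans _ (fM 0)).
have e3 : 0 < e / 3 by rewrite divr_gt0.
have [d1 d10 H1] := box_unif_continuous K cf e3.
(* Large enough for [K ^ 2 / L < d1], the bound that [norm_id_subr_sin] gives for the distance from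
   [x i] to [L * sin (x i / L)]. *)
pose L := 1 + (1 + K ^+ 2) / d1.
have L0 : 0 < L by rewrite /L ltr_wpDr// divr_ge0 ?(ltW d10)// addr_ge0 ?sqr_ge0.
have LK : K ^+ 2 / L < d1.
  rewrite ltr_pdivrMr// /L mulrDr mulr1 mulrCA mulfV ?gt_eqF// mulr1; lra.
have [d2 d20 H2] := box_unif_continuous L cf e3.
pose C := 2 * M / d2 ^+ 2.
have C0 : 0 <= C by rewrite divr_ge0 ?sqr_ge0// mulr_ge0.
(* Pointwise form of Chebyshev's inequality: if some coordinates differ by [d2] or more, the
   quadratic term alone exceeds [2 * M]. Its average along the walk is a sum of variances. *)
have H3 (x y : 'rV[R]_n) : (forall i, `|x 0 i| <= L) ->
    `|f x - f y| <= e / 3 + C * \sum_(i < n) (y 0 i - x 0 i) ^+ 2.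
  move=> xL; have S0 : 0 <= \sum_(i < n) (y 0 i - x 0 i) ^+ 2.
    by apply: sumr_ge0 => i _; exact: sqr_ge0.
  have [/forallP xy|] := boolP [forall i, `|x 0 i - y 0 i| < d2].
    by rewrite (le_trans (H2 _ _ xL xy))// lerDl mulr_ge0.
  rewrite negb_forall => /existsP[i]; rewrite -leNgt => xyi.
  rewrite (@le_trans _ _ (2 * M))//.
    by rewrite (le_trans (ler_normB _ _))//; have := fM x; have := fM y; lra.
  apply: (@le_trans _ _ (C * \sum_(i < n) (y 0 i - x 0 i) ^+ 2)); last by lra.
  rewrite /C mulrAC ler_pdivlMr ?exprn_gt0// ler_wpM2l ?mulr_ge0// (bigD1 i)//=.
  rewrite (@le_trans _ _ ((y 0 i - x 0 i) ^+ 2))//; last first.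
    by rewrite lerDl sumr_ge0// => j _; exact: sqr_ge0.
  by rewrite -[leRHS]real_normK ?num_real// distrC ler_sqr ?nnegrE// ltW.
pose N := (Num.truncn (3 * C * (n%:R * L ^+ 2) / e)).+1.
have CN : C * (n%:R * (L ^+ 2 / N%:R)) <= e / 3.
  have N0 : (0 : R) < N%:R by rewrite ltr0n.
  have := truncnS_gt (3 * C * (n%:R * L ^+ 2) / e).
  rewrite -/N ltr_pdivrMr// => HN.
  have -> : C * (n%:R * (L ^+ 2 / N%:R)) = C * (n%:R * L ^+ 2) / N%:R by ring.
  rewrite ler_pdivrMr//; lra.
(* Each coordinate is moved [N] times by [L / N], so the mean end point is the row of the
   [L * s i x], and each variance is at most [L ^ 2 / N]. *)
pose l := flatten (nseq N (enum 'I_n)).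
have cl j : count_mem j l = N.
  rewrite /l count_flatten map_nseq sumn_nseq count_uniq_mem ?enum_uniq//.
  by rewrite mem_enum mul1n.
pose s i (x : 'rV[R]_n) := sin (L^-1 * x 0 i).
have s1 x i : `|s i x| <= 1 by rewrite ler_norml sin_geN1 sin_le1.
exists (fun x => walk (L / N%:R) l (fun i => s i x) f 0); split.
- by apply: trigpoly_walk => i; exact: trigpoly_sin_coord.
- by move=> x; exact: norm_walk_le.
move=> x xK; pose z := \row_(i < n) (L * s i x).
have zL i : `|z 0 i| <= L by rewrite mxE normrM (gtr0_norm L0) ler_piMr// ltW.
have -> : f x - walk (L / N%:R) l (fun i => s i x) f 0 =
  (f x - f z) + (f z - walk (L / N%:R) l (fun i => s i x) f 0) by ring.
rewrite (le_trans (ler_normD _ _))//.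
have F1 : `|f x - f z| <= e / 3.
  apply: H1 => // i; rewrite mxE.
  have -> : x 0 i - L * s i x = L * (L^-1 * x 0 i - sin (L^-1 * x 0 i)).
    by rewrite mulrBr mulrA mulfV ?gt_eqF// mul1r.
  rewrite normrM gtr0_norm// (le_lt_trans (ler_wpM2l (ltW L0) (norm_id_subr_sin _)))//.
  apply: le_lt_trans LK.
  have -> : L * (L^-1 * x 0 i) ^+ 2 = x 0 i ^+ 2 / L by field; exact: lt0r_neq0.
  rewrite ler_pM2r ?invr_gt0// -[leLHS]real_normK ?num_real//.
  by rewrite ler_sqr ?nnegrE ?(le_trans _ (xK i)).
have F2 : `|f z - walk (L / N%:R) l (fun i => s i x) f 0| <= e / 3 + e / 3.
  apply: (le_trans (norm_walk_subr_le _ _ _ _ (fun y => H3 z y zL))) => //.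
  rewrite walkD walk_cst lerD2l walkZ walk_sum (le_trans _ CN)//.
  rewrite ler_wpM2l//.
  rewrite [leRHS](_ : _ = \sum_(i < n) (L ^+ 2 / N%:R)); last first.
    by rewrite sumr_const card_ord mulr_natl.
  apply: ler_sum => i _; rewrite walk_sqr !mxE add0r cl.
  have N0 : N%:R != 0 :> R by rewrite pnatr_eq0.
  rewrite [X in X ^+ 2 + _](_ : _ = 0); last by field.
  rewrite expr0n/= add0r [X in X * _](_ : _ = L ^+ 2 / N%:R); last by field.
  by rewrite ler_piMr// ?divr_ge0 ?sqr_ge0// lerBlDr lerDl sqr_ge0.
lra.
Qed.

End trigonometric_approximation.

Lemma nneseries_geometric_le {R : realType} (C q : R) (m : nat) :
  0 <= C -> 0 <= q < 1 ->
  (\sum_(m <= k <oo) (C * q ^+ k)%:E <= (C * q ^+ m / (1 - q))%:E)%E.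
Proof.
move=> C0 /andP[q0 q1]; apply: lime_le.
  by apply: is_cvg_nneseries => k _ _; rewrite lee_fin mulr_ge0// exprn_ge0.
near=> n.
have mn : (m <= n)%N by near: n; exact: nbhs_infty_ge.
rewrite -(subnKC mn) sumEFin lee_fin; set j := (n - m)%N.
have -> : \sum_(m <= k < m + j) C * q ^+ k = C * (q ^+ m - q ^+ (m + j)) / (1 - q).
  elim: j => [|j IH]; first by rewrite addn0 subrr mulr0 mul0r big_geq.
  rewrite addnS big_nat_recr ?leq_addr//= IH exprS; field; lra.
by rewrite ler_pM2r ?invr_gt0 ?subr_gt0// ler_wpM2l// gerBl exprn_ge0.
Unshelve. all: by end_near. Qed.

(** * Expectations of bounded random variables *)

Section bounded_expectation.
Context {R : realType} {d : measure_display} {T : measurableType d}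
  (P : probability T R).
Implicit Types (f g : T -> R).

(** On this class the extended-real expectation is finite and may be traded for the real-valued
    integral, which is linear and monotone there. *)
Definition bounded_mfun (f : T -> R) : Prop :=
  measurable_fun setT f /\ exists M : R, forall w, `|f w| <= M.

Lemma bounded_mfun_integrable f : bounded_mfun f -> P.-integrable setT (EFin \o f).
Proof.
move=> [mf [M fM]]; apply: measurable_bounded_integrable => //.
  by rewrite ltey_eq fin_num_measure.
exists M; split; first exact: num_real.
by move=> x Mx w _ /=; rewrite (le_trans (fM w))// ltW.
Qed.

Lemma bounded_mfun_expectation f : bounded_mfun f ->
  ('E_P[f] = (\int[P]_w f w)%R%:E)%E.
Proof.
move=> /bounded_mfun_integrable fi; rewrite unlock /Rintegral fineK//.
exact: integrable_fin_num.
Qed.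

Lemma bounded_mfunD f g : bounded_mfun f -> bounded_mfun g ->
  bounded_mfun (fun w => f w + g w).
Proof.
move=> [mf [M fM]] [mg [N gN]]; split; first exact: measurable_funD.
by exists (M + N) => w; rewrite (le_trans (ler_normD _ _))// lerD.
Qed.

Lemma bounded_mfunZ c f : bounded_mfun f -> bounded_mfun (fun w => c * f w).
Proof.
move=> [mf [M fM]]; split; first exact: measurable_funM.
by exists (`|c| * M) => w; rewrite normrM ler_wpM2l.
Qed.

Lemma bounded_mfun_cst c : bounded_mfun (cst c).
Proof. by split => //; exists `|c|. Qed.

Lemma bounded_mfun_indic (A : set T) : measurable A -> bounded_mfun \1_A.
Proof.
move=> mA; split; first exact: measurable_indic.
by exists 1 => w; rewrite indicE; case: (_ \in _); rewrite ?normr1 ?normr0.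
Qed.

Lemma bounded_mfun_sum n (F : 'I_n -> T -> R) : (forall i, bounded_mfun (F i)) ->
  bounded_mfun (fun w => \sum_(i < n) F i w).
Proof.
elim: n F => [|n IH] F bF.
  by under eq_fun do rewrite big_ord0; exact: bounded_mfun_cst.
under eq_fun do rewrite big_ord_recl; apply: bounded_mfunD => //.
exact: IH.
Qed.

Lemma Rintegral_prob_cst c : (\int[P]_w c)%R = c.
Proof. by rewrite Rintegral_cst// [X in fine X](@probability_setT _ _ _ P) mulr1. Qed.

Lemma Rintegral_bmfD f g : bounded_mfun f -> bounded_mfun g ->
  (\int[P]_w (f w + g w) = \int[P]_w f w + \int[P]_w g w)%R.
Proof. by move=> bf bg; rewrite RintegralD//; exact: bounded_mfun_integrable. Qed.

Lemma Rintegral_bmfB f g : bounded_mfun f -> bounded_mfun g ->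
  (\int[P]_w (f w - g w) = \int[P]_w f w - \int[P]_w g w)%R.
Proof. by move=> bf bg; rewrite RintegralB//; exact: bounded_mfun_integrable. Qed.

Lemma Rintegral_bmfZ c f : bounded_mfun f ->
  (\int[P]_w (c * f w) = c * \int[P]_w f w)%R.
Proof. by move=> bf; rewrite RintegralZl//; exact: bounded_mfun_integrable. Qed.

Lemma le_Rintegral_bmf f g : bounded_mfun f -> bounded_mfun g ->
  (forall w, f w <= g w) -> (\int[P]_w f w <= \int[P]_w g w)%R.
Proof.
by move=> bf bg fg; apply: le_Rintegral => //; exact: bounded_mfun_integrable.
Qed.

Lemma Rintegral_indic (A : set T) : measurable A ->
  (\int[P]_w \1_A w)%R = fine (P A).
Proof. by move=> mA; rewrite /Rintegral integral_indic// setIT. Qed.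

Lemma Rintegral_bmf_sum n (F : 'I_n -> T -> R) : (forall i, bounded_mfun (F i)) ->
  (\int[P]_w (\sum_(i < n) F i w) = \sum_(i < n) \int[P]_w F i w)%R.
Proof.
elim: n F => [|n IH] F bF.
  by under eq_Rintegral do rewrite big_ord0; rewrite Rintegral_prob_cst big_ord0.
under eq_Rintegral do rewrite big_ord_recl.
by rewrite Rintegral_bmfD ?IH ?big_ord_recl//; exact: bounded_mfun_sum.
Qed.

(** Common end of both tightness arguments: in ['rV[R]_n] there is one exceptional event per
    coordinate, in [CR] a single one. *)
Lemma norm_Rintegral_subr_le f g (e c del : R) n (A : 'I_n -> set T) :
  bounded_mfun f -> bounded_mfun g -> 0 <= c ->
  (forall i, measurable (A i)) -> (forall i, (P (A i) <= del%:E)%E) ->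
  (forall w, `|f w - g w| <= e + c * \sum_(i < n) \1_(A i) w) ->
  `|\int[P]_w f w - \int[P]_w g w| <= e + c * (n%:R * del).
Proof.
move=> bf bg c0 mA PA H; rewrite -Rintegral_bmfB//.
pose psi w := e + c * \sum_(i < n) \1_(A i) w.
have bs : bounded_mfun (fun w => \sum_(i < n) \1_(A i) w).
  by apply: bounded_mfun_sum => i; exact: bounded_mfun_indic.
have bpsi : bounded_mfun psi.
  by apply: bounded_mfunD; [exact: bounded_mfun_cst|exact: bounded_mfunZ].
have bfg : bounded_mfun (fun w => f w - g w).
  apply: bounded_mfunD => //; have := bounded_mfunZ (-1) bg.
  by under eq_fun do rewrite mulN1r.
have psi_le : (\int[P]_w psi w)%R <= e + c * (n%:R * del).
  rewrite Rintegral_bmfD//; [|exact: bounded_mfun_cst|exact: bounded_mfunZ].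
  rewrite Rintegral_prob_cst lerD2l Rintegral_bmfZ// ler_wpM2l//.
  rewrite Rintegral_bmf_sum; last by move=> i; exact: bounded_mfun_indic.
  rewrite (_ : n%:R * del = \sum_(i < n) del); last first.
    by rewrite sumr_const card_ord mulr_natl.
  apply: ler_sum => i _; rewrite Rintegral_indic//.
  by rewrite -lee_fin fineK// fin_num_measure.
rewrite ler_norml; apply/andP; split.
  rewrite lerNl (le_trans _ psi_le)// -mulN1r -Rintegral_bmfZ//.
  apply: le_Rintegral_bmf => //; first exact: bounded_mfunZ.
  by move=> w; have := H w; rewrite ler_norml /psi => /andP[]; lra.
rewrite (le_trans _ psi_le)//; apply: le_Rintegral_bmf => //.
by move=> w; have := H w; rewrite ler_norml /psi => /andP[].
Qed.

Lemma measurable_comp_continuous (X : T -> R) (f : R -> R) : continuous f ->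
  measurable_fun setT X -> measurable_fun setT (fun w => f (X w)).
Proof.
by move=> cf mX; apply: measurableT_comp => //; exact: continuous_measurable_fun.
Qed.

Lemma bounded_mfun_cos (X : T -> R) : measurable_fun setT X ->
  bounded_mfun (fun w => cos (X w)).
Proof.
move=> mX; split; first by apply: measurable_comp_continuous => //; exact: continuous_cos.
by exists 1 => w; rewrite ler_norml cos_geN1 cos_le1.
Qed.

Lemma bounded_mfun_sin (X : T -> R) : measurable_fun setT X ->
  bounded_mfun (fun w => sin (X w)).
Proof.
move=> mX; split; first by apply: measurable_comp_continuous => //; exact: continuous_sin.
by exists 1 => w; rewrite ler_norml sin_geN1 sin_le1.
Qed.

Lemma measurable_linear_form n (X : T -> 'rV[R]_n) (th : 'I_n -> R) :
  (forall i, measurable_fun setT (fun w => X w 0 i)) ->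
  measurable_fun setT (fun w => \sum_(i < n) th i * X w 0 i).
Proof.
by move=> mX; apply: measurable_sum => i; exact: measurable_funM.
Qed.

Lemma bounded_mfun_trigpoly n (X : T -> 'rV[R]_n) (g : 'rV[R]_n -> R) :
  (forall i, measurable_fun setT (fun w => X w 0 i)) -> trigpoly g ->
  bounded_mfun (fun w => g (X w)).
Proof.
move=> mX; elim => {g} [th|th|g1 g2 _ IH1 _ IH2|c g _ IH].
- by apply: bounded_mfun_cos; exact: measurable_linear_form.
- by apply: bounded_mfun_sin; exact: measurable_linear_form.
- exact: bounded_mfunD.
- exact: bounded_mfunZ.
Qed.

(** Measurability is known for the coordinates. It passes to [f] through trigonometric polynomials,
    the [m]-th being within [1 / (m + 1)] of [f] on the box of half-side [m]. *)
Lemma bounded_mfun_continuous_rV n (X : T -> 'rV[R]_n) (f : 'rV[R]_n -> R) (M : R) :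
  (forall i, measurable_fun setT (fun w => X w 0 i)) -> continuous f ->
  (forall x, `|f x| <= M) -> bounded_mfun (fun w => f (X w)).
Proof.
move=> mX cf fM; split; last by exists M => w.
have H m : exists g : 'rV[R]_n -> R, trigpoly g /\
    forall x : 'rV[R]_n, (forall i, `|x 0 i| <= m%:R) -> `|f x - g x| <= m.+1%:R^-1.
  by have [|g [tg _ gP]] := @trigpoly_approx _ _ f M m%:R m.+1%:R^-1 cf fM => //; exists g.
have [g gP] := choice H.
apply: (@measurable_fun_cvg _ _ _ _ (fun m w => g m (X w))).
  by move=> m; apply: (bounded_mfun_trigpoly mX (gP m).1).1.
move=> w _; apply/cvgrPdist_le => e e0; near=> m.
apply: (@le_trans _ _ m.+1%:R^-1); last first.
  by apply/ltW; near: m; exact: (near_infty_natSinv_lt (PosNum e0)).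
apply: (gP m).2 => i; rewrite (le_trans (rV_coord_norm_le _ _))//.
by near: m; exact: nbhs_infty_ger.
Unshelve. all: by end_near. Qed.

(* The intervals [lam * 2 ^ k <= `|X| < lam * 2 ^ k.+1] are scaled onto
   [pi / 2 <= v < pi], where [cos v <= 0]. *)
Lemma prob_tail_le (X : T -> R) (K q a lam : R) :
  measurable_fun setT X -> 0 <= K -> 0 <= q -> 0 < a -> 0 < lam ->
  (forall th, 0 <= th -> th <= pi / 2 / lam ->
     1 - \int[P]_w cos (th * X w) <= K * (th * q) `^ a) ->
  (P [set w | (lam < `|X w|)%R] <=
   (K * (pi / 2) `^ a / (1 - 2 `^ (- a)) * (q / lam) `^ a)%:E)%E.
Proof.
move=> mX K0 q0 a0 lam0 H.
have pi20 : 0 < (pi / 2 : R) by rewrite divr_gt0 ?pi_gt0.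
pose th k : R := pi / 2 / lam / 2 ^+ k.
have th0 k : 0 < th k by rewrite !divr_gt0 ?exprn_gt0 ?pi_gt0.
have th1 k : th k <= pi / 2 / lam.
  have A0 : 0 <= pi / 2 / lam by rewrite ltW// divr_gt0.
  by rewrite /th ler_pdivrMr ?exprn_gt0// ler_peMr// exprn_ege1// ler1n.
pose A := [set w | lam < `|X w|].
have mA : measurable A.
  have -> : A = (fun w => `|X w|) @^-1` `]lam, +oo[%classic.
    by apply/seteqP; split => w; rewrite /A /= in_itv/= andbT.
  by rewrite -[X in measurable X]setTI; apply: measurableT_comp => //; exact: measurable_itv.
have mcos k : measurable_fun setT (fun w => 1 - cos (th k * X w)).
  apply: measurable_funB => //; apply: measurable_comp_continuous; first exact: continuous_cos.
  exact: measurable_funM.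
have cge0 k w : 0 <= 1 - cos (th k * X w) by rewrite subr_ge0 cos_le1.
(* The indicator of [A] is bounded by a series of nonnegative terms, one of which is at least 1 on
   [A]. Integration then leaves values of the characteristic function at the points [th k], a
   geometric series of ratio [2 ^ (- a)]. *)
have step1 : (P A <= \int[P]_w (\sum_(0 <= k <oo) (1 - cos (th k * X w))%:E))%E.
  rewrite -(setIT A) -integral_indic//; apply: ge0_le_integral => //.
  - by apply/measurable_EFinP; exact: measurable_indic.
  - by apply: ge0_emeasurable_sum => // k _; exact/measurable_EFinP.
  move=> w _; rewrite indicE; case: (boolP (w \in A)) => /= [|_]; last first.
    by apply: nneseries_ge0 => k _ _; rewrite lee_fin.
  rewrite inE /A /= => lX; pose y := `|X w| / lam.
  have y1 : 1 < y by rewrite ltr_pdivlMr// mul1r.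
  pose k := trunc_log 2 (Num.truncn y).
  have n1 : (0 < Num.truncn y)%N by rewrite truncn_gt0 ltW.
  have /andP[k1 k2] := trunc_log_bounds (ltnSn 1) n1.
  have ky1 : 2 ^+ k <= y.
    by rewrite -natrX -truncn_ge_nat// ltW// (lt_trans ltr01).
  have ky2 : y < 2 ^+ k.+1.
    by rewrite -natrX -truncn_lt_nat// ltW// (lt_trans ltr01).
  rewrite (nneseriesD1 (n := k))//.
  rewrite (@le_trans _ _ (1 - cos (th k * X w))%:E)//; last first.
    by rewrite leeDl// nneseries_ge0.
  rewrite lee_fin lerBrDr gerDl -cos_norm normrM (gtr0_norm (th0 k)).
  have -> : th k * `|X w| = pi / 2 * (y / 2 ^+ k).
    by rewrite /th /y; field; rewrite gt_eqF//= gt_eqF// exprn_gt0.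
  set v := y / 2 ^+ k.
  have v1 : 1 <= v by rewrite ler_pdivlMr ?exprn_gt0// mul1r.
  have v2 : v <= 2 by rewrite ler_pdivrMr ?exprn_gt0// -exprS ltW.
  have -> : pi / 2 * v = pi / 2 * (v - 1) + pi / 2 by ring.
  rewrite cosDpihalf oppr_le0 sin_ge0_pi//; apply/andP; split.
    by rewrite mulr_ge0 ?subr_ge0// ltW.
  rewrite (@le_trans _ _ (pi / 2 * 1))//; first by rewrite ler_pM2l//; lra.
  by have := pi_gt0 R; lra.
apply: (le_trans step1).
rewrite integral_nneseries//; last by move=> k; apply/measurable_EFinP.
pose C := K * (pi / 2) `^ a * (q / lam) `^ a.
have C0 : 0 <= C by rewrite !mulr_ge0 ?powR_ge0.
have r0 : 0 <= (2 `^ (- a) : R) < 1.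
  rewrite powR_ge0/= powRN invf_lt1 ?powR_gt0//.
  by rewrite /powR gt_eqF// expR_gt1 mulr_gt0// ln_gt0//; lra.
apply: (@le_trans _ _ (\sum_(0 <= k <oo) (C * (2 `^ (- a)) ^+ k)%:E)%E); last first.
  rewrite (le_trans (nneseries_geometric_le _ C0 r0))// lee_fin expr0 mulr1 /C.
  by rewrite [leRHS]mulrAC.
apply: lee_nneseries => [k _ _|k _].
  by apply: integral_ge0 => w _; rewrite lee_fin.
have bc : bounded_mfun (fun w => cos (th k * X w)).
  by apply: bounded_mfun_cos; exact: measurable_funM.
have bc1 : bounded_mfun (fun w => 1 - cos (th k * X w)).
  by split => //; exists 2 => w; rewrite ler_norml; have := cos_geN1 (th k * X w); have := cos_le1 (th k * X w); lra.
rewrite -[leLHS]fineK; last exact/integrable_fin_num/bounded_mfun_integrable.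
rewrite lee_fin (le_trans _ (le_trans (H (th k) (ltW (th0 k)) (th1 k)) _))//.
  by rewrite -[X in _ <= X - _]Rintegral_prob_cst -Rintegral_bmfB//; exact: bounded_mfun_cst.
rewrite /C -[K * _ * _]mulrA -[K * _ * _]mulrA ler_wpM2l//.
have -> : th k * q = pi / 2 * (q / lam) * (2 ^+ k)^-1.
  by rewrite /th; field; rewrite gt_eqF//= gt_eqF// exprn_gt0.
rewrite !powRM ?mulr_ge0 ?divr_ge0 ?invr_ge0 ?exprn_ge0 ?pi_ge0 ?(ltW lam0)//.
rewrite ler_wpM2l ?mulr_ge0 ?powR_ge0//.
rewrite -[2 ^+ k]powR_mulrn// -powRN -!powRrM -powR_mulrn ?powR_ge0// -powRrM.
by rewrite [- k%:R * a]mulrC mulNr mulrN.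
Qed.

End bounded_expectation.

(** * Convergence in distribution *)

Section convergence_in_distribution.
Context {R : realType}.

Lemma cvg_Rintegral_bounded {d} {T : measurableType d} (P : probability T R)
    (g : nat -> T -> R) (f : T -> R) (M : R) :
  (forall k, measurable_fun setT (g k)) -> (forall k w, `|g k w| <= M) ->
  (forall w, g k w @[k --> \oo] --> f w) ->
  (\int[P]_w g k w)%R @[k --> \oo] --> (\int[P]_w f w)%R.
Proof.
move=> mg gM gf.
have mf : measurable_fun setT f.
  by apply: (measurable_fun_cvg mg) => w _; exact: gf.
have fM w : `|f w| <= M.
  by apply: (cvgr_to_le (cvg_norm (gf w))); exact: nearW.
have bf : bounded_mfun f by split => //; exists M.
apply: fine_cvg; rewrite /Rintegral fineK; last exact/integrable_fin_num/bounded_mfun_integrable.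
apply: (@dominated_cvg _ _ _ P setT _ _ _ (fun=> M%:E)) => //.
- by move=> k; exact/measurable_EFinP.
- by move=> w _; apply: cvg_EFin; [exact: nearW|exact: gf].
- by apply: (@bounded_mfun_integrable _ _ _ P (cst M)); exact: bounded_mfun_cst.
- by move=> k w _; rewrite /= lee_fin.
Qed.

Section two_spaces.
Context {d d' : measure_display} {T : measurableType d} {T' : measurableType d'}
  (P : probability T R) (P' : probability T' R) {J : Type} (F : set_system J)
  {FF : Filter F}.

Lemma cvg_Rintegral_trigpoly n (X : J -> T -> 'rV[R]_n) (Z : T' -> 'rV[R]_n) (g : 'rV[R]_n -> R) :
  (forall j i, measurable_fun setT (fun w => X j w 0 i)) ->
  (forall i, measurable_fun setT (fun w => Z w 0 i)) ->
  (forall th : 'I_n -> R,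
    (\int[P]_w cos (\sum_(i < n) th i * X j w 0 i))%R @[j --> F] -->
    (\int[P']_w cos (\sum_(i < n) th i * Z w 0 i))%R) ->
  (forall th : 'I_n -> R,
    (\int[P]_w sin (\sum_(i < n) th i * X j w 0 i))%R @[j --> F] -->
    (\int[P']_w sin (\sum_(i < n) th i * Z w 0 i))%R) ->
  trigpoly g ->
  (\int[P]_w g (X j w))%R @[j --> F] --> (\int[P']_w g (Z w))%R.
Proof.
move=> mX mZ Hcos Hsin; elim=> {g} // [g1 g2 t1 IH1 t2 IH2|c g tg IH].
  rewrite Rintegral_bmfD; [|exact: bounded_mfun_trigpoly..].
  under eq_fun => j do rewrite (Rintegral_bmfD _ (bounded_mfun_trigpoly (mX j) t1) (bounded_mfun_trigpoly (mX j) t2)).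
  exact: cvgD.
rewrite Rintegral_bmfZ; last exact: bounded_mfun_trigpoly.
under eq_fun => j do rewrite (Rintegral_bmfZ _ _ (bounded_mfun_trigpoly (mX j) tg)).
by apply: cvgM => //; exact: cvg_cst.
Qed.

(** The law of the limit is given, so no subsequence has to be extracted: [f] is replaced by a
    trigonometric polynomial close to it on the box of half-side [K] and bounded by [M] everywhere,
    and the rest is charged to the small probability of leaving the box. *)
Lemma levy_continuity n (X : J -> T -> 'rV[R]_n) (Z : T' -> 'rV[R]_n)
    (f : 'rV[R]_n -> R) (M : R) :
  (forall j i, measurable_fun setT (fun w => X j w 0 i)) ->
  (forall i, measurable_fun setT (fun w => Z w 0 i)) ->
  (forall th : 'I_n -> R,
    (\int[P]_w cos (\sum_(i < n) th i * X j w 0 i))%R @[j --> F] -->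
    (\int[P']_w cos (\sum_(i < n) th i * Z w 0 i))%R) ->
  (forall th : 'I_n -> R,
    (\int[P]_w sin (\sum_(i < n) th i * X j w 0 i))%R @[j --> F] -->
    (\int[P']_w sin (\sum_(i < n) th i * Z w 0 i))%R) ->
  (forall e : R, 0 < e -> exists K : R, forall i,
    (\forall j \near F, P [set w | (K < `|X j w 0 i|)%R] <= e%:E)%E /\
    (P' [set w | (K < `|Z w 0 i|)%R] <= e%:E)%E) ->
  continuous f -> (forall x, `|f x| <= M) ->
  (\int[P]_w f (X j w))%R @[j --> F] --> (\int[P']_w f (Z w))%R.
Proof.
move=> mX mZ Hcos Hsin tight cf fM.
have M0 : 0 <= M by rewrite (le_trans _ (fM 0)).
apply/cvgrPdist_le => e e0.
(* The increments by 1 keep the denominator positive when [M] or [n] is 0. The budget is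
   [e / 8 + e / 4] for each of the two replacements and [e / 4] for the polynomial. *)
pose del := e / (8 * (M + 1) * (n%:R + 1)).
have del0 : 0 < del.
  by rewrite divr_gt0// !mulr_gt0//; have := ler0n R n; lra.
have delE : 2 * M * (n%:R * del) <= e / 4.
  have H1 : M * n%:R <= (M + 1) * (n%:R + 1).
    by rewrite ler_pM// ?lerDl.
  have M1 : 0 < M + 1 by lra.
  have n1 : 0 < n%:R + 1 :> R by have := ler0n R n; lra.
  have -> : 2 * M * (n%:R * del) = e / 4 * (M * n%:R / ((M + 1) * (n%:R + 1))).
    by rewrite /del; field; lra.
  by rewrite ler_piMr ?ler_pdivrMr ?mul1r ?mulr_gt0//; lra.
have [K KP] := tight _ del0.
have e8 : 0 < e / 8 by lra.
have [g [tg gM gP]] := @trigpoly_approx _ _ f M K (e / 8) cf fM e8.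
have mset d0 (T0 : measurableType d0) (Y : T0 -> R) : measurable_fun setT Y ->
    measurable [set w | K < `|Y w|].
  move=> mY; have -> : [set w | K < `|Y w|] = (fun w => `|Y w|) @^-1` `]K, +oo[%classic.
    by apply/seteqP; split => w; rewrite /= in_itv/= andbT.
  by rewrite -[X in measurable X]setTI; apply: measurableT_comp => //; exact: measurable_itv.
have fg d0 (T0 : measurableType d0) (Y : T0 -> 'rV[R]_n) w :
    `|f (Y w) - g (Y w)| <= e / 8 + 2 * M * \sum_(i < n) \1_[set w | K < `|Y w 0 i|] w.
  have S0 (Q : pred 'I_n) : 0 <= \sum_(i < n | Q i) \1_[set w | K < `|Y w 0 i|] w :> R.
    by apply: sumr_ge0 => i _; rewrite indicE.
  have [/forallP h|] := boolP [forall i, `|Y w 0 i| <= K].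
    by rewrite (le_trans (gP _ h))// lerDl !mulr_ge0.
  rewrite negb_forall => /existsP[i]; rewrite -ltNge => h.
  rewrite (@le_trans _ _ (2 * M))//.
    by rewrite (le_trans (ler_normB _ _))//; have := fM (Y w); have := gM (Y w); lra.
  rewrite (@le_trans _ _ (2 * M * \sum_(i < n) \1_[set w | K < `|Y w 0 i|] w))//; last lra.
  rewrite ler_peMr ?mulr_ge0// (bigD1 i)//= indicE mem_set//= lerDl.
  exact: S0.
have bf j : bounded_mfun (fun w => f (X j w)) by exact: bounded_mfun_continuous_rV fM.
have bf' : bounded_mfun (fun w => f (Z w)) by exact: bounded_mfun_continuous_rV fM.
have bg j : bounded_mfun (fun w => g (X j w)) by exact: bounded_mfun_trigpoly.
have bg' : bounded_mfun (fun w => g (Z w)) by exact: bounded_mfun_trigpoly.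
have M2 : 0 <= 2 * M by rewrite mulr_ge0.
have HZ : `|\int[P']_w f (Z w) - \int[P']_w g (Z w)| <= e / 8 + 2 * M * (n%:R * del).
  apply: (norm_Rintegral_subr_le bf' bg' M2 _ _ (fg _ _ Z)).
  - by move=> i; exact: mset.
  - by move=> i; exact: (KP i).2.
have cg := cvg_Rintegral_trigpoly mX mZ Hcos Hsin tg.
have near_tight : \forall j \near F, forall i, (P [set w | (K < `|X j w 0 i|)%R] <= del%:E)%E.
  apply: filter_forall => i; exact: (KP i).1.
near=> j.
have HX : `|\int[P]_w f (X j w) - \int[P]_w g (X j w)| <= e / 8 + 2 * M * (n%:R * del).
  apply: (norm_Rintegral_subr_le (bf j) (bg j) M2 _ _ (fg _ _ (X j))).
  - by move=> i; exact: mset.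
  - by near: j.
have Hg : `|\int[P']_w g (Z w) - \int[P]_w g (X j w)| <= e / 4.
  by near: j; apply: cvgr_dist_le => //; lra.
move: (HZ) HX Hg.
rewrite !ler_norml; lra.
Unshelve. all: by end_near. Qed.

(* [f] is the supremum of its Lipschitz envelopes [inf_y (f y + k * D x y)], which
   bounds the limit inferior of the expectations from below; the same for [- f]
   bounds the limit superior. *)
Lemma cvg_distr_lipschitz (E : Type) (D : E -> E -> R) (X : J -> T -> E)
    (Z : T' -> E) (f : E -> R) (M : R) :
  (forall x y, 0 <= D x y) -> (forall x, D x x = 0) ->
  (forall x y, D x y = D y x) -> (forall x y z, D x z <= D x y + D y z) ->
  (forall (g : E -> R) (L N : R), (forall x, `|g x| <= N) ->
    (forall x y, `|g x - g y| <= L * D x y) ->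
    [/\ forall j, measurable_fun setT (fun w => g (X j w)),
        measurable_fun setT (fun w => g (Z w)) &
        (\int[P]_w g (X j w))%R @[j --> F] --> (\int[P']_w g (Z w))%R]) ->
  (forall x, `|f x| <= M) ->
  (forall x (e : R), 0 < e -> exists2 del : R, 0 < del &
    forall y, D x y < del -> `|f x - f y| <= e) ->
  [/\ forall j, bounded_mfun (fun w => f (X j w)),
      bounded_mfun (fun w => f (Z w)) &
      (\int[P]_w f (X j w))%R @[j --> F] --> (\int[P']_w f (Z w))%R].
Proof.
move=> D0 Dxx Dsym Dtri H.
have kD0 (k : nat) x y : 0 <= k%:R * D x y by rewrite mulr_ge0.
have lower (h : E -> R) : (forall x, `|h x| <= M) ->
  (forall x (e : R), 0 < e -> exists2 del : R, 0 < del &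
    forall y, D x y < del -> `|h x - h y| <= e) ->
  [/\ forall j, measurable_fun setT (fun w => h (X j w)),
      measurable_fun setT (fun w => h (Z w)) &
      forall e : R, 0 < e -> \forall j \near F,
        (\int[P']_w h (Z w) - e <= \int[P]_w h (X j w))%R].
  move=> hM hc.
  pose g (k : nat) x := inf (range (fun y => h y + k%:R * D x y)).
  have hb k x : has_lbound (range (fun y => h y + k%:R * D x y)).
    exists (- M) => _ [y _ <-]; have := hM y; rewrite ler_norml => /andP[].
    by have := kD0 k x y; lra.
  have g_le k x y : g k x <= h y + k%:R * D x y by apply: ge_inf => //; exists y.
  have le_g k x c : (forall y, c <= h y + k%:R * D x y) -> c <= g k x.
    by move=> cy; apply: lb_le_inf; [exists (h x + k%:R * D x x); exists x|move=> _ [y _ <-]].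
  have gh k x : g k x <= h x by have := g_le k x x; rewrite Dxx mulr0 addr0.
  have gM k x : `|g k x| <= M.
    rewrite ler_norml; apply/andP; split.
      apply: le_g => y; have := hM y; rewrite ler_norml => /andP[].
      by have := kD0 k x y; lra.
    by rewrite (le_trans (gh k x))//; have := hM x; rewrite ler_norml => /andP[].
  have gL1 k x y : g k x - k%:R * D x y <= g k y.
    apply: le_g => z; rewrite lerBlDr (le_trans (g_le k x z))// -addrA lerD2l.
    by rewrite -mulrDr ler_wpM2l// addrC.
  have gL k x y : `|g k x - g k y| <= k%:R * D x y.
    by rewrite ler_norml; have := gL1 k x y; have := gL1 k y x; rewrite (Dsym y x); lra.
  (* Within distance [del] of [x] continuity applies; beyond it the penalty [k * del] exceeds the
     oscillation [2 * M] once [k] is large. *)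
  have gcvg x : g k x @[k --> \oo] --> h x.
    apply/cvgrPdist_le => e e0; have [del del0 hdel] := hc x e e0.
    near=> k; rewrite ger0_norm ?subr_ge0// lerBlDr -lerBlDl.
    apply: le_g => y; have [/hdel|dy] := ltP (D x y) del.
      by rewrite ler_norml; have := kD0 k x y; lra.
    have : 2 * M <= k%:R * D x y.
      rewrite (@le_trans _ _ (k%:R * del))//; last by rewrite ler_wpM2l.
      by rewrite -ler_pdivrMr//; near: k; exact: nbhs_infty_ger.
    have := hM x; have := hM y; rewrite !ler_norml; lra.
  have mX k j : measurable_fun setT (fun w => g k (X j w)).
    by have [+ _ _] := H _ _ _ (gM k) (gL k).
  have mZ k : measurable_fun setT (fun w => g k (Z w)).
    by have [_ + _] := H _ _ _ (gM k) (gL k).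
  have mhX j : measurable_fun setT (fun w => h (X j w)).
    by apply: measurable_fun_cvg (fun k => mX k j) _ => w _; exact: gcvg.
  have mhZ : measurable_fun setT (fun w => h (Z w)).
    by apply: measurable_fun_cvg mZ _ => w _; exact: gcvg.
  split => // e e0.
  (* A single envelope is fixed before [j] moves: it is close in mean to [h] under the limit law and
     stays below [h] under every other law. *)
  have := cvg_Rintegral_bounded (P := P') mZ (fun k w => gM k (Z w)) (fun w => gcvg (Z w)).
  move=> /cvgrPdist_le /(_ (e / 2)) /(_ ltac:(lra)) [k _ /(_ k (leqnn k)) /=] h1.
  have [_ _ /cvgrPdist_le /(_ (e / 2)) /(_ ltac:(lra)) h2] := H _ _ _ (gM k) (gL k).
  near=> j.
  have h3 : `|\int[P']_w g k (Z w) - \int[P]_w g k (X j w)| <= e / 2 by near: j.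
  have h4 : (\int[P]_w g k (X j w) <= \int[P]_w h (X j w))%R.
    by apply: le_Rintegral_bmf => //; split => //; exists M.
  by move: h1 h3; rewrite !ler_norml; lra.
move=> fM fc.
have [mX mZ lo] := lower f fM fc.
have [||_ _ up] := lower (fun x => - f x).
- by move=> x; rewrite normrN.
- move=> x e e0; have [del del0 h] := fc x e e0; exists del => // y /h.
  by rewrite -opprD normrN.
have bX j : bounded_mfun (fun w => f (X j w)) by split => //; exists M.
have bZ : bounded_mfun (fun w => f (Z w)) by split => //; exists M.
split => //; apply/cvgrPdist_le => e e0; near=> j.
have h1 : (\int[P']_w f (Z w) - e <= \int[P]_w f (X j w))%R by near: j; exact: lo.
have : (\int[P']_w (- f (Z w)) - e <= \int[P]_w (- f (X j w)))%R by near: j; exact: up.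
have -> : (\int[P']_w (- f (Z w)) = - \int[P']_w f (Z w))%R.
  by rewrite -mulN1r -Rintegral_bmfZ//; apply: eq_Rintegral => w _; rewrite mulN1r.
have -> : (\int[P]_w (- f (X j w)) = - \int[P]_w f (X j w))%R.
  by rewrite -mulN1r -Rintegral_bmfZ//; apply: eq_Rintegral => w _; rewrite mulN1r.
by move: h1; rewrite ler_norml; lra.
Unshelve. all: by end_near. Qed.

End two_spaces.
End convergence_in_distribution.

(** * Characteristic functions and tails of the motion *)

Section characteristic_functions.
Context {R : realType}.
Notation mu := (@lebesgue_measure R).
Implicit Types (a h p : R) (alpha : R -> R).

(** Changing the combined integrand on a null set is allowed, which lets [frac_incr] replace
    [lf_kernel]. The two claims are the real and imaginary parts of one identity. *)
Lemma multistable_cos_sin {d} {T : measurableType d} (P : probability T R)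
    alpha (I : (R -> R) -> {RV P >-> R}) n (g : 'I_n -> R -> R)
    (th : 'I_n -> R) (f : R -> R) :
  measurable_fun setT alpha -> multistable_integral alpha I ->
  (forall j, Fspace alpha (g j)) -> measurable_fun setT f ->
  {ae mu, forall x, \sum_(j < n) th j * g j x = f x} ->
  ((\int[P]_w cos (\sum_(j < n) th j * I (g j) w) =
     expR (- fine (\int[mu]_x (`|f x| `^ alpha x)%:E)%E))%R *
  (\int[P]_w sin (\sum_(j < n) th j * I (g j) w) = 0)%R)%type.
Proof.
move=> ma HI Fg mf gf.
have := HI n g th Fg; rewrite /cexpectation unlock /= => -[Ec Es].
split; last exact: Es.
rewrite [LHS]Ec; congr (expR (- fine _)); apply: ge0_ae_eq_integral => //.
- apply/measurable_EFinP; apply: measurable_fun_powR2 => //.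
  apply: measurableT_comp => //; apply: measurable_sum => j.
  by apply: measurable_funM => //; have [] := Fg j.
- by apply/measurable_EFinP; apply: measurable_fun_powR2 => //; exact: measurableT_comp.
- case: gf => N [mN N0 gfN]; exists N; split=> // x /= h; apply: gfN => /= E.
  by apply: h => _; rewrite E.
Qed.

Lemma lf_motion_cos_sin {d} {T : measurableType d} (P : probability T R) a h
    alpha (I : (R -> R) -> {RV P >-> R}) n (c t : 'I_n -> R) :
  0 < a -> 0 < h < 1 -> measurable_fun setT alpha ->
  (forall x, a <= alpha x <= 2) -> multistable_integral alpha I ->
  ((\int[P]_w cos (\sum_(i < n) c i * lf_motion alpha h I (t i) w) =
     expR (- fine (\int[mu]_x
       (`|\sum_(i < n) c i * frac_incr (alpha x) h (t i) 0 x| `^ alpha x)%:E)%E))%R *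
  (\int[P]_w sin (\sum_(i < n) c i * lf_motion alpha h I (t i) w) = 0)%R)%type.
Proof.
move=> a0 h01 ma aal HI.
have al0 x : 0 < alpha x by case/andP: (aal x) => + _; lra.
apply: multistable_cos_sin => //.
- by move=> i; exact: (Fspace_lf_kernel _ a0).
- apply: measurable_sum => i; apply: measurable_funM => //.
  exact: measurable_frac_incr.
- apply: (@ae_off_points _ (0 :: [seq t i | i <- enum 'I_n])) => x.
  rewrite inE negb_or => /andP[x0 xt]; apply: eq_bigr => i _; rewrite lf_kernelE//.
  rewrite !inE negb_or x0/=; apply: contra xt => /eqP ->.
  by apply: map_f; rewrite mem_enum.
Qed.

(** With [p = alpha (u + r * z)], the kernel yields [r ^ (h - 1/p)] and the normalisation leaves
    [r ^ (- 1/p)], whose power [p] cancels the Jacobian [r]. All that remains of [r] is in the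
    index. *)
Lemma frac_incr_scaling h (u r : R) (r0 : 0 < r) n (th t : 'I_n -> R) alpha :
  measurable_fun setT alpha -> (forall x, 0 < alpha x) ->
  (\int[mu]_x (`|\sum_(i < n) (th i * r `^ (- h)) *
      frac_incr (alpha x) h (u + r * t i) u x| `^ alpha x)%:E =
   \int[mu]_z (`|\sum_(i < n) th i *
      frac_incr (alpha (u + r * z)) h (t i) 0 z| `^ alpha (u + r * z))%:E)%E.
Proof.
move=> ma al0.
pose f x := (`|\sum_(i < n) (th i * r `^ (- h)) *
      frac_incr (alpha x) h (u + r * t i) u x| `^ alpha x)%:E.
have mf : measurable_fun setT f.
  apply/measurable_EFinP; apply: measurable_fun_powR2 => //.
  apply: measurableT_comp => //; apply: measurable_sum => i.
  by apply: measurable_funM => //; exact: measurable_frac_incr.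
have f0 x : (0 <= f x)%E by rewrite lee_fin powR_ge0.
apply: (etrans (ge0_integral_affine u (lt0r_neq0 r0) mf f0)).
have mg : measurable_fun setT (fun z : R => u + r * z).
  by apply: measurable_funD => //; exact: measurable_funM.
have mag : measurable_fun setT (fun z => alpha (u + r * z)) by exact: measurableT_comp.
have mfg : measurable_fun setT (fun z => f (u + r * z)) by exact: measurableT_comp.
rewrite gtr0_norm// -(ge0_integralZl mu measurableT mfg)//; last by rewrite lee_fin ltW.
apply: eq_integral => z _; rewrite /f; set p := alpha _.
have p0 : 0 < p by exact: al0.
rewrite -EFinM; congr EFin.
have -> : \sum_(i < n) th i * r `^ (- h) * frac_incr p h (u + r * t i) u (u + r * z) =
    r `^ (- p^-1) * \sum_(i < n) th i * frac_incr p h (t i) 0 z.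
  rewrite mulr_sumr; apply: eq_bigr => i _.
  rewrite (_ : - p^-1 = - h + (h - p^-1)); last by ring.
  rewrite powRD; last by rewrite (gt_eqF r0) implybT.
  have := frac_incr_affine p h u (t i) 0 z r0; rewrite mulr0 addr0 => ->.
  ring.
rewrite normrM ger0_norm ?powR_ge0// powRM ?powR_ge0// -powRrM mulNr mulVf ?gt_eqF//.
by rewrite mulrA powR_inv1 ?ltW// divff ?gt_eqF// mul1r.
Qed.

Lemma cvg_frac_incr_integral a h (u : R) n (th t : 'I_n -> R) alpha :
  0 < a -> 0 < h < 1 -> (forall x, a <= alpha x <= 2) -> continuous alpha ->
  fine (\int[mu]_x (`|\sum_(i < n) (th i * r `^ (- h)) *
      frac_incr (alpha x) h (u + r * t i) u x| `^ alpha x)%:E)%E @[r --> 0^'+] -->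
  fine (\int[mu]_z (`|\sum_(i < n) th i *
      frac_incr (alpha u) h (t i) 0 z| `^ alpha u)%:E)%E.
Proof.
move=> a0 h01 aal ca.
have al0 x : 0 < alpha x by case/andP: (aal x) => + _; lra.
have ma : measurable_fun setT alpha by exact: continuous_measurable_fun.
have /choice[D DP] : forall i : 'I_n, exists D : R -> R, mu.-integrable setT (EFin \o D) /\
    forall p x, a <= p <= 2 -> `|th i * frac_incr p h (t i) 0 x| `^ p <= D x.
  by move=> i; have [D D1 D2] := frac_incr_dominated (th i) (t i) 0 a0 h01; exists D.
pose G z := 4 ^+ n * \sum_(i < n) D i z.
have bound p z : a <= p <= 2 -> `|\sum_(i < n) th i * frac_incr p h (t i) 0 z| `^ p <= G z.
  move=> ap; rewrite (le_trans (powR_norm_sum_le _ _))//; first by lra.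
  by rewrite ler_wpM2l ?exprn_ge0// ler_sum// => i _; exact: (DP i).2.
have iG : mu.-integrable setT (EFin \o G).
  have iS : mu.-integrable setT (fun x => \sum_(i < n) (EFin \o D i) x)%E.
    by apply: integrable_sum => // i _; exact: (DP i).1.
  apply: eq_integrable (integrableZl _ (4 ^+ n) iS) => // x _.
  by rewrite /= sumEFin -EFinM.
(* Dominated convergence is sequential, so the limit is taken along an arbitrary positive sequence
   tending to 0. *)
apply/cvg_at_rightP => r [r0 rcv].
under eq_fun => k do rewrite (frac_incr_scaling _ _ (r0 k))//.
pose S p z := \sum_(i < n) th i * frac_incr p h (t i) 0 z.
have mS p : 0 < p -> measurable_fun setT (S p).
  move=> p0; apply: measurable_sum => i; apply: measurable_funM => //.
  exact: (@measurable_frac_incr _ (cst p)).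
have mSk k : measurable_fun setT (fun z => S (alpha (u + r k * z)) z).
  apply: measurable_sum => i; apply: measurable_funM => //.
  apply: (@measurable_frac_incr _ (fun z => alpha (u + r k * z))) => //.
  by apply: measurableT_comp => //; apply: measurable_funD => //; exact: measurable_funM.
have iGb p : a <= p <= 2 -> (\int[mu]_z (`|S p z| `^ p)%:E)%E \is a fin_num.
  move=> ap; have p0 : 0 < p by lra.
  apply: integrable_fin_num => //; apply: le_integrable iG => //.
    apply/measurable_EFinP; apply: measurable_fun_powR2 => //.
    by apply: measurableT_comp => //; exact: mS.
  move=> z _ /=; rewrite lee_fin ger0_norm ?powR_ge0// (le_trans (bound p z ap))//.
  exact: ler_norm.
apply: fine_cvg; rewrite fineK; last exact: iGb.
apply: (@dominated_cvg _ _ _ mu setT _ _ _ (EFin \o G)) => //.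
- move=> k; apply/measurable_EFinP; apply: measurable_fun_powR2.
    by apply: measurableT_comp => //; exact: mSk.
  by apply: measurableT_comp => //; apply: measurable_funD => //; exact: measurable_funM.
- move=> z _; apply: cvg_EFin; first exact: nearW.
  have rz : u + r k * z @[k --> \oo] --> u.
    rewrite -[X in _ --> X]addr0 -(mul0r z); apply: cvgD; first exact: cvg_cst.
    by apply: cvgM => //; exact: cvg_cst.
  have arz : alpha (u + r k * z) @[k --> \oo] --> alpha u.
    by apply: continuous_cvg rz; exact: ca.
  apply: cvg_powR2 => //; apply: cvg_norm.
  apply: cvg_big; first exact: add_continuous.
  move=> i _; apply: cvgM; first exact: cvg_cst.
  exact: cvg_frac_incr.
- by move=> k z _; rewrite /= lee_fin ger0_norm ?powR_ge0// bound.
Qed.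

Lemma frac_incr_tail a h : 0 < a -> 0 < h < 1 -> exists2 K, 0 <= K &
  forall d (T : measurableType d) (P : probability T R) (X : T -> R) alpha (c t s lam : R),
    measurable_fun setT alpha -> (forall x, a <= alpha x <= 2) ->
    measurable_fun setT X ->
    (forall th, (\int[P]_w cos (th * X w) = expR (- fine (\int[mu]_x
        (`|th * c * frac_incr (alpha x) h t s x| `^ alpha x)%:E)%E))%R) ->
    0 < lam -> 2 * (`|c| * `|t - s| `^ h) <= lam ->
    (P [set w | (lam < `|X w|)%R] <= (K * (`|c| * `|t - s| `^ h / lam) `^ a)%:E)%E.
Proof.
move=> a0 h01; have [C C0 HC] := integral_frac_incr_le a0 h01.
exists (C * (pi / 2) `^ a / (1 - 2 `^ (- a))).
  rewrite divr_ge0 ?mulr_ge0 ?powR_ge0// subr_ge0 powRN invf_le1 ?powR_gt0//.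
  by rewrite -[leLHS](powRr0 2); apply: ler_powR; lra.
move=> d T P X alpha c t s lam ma aal mX HX lam0 clam.
set q := `|c| * _ in clam *; have q0 : 0 <= q by rewrite mulr_ge0 ?powR_ge0.
apply: prob_tail_le => // th th0 thlam.
(* The frequencies go up to [pi / 2 / lam], and [pi / 2 < 2] together with [2 * q <= lam] keeps
   [th * q] in the range of [integral_frac_incr_le]. The final step is [1 - exp (- J) <= J]. *)
have thq : th * q <= 1.
  rewrite (@le_trans _ _ (pi / 2 / lam * q))// ?ler_wpM2r//.
  rewrite mulrAC ler_pdivrMr// mul1r (le_trans _ clam)// ler_wpM2r//.
  by have := pihalf_lt2 R; lra.
have thc : `|th * c| * `|t - s| `^ h = th * q.
  by rewrite normrM ger0_norm// mulrA.
have := HC alpha (th * c) t s ma aal; rewrite thc => /(_ thq).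
rewrite HX; set J := (\int[mu]_x _)%E => HJ.
have J0 : (0 <= J)%E by apply: integral_ge0 => x _; rewrite lee_fin powR_ge0.
have Jf : J \is a fin_num by rewrite ge0_fin_numE// (le_lt_trans HJ) ?ltry.
move: HJ; rewrite -[leLHS](fineK Jf) lee_fin => HJ.
by have := expR_ge1Dx (- fine J); lra.
Qed.

(** If the motion vanished almost surely at time 1, its characteristic function at frequency 1 would
    be 1, while the exponent [J] is positive. *)
Lemma lf_motion_nontrivial {d} {T : measurableType d} (P : probability T R) h p
    (I : (R -> R) -> {RV P >-> R}) : 0 < h < 1 -> 0 < p <= 2 ->
  multistable_integral (cst p) I -> nontrivial_process (lf_motion (cst p) h I).
Proof.
move=> h01 /andP[p0 p2] HI; exists 1 => Y1.
have pp (x : R) : p <= cst p x <= 2 by rewrite /= lexx.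
have mp : measurable_fun setT (cst p : R -> R) by exact: measurable_cst.
have [+ _] := lf_motion_cos_sin (n := 1) (fun=> 1) (fun=> 1) p0 h01 mp pp HI.
rewrite (_ : (\int[P]_w _)%R = 1); last first.
  rewrite -[RHS](Rintegral_prob_cst P 1) /Rintegral; congr fine.
  apply: ae_eq_integral => //.
  - apply/measurable_EFinP; apply: (bounded_mfun_cos _).1.
    by apply: measurable_sum => i; apply: measurable_funM.
  - apply: filterS Y1 => w /= Yw _.
    by rewrite big_ord1 /= Yw mulr0 cos0.
set J := (\int[mu]_x _)%E => E1; suff : 0 < fine J.
  by move=> J0; have := expR_lt1 (- fine J); rewrite -E1 ltxx oppr_lt0 J0.
have JE : J = (\int[mu]_x (`|frac_incr p h 1 0 x| `^ p)%:E)%E.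
  by apply: eq_integral => x _; rewrite big_ord1 mul1r.
have mJ : measurable_fun setT (fun x => (`|frac_incr p h 1 0 x| `^ p)%:E).
  apply/measurable_EFinP; apply: measurable_fun_powR2 => //.
  apply: measurableT_comp => //.
  exact: (@measurable_frac_incr _ (cst p)).
have Jf : (J < +oo)%E.
  rewrite JE; apply: le_lt_trans (integral_frac_dom_lty p0 h01).
  apply: ge0_le_integral => //.
  - by apply/measurable_EFinP; exact: measurable_frac_dom.
  - by move=> x _; rewrite lee_fin frac_incr01_le// lexx.
(* On []0, 1/2[] the integrand is [(1 - x) ^ (h * p - 1)], at least [1 - x >= 1/2] because
   [h * p - 1 <= 1]; the interval has length 1/2. *)
have JL : ((4^-1)%:E <= J)%E.
  rewrite JE; apply: (@le_trans _ _ (\int[mu]_(x in `]0%R, 2^-1%R[) (2^-1)%:E)%E).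
    rewrite integral_cst//= lebesgue_measure_itv/= lte_fin invr_gt0 ltr0n.
    rewrite -EFinB -EFinM lee_fin; lra.
  apply: (@le_trans _ _ (\int[mu]_(x in `]0%R, 2^-1%R[) (`|frac_incr p h 1 0 x| `^ p)%:E)%E).
    apply: ge0_le_integral => //.
    - exact: measurable_funTS.
    - move=> x; rewrite /= in_itv/= => /andP[x0 x1]; rewrite lee_fin.
      rewrite /frac_incr /pos_powR subr_gt0 subr_gt0 (lt_trans x1) ?invf_lt1 ?ltr1n//.
      rewrite ltNge (ltW x0)/= subr0 ger0_norm ?powR_ge0// -powRrM.
      have -> : (h - p^-1) * p = h * p - 1 by field; lra.
      rewrite (@le_trans _ _ (1 - x))//; first by lra.
      rewrite -[leLHS]powRr1; last by lra.
      apply: ger_powR; first by lra.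
      have : h * p <= 1 * 2 by apply: ler_pM; lra.
      lra.
  apply: ge0_subset_integral => //.
rewrite -lte_fin fineK; first by apply: lt_le_trans JL; rewrite lte_fin invr_gt0.
by rewrite ge0_fin_numE// (le_trans _ JL)// lee_fin.
Qed.

End characteristic_functions.

(** * Dyadic chaining and continuous versions *)

Section dyadic_chaining.
Context {R : realType}.
Implicit Types (m n N : nat) (k : int) (t s rho : R) (f : R -> R).

Definition dyad m k : R := k%:~R / 2 ^+ m.

Definition dfloor m t : int := Num.floor (t * 2 ^+ m).

Lemma dyadS m k : dyad m.+1 (2 * k) = dyad m k.
Proof.
rewrite /dyad exprS intrM.
by field; rewrite gt_eqF// exprn_gt0.
Qed.

Lemma dyadD1 m k : dyad m (k + 1) = dyad m k + 2 ^- m.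
Proof. by rewrite /dyad intrD mulrDl mul1r. Qed.

Lemma dfloor_itv m t : dyad m (dfloor m t) <= t < dyad m (dfloor m t) + 2 ^- m.
Proof.
rewrite -dyadD1 /dyad ler_pdivrMr ?exprn_gt0// ltr_pdivlMr ?exprn_gt0//.
exact: floor_itv.
Qed.

Lemma dfloorS m t :
  dfloor m.+1 t = 2 * dfloor m t \/ dfloor m.+1 t = 2 * dfloor m t + 1.
Proof.
have /andP[h1 h2] := floor_itv (t * 2 ^+ m).
rewrite -/(dfloor m t) in h1 h2; set j := dfloor m t in h1 h2 *.
have E : t * 2 ^+ m.+1 = (t * 2 ^+ m) * 2 by rewrite exprSr mulrA.
have l : 2 * j <= dfloor m.+1 t.
  by rewrite /dfloor floor_ge_int E mulrC intrM ler_pM2r.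
have u : dfloor m.+1 t < 2 * j + 2.
  rewrite /dfloor floor_lt_int E intrD intrM.
  by move: h2; rewrite intrD; lra.
by move: l u; lia.
Qed.

Lemma dfloor_near m t s : `|t - s| <= 2 ^- m ->
  [\/ dfloor m t = dfloor m s, dfloor m t = dfloor m s + 1 | dfloor m s = dfloor m t + 1].
Proof.
move=> ts.
have H t' s' : `|t' - s'| <= 2 ^- m -> dfloor m t' <= dfloor m s' + 1.
  move=> ts'; rewrite -ltzD1 /dfloor floor_lt_int.
  have /andP[_ h2] := floor_itv (s' * 2 ^+ m).
  have p2 : 0 < (2 ^+ m : R) by rewrite exprn_gt0.
  have : (t' - s') * 2 ^+ m <= 1.
    by rewrite -ler_pdivlMr// div1r (le_trans (ler_norm _)).
  rewrite intrD; lra.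
have := H t s ts; rewrite distrC in ts; have := H s t ts.
set j := dfloor m t; set l := dfloor m s => h1 h2.
have [e|e|e] := ltgtP j l; [apply: Or33|apply: Or32|apply: Or31]; move: h1 h2 e; lia.
Qed.

Lemma dfloor_bound N m t : `|t| <= N%:R -> (`|dfloor m t| <= N * 2 ^ m)%N.
Proof.
rewrite ler_norml => /andP[t1 t2].
have p2 : 0 < (2 ^+ m : R) by rewrite exprn_gt0.
have E : (N * 2 ^ m)%:Z%:~R = N%:R * 2 ^+ m :> R by rewrite -pmulrn natrM natrX.
have l : - (N * 2 ^ m)%:Z <= dfloor m t.
  by rewrite /dfloor floor_ge_int mulrNz E -mulNr ler_pM2r.
have u : dfloor m t < (N * 2 ^ m)%:Z + 1.
  by rewrite /dfloor floor_lt_int intrD E (@le_lt_trans _ _ (N%:R * 2 ^+ m)) ?ler_pM2r// ltrDl.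
move: l u; lia.
Qed.

Lemma cvg_dfloor t : dyad m (dfloor m t) @[m --> \oo] --> t.
Proof.
apply/cvgrPdist_le => e e0; near=> m.
have /andP[h1 h2] := dfloor_itv m t.
rewrite ger0_norm ?subr_ge0// lerBlDl (le_trans (ltW h2))// lerD2l -[leLHS]div1r.
by apply/ltW; near: m; exact: (near_infty_natSinv_expn_lt (PosNum e0)).
Unshelve. all: by end_near. Qed.

(** The range of [k] contains every value of [dfloor m] on [[-N, N]], including [N * 2 ^ m], whose
    right neighbour falls just outside that interval. *)
Definition chain_good rho N n f := forall m k, (n <= m)%N -> (`|k| <= N * 2 ^ m)%N ->
  `|f (dyad m (k + 1)) - f (dyad m k)| <= rho ^+ m.

Section chain.
Variables (rho : R) (N n : nat) (f : R -> R).
Hypotheses (rho01 : 0 < rho < 1) (gf : chain_good rho N n f).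

Let rho0 : 0 < rho. Proof. by case/andP: rho01. Qed.
Let rho1 : 0 < 1 - rho. Proof. by case/andP: rho01; rewrite subr_gt0. Qed.

Lemma chain_step m t : (n <= m)%N -> `|t| <= N%:R ->
  `|f (dyad m.+1 (dfloor m.+1 t)) - f (dyad m (dfloor m t))| <= rho ^+ m.+1.
Proof.
move=> nm tN; rewrite -[dyad m (dfloor m t)]dyadS.
have [->|->] := dfloorS m t; first by rewrite subrr normr0 exprn_ge0 ?ltW.
apply: gf; first exact: leqW.
have := dfloor_bound m tN; rewrite expnS; lia.
Qed.

Lemma chain_sum i m t : (n <= m)%N -> `|t| <= N%:R ->
  `|f (dyad (m + i) (dfloor (m + i) t)) - f (dyad m (dfloor m t))| <=
    rho ^+ m / (1 - rho).
Proof.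
move=> nm tN.
apply: (@le_trans _ _ ((rho ^+ m - rho ^+ (m + i)) / (1 - rho))); last first.
  by rewrite ler_pM2r ?invr_gt0// gerBl exprn_ge0 ?ltW.
elim: i => [|i IH]; first by rewrite addn0 !subrr normr0 mul0r.
have := chain_step (leq_trans nm (leq_addr i m)) tN.
rewrite addnS; set A := f _; set B := f (dyad (m + i) _); set C := f _ => h.
have -> : A - C = (A - B) + (B - C) by rewrite /A /B /C; ring.
rewrite (le_trans (ler_normD _ _))//.
have h' : rho ^+ (m + i).+1 <= rho ^+ (m + i).
  by rewrite exprS ler_piMl ?exprn_ge0 ?ltW//; move: rho1; lra.
have -> : (rho ^+ m - rho ^+ (m + i).+1) / (1 - rho) =
    rho ^+ (m + i) + (rho ^+ m - rho ^+ (m + i)) / (1 - rho).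
  by rewrite exprS; field; rewrite gt_eqF.
by rewrite lerD// (le_trans h).
Qed.

Lemma chain_is_cvg t : `|t| <= N%:R -> cvgn (fun m => f (dyad m (dfloor m t))).
Proof.
move=> tN; apply: cauchy_cvg; apply: cauchy_exP => e e0.
have r1 : `|rho| < 1 by rewrite gtr0_norm// -subr_gt0.
have /cvgr0Pnorm_lt/(_ (e * (1 - rho))) := cvg_expr r1.
rewrite mulr_gt0// => /(_ isT) [m0 _ /(_ (maxn m0 n))].
rewrite /= leq_maxl => /(_ isT); set m := maxn m0 n => rm.
have nm : (n <= m)%N by rewrite leq_maxr.
exists (f (dyad m (dfloor m t))).
exists m => // i /= mi; rewrite /ball/= distrC -(subnKC mi).
rewrite (le_lt_trans (chain_sum _ nm tN))// ltr_pdivrMr//.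
by rewrite (le_lt_trans _ rm)// ler_norm.
Qed.

Variable F : R -> R.
Hypothesis fF : forall t, `|t| <= N%:R ->
  f (dyad m (dfloor m t)) @[m --> \oo] --> F t.

(** [F] is a parameter with two uses: the limit under construction when a version is built, and [f]
    itself when the path is already continuous. *)
Lemma chain_limit m t : (n <= m)%N -> `|t| <= N%:R ->
  `|F t - f (dyad m (dfloor m t))| <= rho ^+ m / (1 - rho).
Proof.
move=> nm tN.
have c : `|f (dyad i (dfloor i t)) - f (dyad m (dfloor m t))| @[i --> \oo] -->
    `|F t - f (dyad m (dfloor m t))|.
  by apply: cvg_norm; apply: cvgB; [exact: fF|exact: cvg_cst].
apply: (cvgr_to_le c); exists m => // i /= mi.
by rewrite -(subnKC mi) chain_sum.
Qed.

(** Points within [2 ^- m] have equal or adjacent dyadic floors, so one good jump joins the two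
    chains; each of the three pieces is at most [rho ^ m / (1 - rho)]. *)
Lemma chain_modulus m t s : (n <= m)%N -> `|t| <= N%:R -> `|s| <= N%:R ->
  `|t - s| <= 2 ^- m -> `|F t - F s| <= 3 * (rho ^+ m / (1 - rho)).
Proof.
move=> nm tN sN ts.
have h1 := chain_limit nm tN; have h2 := chain_limit nm sN.
have h3 : `|f (dyad m (dfloor m t)) - f (dyad m (dfloor m s))| <= rho ^+ m / (1 - rho).
  have rm : rho ^+ m <= rho ^+ m / (1 - rho).
    by rewrite ler_pdivlMr// ler_piMr ?exprn_ge0 ?(ltW rho0)// gerBl ltW.
  rewrite (le_trans _ rm)//.
  have [->|->|->] := dfloor_near ts.
  - by rewrite subrr normr0 exprn_ge0 ?ltW.
  - by apply: gf => //; exact: dfloor_bound.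
  - by rewrite distrC; apply: gf => //; exact: dfloor_bound.
move: h1 h2 h3; rewrite !ler_norml; lra.
Qed.

End chain.

Lemma chain_continuous rho f (F : R -> R) : 0 < rho < 1 ->
  (forall N, exists n, chain_good rho N n f) ->
  (forall t, f (dyad m (dfloor m t)) @[m --> \oo] --> F t) ->
  continuous F.
Proof.
move=> rho01 gf fF t; apply/cvgrPdist_le => e e0.
have rho0 : 0 < rho by case/andP: rho01.
have rho1 : 0 < 1 - rho by case/andP: rho01; rewrite subr_gt0.
(* One unit more than [|t|] requires, so that the points within distance 1 of [t] stay in
   [[-N, N]]. *)
pose N := (Num.truncn `|t|).+2.
have [n gn] := gf N.
have r1 : `|rho| < 1 by rewrite gtr0_norm// -subr_gt0.
have /cvgr0Pnorm_lt/(_ (e * (1 - rho) / 3)) := cvg_expr r1.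
rewrite divr_gt0 ?mulr_gt0// => /(_ isT) [m0 _ /(_ (maxn m0 n))].
rewrite /= leq_maxl => /(_ isT); set m := maxn m0 n => rm.
have nm : (n <= m)%N by rewrite leq_maxr.
have tN : `|t| + 1 <= N%:R.
  by rewrite /N -natr1 lerD2r ltW// truncnS_gt.
near=> s.
have ts : `|t - s| <= 2 ^- m by near: s; apply: cvgr_dist_le; rewrite ?invr_gt0 ?exprn_gt0.
have ts1 : `|t - s| <= 1 by near: s; exact: cvgr_dist_le.
have sN : `|s| <= N%:R.
  have -> : s = t - (t - s) by ring.
  by rewrite (le_trans (ler_normB _ _))// (le_trans _ tN)// lerD2l.
apply: (le_trans (chain_modulus rho01 gn _ nm _ sN ts)) => //; first lra.
rewrite mulrA ler_pdivrMr// mulrC -ler_pdivlMr// (le_trans _ (ltW rm))//.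
by rewrite ler_norm.
Unshelve. all: by end_near. Qed.

End dyadic_chaining.

(** * Kolmogorov's continuity criterion from tail bounds *)

Lemma cvg_geometric_bound {R : realType} (C q : R) : 0 <= q < 1 ->
  C * q ^+ n / (1 - q) @[n --> \oo] --> (0 : R).
Proof.
move=> /andP[q0 q1]; have nq : `|q| < 1 by rewrite ger0_norm.
have -> : (fun n => C * q ^+ n / (1 - q)) = (fun n => C / (1 - q) * q ^+ n).
  by apply/funext => n; rewrite mulrAC.
rewrite -[X in _ --> X](mulr0 (C / (1 - q))).
by apply: cvgM; [exact: cvg_cst|exact: cvg_expr].
Qed.

(** The scale [2 ^ (- h m)] of a step of length [2 ^- m] is split as [eta ^ m * rho ^ m]: [rho ^ m]
    is the permitted jump and [eta ^ m] the ratio entering the tail bound. A union over about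
    [2 ^ m] steps requires [2 * eta ^ a < 1], so the exponent of [eta] is put midway between [1/a]
    and [h]. *)
Lemma kolmogorov_rates {R : realType} (a h : R) : 0 < a -> a^-1 < h ->
  exists rho eta : R, [/\ 0 < rho < 1, 0 < eta < 1, 2 * eta `^ a < 1 &
    forall m x, 0 <= x -> x <= 2 ^- m -> x `^ h <= eta ^+ m * rho ^+ m].
Proof.
move=> a0 ha; have ai0 : 0 < a^-1 by rewrite invr_gt0.
have pow2_lt1 (x : R) : 0 < x -> 0 < 2 `^ (- x) < 1.
  move=> x0; rewrite powR_gt0//= powRN invf_lt1 ?powR_gt0//.
  by rewrite /powR gt_eqF// expR_gt1 mulr_gt0// ln_gt0// ltr1n.
have pow2D (x y : R) : 2 `^ (x + y) = 2 `^ x * 2 `^ y.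
  by rewrite powRD// pnatr_eq0/= implybT.
exists (2 `^ (- ((h - a^-1) / 2))), (2 `^ (- ((h + a^-1) / 2))); split.
- by apply: pow2_lt1; lra.
- by apply: pow2_lt1; lra.
- rewrite -powRrM -[X in X * _](@powRr1 _ 2)// -pow2D.
  have -> : 1 + - ((h + a^-1) / 2) * a = - ((h * a - 1) / 2) by field; rewrite gt_eqF.
  have h1 : 1 < h * a by rewrite -ltr_pdivrMr// div1r.
  by have /andP[] := @pow2_lt1 ((h * a - 1) / 2) ltac:(lra).
move=> m x x0 xm; rewrite -exprMn -pow2D.
have -> : - ((h + a^-1) / 2) + - ((h - a^-1) / 2) = - h by field; rewrite gt_eqF.
rewrite (@le_trans _ _ ((2 ^- m) `^ h))//; first by apply: ler_powR_homo => //; lra.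
by rewrite -[2 ^- m]powR_invn// -powRrM -powR_mulrn ?powR_ge0// -powRrM mulrC mulNr mulrN.
Qed.

Section borel_cantelli.
Context {R : realType} {d : measure_display} {T : measurableType d}
  (P : probability T R).
Variables (A : nat -> set T) (C q : R) (m0 : nat).
Hypotheses (mA : forall m, measurable (A m)) (C0 : 0 <= C) (q01 : 0 <= q < 1)
  (PA : forall m, (m0 <= m)%N -> (P (A m) <= (C * q ^+ m)%:E)%E).

Lemma prob_bigcup_geometric_le n : (m0 <= n)%N ->
  (P (\bigcup_(m in ~` `I_n) A m) <= (C * q ^+ n / (1 - q))%:E)%E.
Proof.
move=> m0n; have mU : measurable (\bigcup_(m in ~` `I_n) A m) by exact: bigcup_measurable.
have /le_trans := measure_sigma_subadditive_tail P mA mU (@subset_refl _ _); apply.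
apply: le_trans (nneseries_geometric_le n C0 q01).
have E (u : nat -> \bar R) : (\sum_(n <= k <oo) u k = \sum_(n <= k <oo | (n <= k)%N) u k)%E.
  by apply/congr_lim/funext => k /=; rewrite [RHS]big_nat_cond [LHS]big_nat_cond; apply: eq_bigl => i; case: (n <= i)%N.
rewrite E [leRHS]E; apply: lee_nneseries => [k _ _|k nk]; first exact: measure_ge0.
by apply: PA; exact: leq_trans nk.
Qed.

Lemma ae_eventually_notin : {ae P, forall w, exists n, forall m, (n <= m)%N -> ~ A m w}.
Proof.
exists (\bigcap_n \bigcup_(m in ~` `I_n) A m); split.
- by apply: bigcapT_measurable => n; exact: bigcup_measurable.
- apply/eqP; rewrite eq_le measure_ge0 andbT; apply/lee_addgt0Pr => e e0.
  rewrite add0e; have /andP[q0 q1] := q01.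
  have nq : `|q| < 1 by rewrite ger0_norm.
  have c := cvg_geometric_bound C q01.
  have /cvgr0Pnorm_le/(_ e e0)[n _ /(_ (maxn n m0))] := c.
  rewrite /= leq_maxl => /(_ isT) h.
  apply: (le_trans _ (le_trans (prob_bigcup_geometric_le (leq_maxr n m0)) _)).
    apply: le_measure; rewrite ?inE.
    - by apply: bigcapT_measurable => k; exact: bigcup_measurable.
    - exact: bigcup_measurable.
    - by move=> w; apply.
  by rewrite lee_fin (le_trans (ler_norm _)).
- move=> w /= H n _; apply: contrapT => nA; apply: H; exists n => m nm Am.
  by apply: nA; exists m => //=; rewrite leqNgt in nm; exact/negP.
Qed.

End borel_cantelli.

(** With [lam = rho ^ m], the condition [2 * |t - s| ^ h <= lam] of the tail bound becomes
    [2 * eta ^ m <= 1], which holds from some level on. *)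
Lemma half_bound_geometric {R : realType} (eta : R) : 0 < eta < 1 ->
  exists m0, forall m, (m0 <= m)%N -> 2 * eta ^+ m <= 1.
Proof.
move=> eta01.
have ne : `|eta| < 1 by case/andP: eta01 => e0 e1; rewrite gtr0_norm.
have /cvgr0Pnorm_le/(_ (2^-1)) := cvg_expr ne.
rewrite invr_gt0 => /(_ ltac:(lra)) [m0 _ H]; exists m0 => m /H /=.
by have := ler_norm (eta ^+ m); lra.
Qed.

Definition increments_tail {R : realType} (a h K : R) {d} {T : measurableType d} (P : probability T R)
    (V : R -> T -> R) : Prop :=
  forall t s lam, 0 < lam -> 2 * `|t - s| `^ h <= lam ->
  (P [set w | (lam < `|V t w - V s w|)%R] <= (K * (`|t - s| `^ h / lam) `^ a)%:E)%E.

Section kolmogorov.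
Context {R : realType}.
Variables (a h K rho eta : R).
Hypotheses (a0 : 0 < a) (K0 : 0 <= K) (rho01 : 0 < rho < 1) (eta01 : 0 < eta < 1)
  (q1 : 2 * eta `^ a < 1)
  (pow_step : forall m x, 0 <= x -> x <= 2 ^- m -> x `^ h <= eta ^+ m * rho ^+ m).

Let rho0 : 0 < rho. Proof. by case/andP: rho01. Qed.
Let eta0 : 0 < eta. Proof. by case/andP: eta01. Qed.

Let q01 : 0 <= 2 * eta `^ a < 1.
Proof. by rewrite mulr_ge0 ?powR_ge0. Qed.

Let etaXa m : (eta ^+ m) `^ a = (eta `^ a) ^+ m.
Proof.
by rewrite -powR_mulrn ?(ltW eta0)// -powRrM mulrC powRrM powR_mulrn ?powR_ge0.
Qed.

Section process.
Context {d : measure_display} {T : measurableType d} (P : probability T R).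
Variable V : R -> T -> R.
Hypotheses (mV : forall t, measurable_fun setT (V t)) (HV : increments_tail a h K P V).

Let jump m t s : set T := [set w | rho ^+ m < `|V t w - V s w|].

Let mjump m t s : measurable (jump m t s).
Proof.
have -> : jump m t s = (fun w => `|V t w - V s w|) @^-1` `]rho ^+ m, +oo[%classic.
  by apply/seteqP; split => w; rewrite /jump /= in_itv/= andbT.
rewrite -[X in measurable X]setTI; apply: measurableT_comp => //.
exact: measurable_funB.
Qed.

Let Pjump m t s : 2 * eta ^+ m <= 1 -> `|t - s| <= 2 ^- m ->
  (P (jump m t s) <= (K * (eta `^ a) ^+ m)%:E)%E.
Proof.
move=> em ts; have h1 := pow_step (normr_ge0 _) ts.
have r0 : 0 < rho ^+ m by rewrite exprn_gt0.
have h2 : 2 * `|t - s| `^ h <= rho ^+ m.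
  rewrite (@le_trans _ _ (2 * eta ^+ m * rho ^+ m))//; first by rewrite -mulrA ler_pM2l.
  by rewrite ler_piMl// ltW.
apply: (le_trans (HV r0 h2)).
rewrite lee_fin ler_wpM2l// -etaXa; case/andP: eta01 => e0 _; apply: ler_powR_homo.
- exact: ltW.
- by rewrite divr_ge0 ?powR_ge0// ltW.
- by rewrite ler_pdivrMr.
Qed.

(** The shift lets a natural index run over the integers from [- N * 2 ^ m] to [N * 2 ^ m], both
    included; hence the odd count in [bad]. *)
Let bad1 N m (i : nat) : set T :=
  jump m (dyad m (i%:Z - (N * 2 ^ m)%:Z + 1)) (dyad m (i%:Z - (N * 2 ^ m)%:Z)).

Let bad N m : set T := \big[setU/set0]_(i < (N * 2 ^ m).*2.+1) bad1 N m i.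

Let mbad N m : measurable (bad N m).
Proof. by apply: bigsetU_measurable => i _; exact: mjump. Qed.

Let Pbad N m : 2 * eta ^+ m <= 1 ->
  (P (bad N m) <= ((2 * N + 1)%:R * K * (2 * eta `^ a) ^+ m)%:E)%E.
Proof.
move=> em; have /le_trans := @Boole_inequality _ _ _ P (bad1 N m)
  (N * 2 ^ m).*2.+1 (fun i _ => mjump _ _ _); apply.
apply: (@le_trans _ _ (\sum_(i < (N * 2 ^ m).*2.+1) (K * (eta `^ a) ^+ m)%:E)%E).
  apply: lee_sum => i _; apply: Pjump => //.
  by rewrite dyadD1 addrAC subrr add0r ger0_norm// invr_ge0 exprn_ge0.
rewrite sumEFin sumr_const card_ord lee_fin -[leLHS]mulr_natl.
rewrite -!mulrA mulrCA [leRHS]mulrCA ler_wpM2l// exprMn.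
rewrite mulrA ler_wpM2r ?exprn_ge0 ?powR_ge0// -natrX -natrM ler_nat.
by rewrite mulnDl mul1n -muln2 mulnC mulnA -addn1 leq_add2l expn_gt0.
Qed.

Let notbad_good N n w : (forall m, (n <= m)%N -> ~ bad N m w) ->
  chain_good rho N n (V ^~ w).
Proof.
move=> H m k nm kN; rewrite leNgt; apply/negP => J; apply: (H m nm).
have i0 : (`|(k + (N * 2 ^ m)%:Z)%R| < (N * 2 ^ m).*2.+1)%N by move: kN; move: (N * 2 ^ m)%N => M; lia.
rewrite /bad -(bigcup_mkord _ (bad1 N m)); exists `|(k + (N * 2 ^ m)%:Z)%R|%N => //.
rewrite /bad1; have -> : `|(k + (N * 2 ^ m)%:Z)%R|%:Z - (N * 2 ^ m)%:Z = k by move: kN; move: (N * 2 ^ m)%N => M; lia.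
exact: J.
Qed.

Lemma kolmogorov_continuous_version_rates : exists Yc : T -> CR R,
  forall t, measurable_fun setT (fun w => eval_CR (Yc w) t) /\
    {ae P, forall w, eval_CR (Yc w) t = V t w}.
Proof.
have [m0 Hm0] := half_bound_geometric eta01.
have ae_good : {ae P, forall w N, exists n, chain_good rho N n (V ^~ w)}.
  apply: ae_foralln => N.
  have C0 : 0 <= (2 * N + 1)%:R * K by rewrite mulr_ge0.
  have [S [mS S0 SP]] := ae_eventually_notin (mbad N) C0 q01 (fun m mm => Pbad N (Hm0 m mm)).
  exists S; split=> // w /= ng; apply: SP => /= -[n Hn]; apply: ng; exists n.
  exact: notbad_good.
have [S [mS S0 SP]] := ae_good.
have goodw w : ~ S w -> forall N, exists n, chain_good rho N n (V ^~ w).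
  by move=> nS; apply: contrapT => ng; apply: nS; exact: SP.
(* On the null set the path is set to 0. The indicator factor makes the dyadic sequence converge for
   every [w], so measurability passes to the limit even though [Yc] comes from choice. *)
have /choice[Yc YcP] : forall w, exists F : CR R, forall t,
    (\1_(~` S) w * V (dyad m (dfloor m t)) w) @[m --> \oo] --> eval_CR F t.
  move=> w; have [Sw|nSw] := pselect (S w).
    exists (mkcts (@cst_continuous R R 0)) => t.
    rewrite indicE memNset; last by move=> /=; exact.
    under eq_fun do rewrite mul0r; exact: cvg_cst.
  have cv (t : R) : cvgn (fun m => V (dyad m (dfloor m t)) w).
    have [n gn] := goodw w nSw (Num.truncn `|t|).+1.
    apply: (chain_is_cvg rho01 gn); exact/ltW/truncnS_gt.
  have cF : continuous (fun t : R => limn (fun m => V (dyad m (dfloor m t)) w)).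
    exact: (chain_continuous rho01 (goodw w nSw)).
  exists (mkcts cF) => t; rewrite indicE mem_set//.
  by under eq_fun do rewrite mul1r; exact: cv.
exists Yc => t; split.
  apply: (@measurable_fun_cvg _ _ _ _ (fun m w => \1_(~` S) w * V (dyad m (dfloor m t)) w)).
    by move=> m; apply: measurable_funM => //; apply: measurable_indic; exact: measurableC.
  by move=> w _; exact: YcP.
(* The limit agrees with [V t] by a second application of Borel-Cantelli, to the jumps from the
   dyadic floors of [t] to [t] itself; its null set depends on [t]. *)
pose A m := jump m (dyad m (dfloor m t)) t.
have ea01 : 0 <= eta `^ a < 1.
  by rewrite powR_ge0/=; have := powR_ge0 eta a; move: q1; lra.
have PA m : (m0 <= m)%N -> (P (A m) <= (K * (eta `^ a) ^+ m)%:E)%E.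
  move=> /Hm0 em; apply: Pjump => //.
  have /andP[d1 d2] := dfloor_itv m t.
  by rewrite distrC ger0_norm ?subr_ge0// lerBlDl ltW.
have [S' [mS' S'0 S'P]] := ae_eventually_notin (fun m => mjump m _ _) K0 ea01 PA.
exists (S `|` S'); split.
- exact: measurableU.
- exact: etrans (measureU0 mS mS' S'0) S0.
move=> w /=; apply: contra_notP => /not_orP[nS nS'].
have [n Hn] : exists n, forall m, (n <= m)%N -> ~ A m w.
  by apply: contrapT => ng; apply: nS'; exact: S'P.
apply: (@cvg_unique _ _ (V (dyad m (dfloor m t)) w @[m --> \oo])) => //.
  have := YcP w t; rewrite indicE mem_set//.
  by under eq_fun do rewrite mul1r.
have /andP[r0 r1] := rho01.
apply/cvgrPdist_le => e e0.
have nr : `|rho| < 1 by rewrite gtr0_norm.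
have /cvgr0Pnorm_le/(_ e e0) := cvg_expr nr => re.
near=> m.
have /(Hn m) : (n <= m)%N by near: m; exact: nbhs_infty_ge.
rewrite /A /jump /= => /negP; rewrite -leNgt distrC => /le_trans; apply.
by rewrite (le_trans (ler_norm _))//; near: m.
Unshelve. all: by end_near. Qed.

Lemma chain_good_event_process N n : (forall m, (n <= m)%N -> 2 * eta ^+ m <= 1) ->
  exists A : set T, [/\ measurable A,
    (P A <= ((2 * N + 1)%:R * K * (2 * eta `^ a) ^+ n / (1 - 2 * eta `^ a))%:E)%E &
    forall w, ~ A w -> chain_good rho N n (V ^~ w)].
Proof.
move=> Hn; exists (\bigcup_(m in ~` `I_n) bad N m); split.
- exact: bigcup_measurable.
- apply: (@prob_bigcup_geometric_le _ _ _ P (bad N) _ _ n) => //.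
  + by rewrite mulr_ge0.
  + by move=> m /Hn em; exact: Pbad.
- move=> w nA; apply: notbad_good => m nm bm; apply: nA; exists m => //=.
  by apply/negP; rewrite -leqNgt.
Qed.

End process.
End kolmogorov.

Lemma kolmogorov_continuous_version {R : realType} (a h K : R)
    {d} {T : measurableType d} (P : probability T R) (V : R -> T -> R) :
  0 < a -> a^-1 < h -> 0 <= K -> (forall t, measurable_fun setT (V t)) ->
  increments_tail a h K P V ->
  exists Yc : T -> CR R, forall t,
    measurable_fun setT (fun w => eval_CR (Yc w) t) /\
    {ae P, forall w, eval_CR (Yc w) t = V t w}.
Proof.
move=> a0 ha K0 mV HV; have [rho [eta [r01 e01 q1 st]]] := kolmogorov_rates a0 ha.
exact: (kolmogorov_continuous_version_rates a0 K0 r01 e01 q1 st mV HV).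
Qed.

(** The level [n] is chosen before the process, so it is common to all rescalings of a motion and to
    its limit. *)
Lemma chain_good_event {R : realType} (a h K : R) : 0 < a -> a^-1 < h -> 0 <= K ->
  exists2 r : R, 0 < r < 1 & forall (e : R) N, 0 < e -> exists n,
  forall d (T : measurableType d) (P : probability T R) (V : R -> T -> R),
    (forall t, measurable_fun setT (V t)) -> increments_tail a h K P V ->
    exists A : set T, [/\ measurable A, (P A <= e%:E)%E &
      forall w, ~ A w -> chain_good r N n (V ^~ w)].
Proof.
move=> a0 ha K0; have [rho [eta [r01 e01 q1 st]]] := kolmogorov_rates a0 ha.
exists rho => // e N e0.
have q01 : 0 <= 2 * eta `^ a < 1 by rewrite mulr_ge0 ?powR_ge0.
have [m0 Hm0] := half_bound_geometric e01.
have /cvgr0Pnorm_le/(_ e e0)[n _ /(_ (maxn n m0))] :=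
  cvg_geometric_bound ((2 * N + 1)%:R * K) q01.
rewrite /= leq_maxl => /(_ isT) hn; exists (maxn n m0) => d T P V mV HV.
have [|A [mA PA gA]] := chain_good_event_process a0 K0 r01 e01 q1 st mV HV N (n := maxn n m0).
  by move=> m; rewrite geq_max => /andP[_ /Hm0].
exists A; split => //; apply: (le_trans PA).
by rewrite lee_fin (le_trans (ler_norm _)).
Qed.

(** * Convergence in distribution in C(R) *)

Section metric_CR.
Context {R : realType}.
Implicit Types (f g k : CR R) (t c e : R) (N m n : nat).

(* The cap [(1 + `|t|)^-1] makes a single supremum control uniform convergence
   on every bounded interval. *)
Definition dCR_term f g t : R :=
  Num.min `|eval_CR f t - eval_CR g t| (1 + `|t|)^-1.

Definition dCR f g : R := sup (range (dCR_term f g)).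

Let inv1_gt0 t : 0 < (1 + `|t|)^-1.
Proof. by rewrite invr_gt0 ltr_pwDl. Qed.

Lemma dCR_term_ge0 f g t : 0 <= dCR_term f g t.
Proof. by rewrite /dCR_term le_min normr_ge0 ltW. Qed.

Lemma dCR_ge f g t : dCR_term f g t <= dCR f g.
Proof.
apply: ub_le_sup; last by exists t.
exists 1 => _ [s _ <-]; rewrite /dCR_term ge_min; apply/orP; right.
by rewrite invf_le1 ?lerDl// ltr_pwDl.
Qed.

Lemma dCR_le f g c : (forall t, dCR_term f g t <= c) -> dCR f g <= c.
Proof.
move=> H; apply: ge_sup; first by exists (dCR_term f g 0), 0.
by move=> _ [s _ <-].
Qed.

Lemma dCR_ge0 f g : 0 <= dCR f g.
Proof. exact: le_trans (dCR_term_ge0 f g 0) (dCR_ge f g 0). Qed.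

Lemma dCRxx f : dCR f f = 0.
Proof.
apply/eqP; rewrite eq_le dCR_ge0 andbT; apply: dCR_le => t.
by rewrite /dCR_term subrr normr0 ge_min lexx.
Qed.

Lemma dCR_sym f g : dCR f g = dCR g f.
Proof. by rewrite /dCR /dCR_term; under eq_fun do rewrite distrC. Qed.

Lemma dCR_tri f g k : dCR f k <= dCR f g + dCR g k.
Proof.
apply: dCR_le => t; apply: (le_trans _ (lerD (dCR_ge f g t) (dCR_ge g k t))).
rewrite /dCR_term; have i0 := inv1_gt0 t; move: (_^-1) i0 => i i0.
have := ler_distD (eval_CR g t) (eval_CR f t) (eval_CR k t).
have := normr_ge0 (eval_CR f t - eval_CR g t).
have := normr_ge0 (eval_CR g t - eval_CR k t).
move: `|_| `|_| `|_| => x y z x0 y0 xyz; rewrite ge_min.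
case: (leP y i) => yi; case: (leP z i) => zi; 
  by apply/orP; first [left; lra|right; lra].
Qed.

Lemma dCR_le_unif f g N c : 0 <= c ->
  (forall t, `|t| <= N%:R -> `|eval_CR f t - eval_CR g t| <= c) ->
  dCR f g <= c + N.+1%:R^-1.
Proof.
move=> c0 H; apply: dCR_le => t; rewrite /dCR_term ge_min; apply/orP.
have [/H tN|tN] := leP `|t| N%:R; [left|right].
  by rewrite (le_trans tN)// lerDl invr_ge0.
rewrite (@le_trans _ _ N.+1%:R^-1) ?lerDr// lef_pV2 ?posrE ?ltr_pwDl//.
by rewrite -natr1 addrC lerD2l ltW.
Qed.

Lemma dCR_lt_unif f g N t e : `|t| <= N%:R -> e <= N.+1%:R^-1 -> dCR f g < e ->
  `|eval_CR f t - eval_CR g t| < e.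
Proof.
move=> tN eN /(le_lt_trans (dCR_ge f g t)); rewrite /dCR_term gt_min => /orP[//|].
rewrite ltNge => /negP[]; rewrite (le_trans eN)// lef_pV2 ?posrE ?ltr_pwDl//.
by rewrite -natr1 addrC lerD2r.
Qed.

(** The balls of [dCR] around [f] form a filter converging to [f] uniformly on bounded intervals,
    hence in the topology of [CR]; continuity of [F] is then applied along this filter. *)
Lemma continuous_dCR (F : CR R -> R) : continuous F -> forall f e, 0 < e ->
  exists2 del : R, 0 < del & forall g, dCR f g < del -> `|F f - F g| <= e.
Proof.
move=> cF f e e0.
pose B := filter_from [set r : R | 0 < r] (fun r => [set g | dCR f g < r]).
have FB : Filter B.
  apply: filter_from_filter; first by exists 1 => /=.
  move=> r s r0 s0; exists (Num.min r s); first by rewrite /= lt_min r0.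
  by move=> g /=; rewrite lt_min => /andP[].
have cB : {family @bounded_intervals R, (@eval_CR R) @ B --> eval_CR f}.
  apply/fam_cvgP => _ [c [d ->]] P /uniform_nbhs[E [/= entE EP]].
  have [r /= r0 rE] : exists2 r : R, 0 < r & forall x y : R, `|x - y| < r -> E (x, y).
    move: entE; rewrite -entourage_ballE => -[r /= r0 rE]; exists r => // x y xy; exact: rE.
  pose N := (Num.truncn (Num.max `|c| `|d|)).+1.
  exists (Num.min r N.+1%:R^-1); first by rewrite /= lt_min r0 invr_gt0 ltr0n.
  move=> g /= fg; apply: EP => t; rewrite /= in_itv/= => /andP[ct td].
  apply: rE; apply: (@lt_le_trans _ _ (Num.min r N.+1%:R^-1)); last by rewrite ge_min lexx.
  apply: (@dCR_lt_unif f g N) => //; last by rewrite ge_min lexx orbT.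
  rewrite (@le_trans _ _ (Num.max `|c| `|d|))//; last exact/ltW/truncnS_gt.
  rewrite le_max; have [t0|t0] := leP 0 t; apply/orP; [right|left].
    by rewrite !ger0_norm// (le_trans t0).
  rewrite !ler0_norm ?lerN2//; last exact: ltW.
  by rewrite (le_trans ct)// ltW.
have : B --> f.
  move=> A /= [_ [[C Cop <-] Cf CA]].
  have [r r0 rC] : ((@eval_CR R) @ B) C.
    by apply: cB; apply: open_nbhs_nbhs.
  by exists r => // g /rC Cg; exact: CA.
move=> /(_ [set g | `|F f - F g| <= e]) H.
have [|r r0 rP] := H; last by exists r.
by move/cvgrPdist_le : (cF f); exact.
Qed.

End metric_CR.

(** * Interpolation on a dyadic grid of a bounded interval *)

Section interpolation.
Context {R : realType}.
Implicit Types (t s c e : R) (N m n : nat) (f g : CR R).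

Definition clamp N t : R := Num.max (- N%:R) (Num.min N%:R t).

Lemma norm_clamp N t : `|clamp N t| <= N%:R.
Proof.
have N0 : 0 <= N%:R :> R by [].
rewrite /clamp ler_norml le_max lexx/= ge_max ge_min lexx andbT; lra.
Qed.

Lemma clamp_id N t : `|t| <= N%:R -> clamp N t = t.
Proof. by rewrite ler_norml => /andP[t1 t2]; rewrite /clamp min_r// max_r. Qed.

Lemma continuous_clamp N : continuous (clamp N).
Proof.
move=> t; apply: (@continuous_max _ _ (fun=> - N%:R) (fun s => Num.min N%:R s)).
  exact: cst_continuous.
by apply: (@continuous_min _ _ (fun=> N%:R) id); [exact: cst_continuous|exact: cvg_id].
Qed.

Definition node N m (i : nat) : R := dyad m (i%:Z - (N * 2 ^ m)%:Z).

Definition nnodes N m : nat := (N * 2 ^ m).*2.+1.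

Lemma norm_node N m (i : 'I_(nnodes N m)) : `|node N m i| <= N%:R.
Proof.
have p2 : 0 < (2 ^+ m : R) by rewrite exprn_gt0.
rewrite /node /dyad normrM [X in _ * X]ger0_norm ?invr_ge0 ?(ltW p2)// ler_pdivrMr//.
rewrite -natrX -natrM -intr_norm pmulrn ler_int.
have := ltn_ord i; rewrite /nnodes; lia.
Qed.

Definition hat N m (i : nat) t : R := Num.max 0 (2 ^- m - `|clamp N t - node N m i|).

Lemma hat_ge0 N m i t : 0 <= hat N m i t.
Proof. by rewrite /hat le_max lexx. Qed.

Lemma hat_eq0 N m i t : 2 ^- m < `|clamp N t - node N m i| -> hat N m i t = 0.
Proof. by move=> h; rewrite /hat max_l// subr_le0 ltW. Qed.

Lemma sum_hat_gt0 N m t : 0 < \sum_(i < nnodes N m) hat N m i t.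
Proof.
have kN := dfloor_bound m (norm_clamp N t).
have /andP[k1 k2] := dfloor_itv m (clamp N t).
set k := dfloor m (clamp N t) in kN k1 k2.
have iP : (`|(k + (N * 2 ^ m)%:Z)%R| < nnodes N m)%N by rewrite /nnodes; lia.
rewrite (bigD1 (Ordinal iP))//= ltr_pwDl//; last by apply: sumr_ge0 => i _; exact: hat_ge0.
rewrite /hat lt_max; apply/orP; right; rewrite /node /=.
have -> : `|(k + (N * 2 ^ m)%:Z)%R|%:Z - (N * 2 ^ m)%:Z = k by lia.
by rewrite subr_gt0 ger0_norm ?subr_ge0// ltrBlDl.
Qed.

(** Linear interpolation on [[-N, N]], extended by constants and written as a weighted average. Its
    value depends only on nodes within [2 ^- m], so the estimates reduce to positivity of the
    weights. *)
Definition interp N m (v : 'rV[R]_(nnodes N m)) t : R :=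
  (\sum_(i < nnodes N m) hat N m i t * v 0 i) / \sum_(i < nnodes N m) hat N m i t.

Lemma interp_close N m (v v' : 'rV[R]_(nnodes N m)) t e :
  (forall i : 'I_(nnodes N m), `|clamp N t - node N m i| <= 2 ^- m -> `|v 0 i - v' 0 i| <= e) ->
  `|interp v t - interp v' t| <= e.
Proof.
move=> H; have s0 := sum_hat_gt0 N m t.
rewrite /interp -mulrBl normrM [X in _ * X]ger0_norm ?invr_ge0 ?(ltW s0)//.
rewrite ler_pdivrMr// -sumrB mulr_sumr (le_trans (ler_norm_sum _ _ _))// ler_sum// => i _.
rewrite -mulrBr normrM (ger0_norm (hat_ge0 _ _ _ _)) mulrC.
have [/H h|/hat_eq0 ->] := leP `|clamp N t - node N m i| (2 ^- m); last by rewrite !mulr0.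
by rewrite ler_wpM2r// hat_ge0.
Qed.

Lemma interp_cst N m c t : interp (const_mx c : 'rV[R]_(nnodes N m)) t = c.
Proof.
rewrite /interp; under eq_bigr do rewrite mxE.
by rewrite -mulr_suml mulrAC divff ?mul1r// gt_eqF// sum_hat_gt0.
Qed.

Lemma continuous_interp N m (v : 'rV[R]_(nnodes N m)) : continuous (interp v).
Proof.
have ch i : continuous (hat N m i).
  move=> t; apply: (@continuous_max _ _ (fun=> 0) (fun s => 2 ^- m - `|clamp N s - node N m i|)).
    exact: cst_continuous.
  apply: cvgB; first exact: cvg_cst.
  apply: cvg_norm; apply: cvgB; [exact: continuous_clamp|exact: cvg_cst].
move=> t; apply: cvgM.
  apply: cvg_big => [|i _]; first exact: add_continuous.
   apply: cvgM; [exact: ch|exact: cvg_cst].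
apply: cvgV; first by rewrite gt_eqF// sum_hat_gt0.
by apply: cvg_big => [|i _]; [exact: add_continuous|exact: ch].
Qed.

Definition interp_CR N m (v : 'rV[R]_(nnodes N m)) : CR R := mkcts (@continuous_interp N m v).

Definition nodes_of N m f : 'rV[R]_(nnodes N m) := \row_i eval_CR f (node N m i).

Lemma dCR_interp_le N m (v v' : 'rV[R]_(nnodes N m)) e : 0 <= e ->
  (forall i, `|v 0 i - v' 0 i| <= e) -> dCR (interp_CR v) (interp_CR v') <= e.
Proof.
move=> e0 H; apply: dCR_le => t; rewrite /dCR_term ge_min; apply/orP; left.
by apply: interp_close => i _; exact: H.
Qed.

Definition modulus_le N m c f := forall t s, `|t| <= N%:R -> `|s| <= N%:R ->
  `|t - s| <= 2 ^- m -> `|eval_CR f t - eval_CR f s| <= c.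

Lemma interp_approx N m c f t : modulus_le N m c f ->
  `|eval_CR f (clamp N t) - interp (nodes_of N m f) t| <= c.
Proof.
move=> H; rewrite -{1}(@interp_cst N m (eval_CR f (clamp N t)) t).
apply: interp_close => i ti; rewrite !mxE; apply: H => //; first exact: norm_clamp.
exact: norm_node.
Qed.

Lemma dCR_interp_approx N m c f : modulus_le N m c f -> 0 <= c ->
  dCR f (interp_CR (nodes_of N m f)) <= c + N.+1%:R^-1.
Proof.
move=> H c0; apply: dCR_le_unif => // t tN.
by rewrite -{1}(clamp_id tN); exact: interp_approx.
Qed.

Lemma modulus_ex N c f : 0 < c ->
  exists n, forall m, (n <= m)%N -> modulus_le N m c f.
Proof.
move=> c0.
(* Row vectors of length one let [box_unif_continuous] supply uniform continuity on [[-N, N]]. *)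
have cf : continuous (fun x : 'rV[R]_1 => eval_CR f (x 0 0)).
  move=> x; apply: (@continuous_comp _ _ _ (fun x : 'rV[R]_1 => x 0 0) (eval_CR f)).
    exact: coord_continuous.
  exact: (@cts_fun _ _ (f : continuousType R R)).
have [del d0 H] := box_unif_continuous N%:R cf c0.
have [n _ Hn] := near_infty_natSinv_expn_lt (PosNum d0).
exists n => m nm t s tN sN ts.
have := H (const_mx t) (const_mx s).
rewrite !mxE; apply => i; rewrite !mxE//.
apply: (le_lt_trans ts); rewrite -[ltLHS]div1r.
exact: Hn.
Qed.

End interpolation.

(** * From finite-dimensional to functional convergence *)

Section convergence_in_CR.
Context {R : realType}.
Implicit Types (N m : nat) (c e L M : R) (f : CR R).

Lemma continuous_lipschitz_interp N m (g : CR R -> R) L :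
  (forall x y, `|g x - g y| <= L * dCR x y) ->
  continuous (fun v : 'rV[R]_(nnodes N m) => g (interp_CR v)).
Proof.
move=> gL v; apply/(@cvgrPdist_le _ _ _ (nbhs v) (nbhs_filter v)) => e e0.
pose del := e / (`|L| + 1).
have L1 : 0 < `|L| + 1 by rewrite ltr_pwDr.
have d0 : 0 < del by rewrite divr_gt0.
apply/nbhs_ballP; exists del => //= v' [_ vv']; rewrite (le_trans (gL _ _))//.
rewrite (@le_trans _ _ (`|L| * dCR (interp_CR v) (interp_CR v')))//.
  by rewrite ler_wpM2r ?dCR_ge0// ler_norm.
rewrite (@le_trans _ _ ((`|L| + 1) * del))//; last by rewrite /del mulrC divfK// gt_eqF.
rewrite ler_pM ?dCR_ge0// ?lerDl//; apply: dCR_interp_le; first exact: ltW.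
by move=> i; exact/ltW/vv'.
Qed.

Lemma continuous_clamp_CR N f : continuous (fun t => eval_CR f (clamp N t)).
Proof.
move=> t; apply: (@continuous_comp _ _ _ (clamp N) (eval_CR f)).
  exact: continuous_clamp.
exact: (@cts_fun _ _ (f : continuousType R R)).
Qed.

Definition clamp_CR N f : CR R := mkcts (@continuous_clamp_CR N f).

Lemma lipschitz_cvg (g : CR R -> R) L (u : nat -> CR R) f :
  (forall x y, `|g x - g y| <= L * dCR x y) ->
  (forall e, 0 < e -> exists n, forall m, (n <= m)%N -> dCR f (u m) <= e) ->
  g (u m) @[m --> \oo] --> g f.
Proof.
move=> gL uf; apply/cvgrPdist_le => e e0.
have L1 : 0 < `|L| + 1 by rewrite ltr_pwDr.
have [n Hn] := uf (e / (`|L| + 1)) (divr_gt0 e0 L1).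
exists n => // m /Hn h; rewrite (le_trans (gL _ _))//.
rewrite (@le_trans _ _ ((`|L| + 1) * dCR f (u m)))//.
  by rewrite ler_wpM2r ?dCR_ge0// (le_trans (ler_norm _))// lerDl.
by rewrite mulrC -ler_pdivlMr.
Qed.

(** An iterated limit: paths clamped to [[-N, N]] converge to the path in [dCR], and each clamped
    path is the uniform limit of its interpolants, on which [g] is a continuous function of finitely
    many coordinates. *)
Lemma measurable_lipschitz_CR {d} {T : measurableType d} (g : CR R -> R) L M
    (Y : T -> CR R) :
  (forall x, `|g x| <= M) -> (forall x y, `|g x - g y| <= L * dCR x y) ->
  (forall t, measurable_fun setT (fun w => eval_CR (Y w) t)) ->
  measurable_fun setT (fun w => g (Y w)).
Proof.
move=> gM gL mY.
apply: (@measurable_fun_cvg _ _ _ _ (fun N w => g (clamp_CR N (Y w)))); last first.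
  move=> w _; apply: (lipschitz_cvg gL) => e e0.
  have [n _ Hn] := near_infty_natSinv_lt (PosNum e0).
  exists n => m nm; rewrite (@le_trans _ _ (0 + m.+1%:R^-1))//; last by rewrite add0r ltW//; exact: Hn.
  apply: dCR_le_unif => // t tm.
  by rewrite -[eval_CR (clamp_CR m _) t]/(eval_CR _ (clamp m t)) clamp_id// subrr normr0.
move=> N.
apply: (@measurable_fun_cvg _ _ _ _ (fun m w => g (interp_CR (nodes_of N m (Y w))))).
  move=> m; apply: (bounded_mfun_continuous_rV _ (continuous_lipschitz_interp gL) _).1 => //.
  by move=> i; under eq_fun do rewrite mxE; exact: mY.
move=> w _; apply: (lipschitz_cvg gL) => e e0.
have [n Hn] := modulus_ex N (Y w) e0.
exists n => m nm; apply: dCR_le => t; rewrite /dCR_term ge_min; apply/orP; left.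
exact: (interp_approx _ (Hn m nm)).
Qed.

Context {d d' : measure_display} {T : measurableType d} {T' : measurableType d'}
  (P : probability T R) (P' : probability T' R) {J : Type} (F : set_system J)
  {FF : ProperFilter F}.

Lemma cvg_distr_CR (X : J -> T -> CR R) (Z : T' -> CR R) (f : CR R -> R) M :
  (forall j t, measurable_fun setT (fun w => eval_CR (X j w) t)) ->
  (forall t, measurable_fun setT (fun w => eval_CR (Z w) t)) ->
  (forall n (t : 'I_n -> R) (g : 'rV[R]_n -> R) (B : R), continuous g ->
    (forall x, `|g x| <= B) ->
    (\int[P]_w g (\row_i eval_CR (X j w) (t i)))%R @[j --> F] -->
    (\int[P']_w g (\row_i eval_CR (Z w) (t i)))%R) ->
  (forall N c e, 0 < c -> 0 < e -> exists m,
    (\forall j \near F, exists A : set T, [/\ measurable A, (P A <= e%:E)%E &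
       forall w, ~ A w -> modulus_le N m c (X j w)]) /\
    (exists A : set T', [/\ measurable A, (P' A <= e%:E)%E &
       forall w, ~ A w -> modulus_le N m c (Z w)])) ->
  continuous f -> (forall x, `|f x| <= M) ->
  [/\ forall j, bounded_mfun (fun w => f (X j w)),
      bounded_mfun (fun w => f (Z w)) &
      (\int[P]_w f (X j w))%R @[j --> F] --> (\int[P']_w f (Z w))%R].
Proof.
move=> mX mZ fdd tight cf fM.
apply: (@cvg_distr_lipschitz R _ _ T T' P P' J F _ _ (@dCR R) X Z f M) => //;
  [exact: dCR_ge0|exact: dCRxx|exact: dCR_sym|exact: dCR_tri| |exact: continuous_dCR].
move=> g L N gN gL.
have mgX j := measurable_lipschitz_CR gN gL (mX j).
have mgZ := measurable_lipschitz_CR gN gL mZ.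
split=> //.
have N0 : 0 <= N by exact: le_trans (gN (mkcts (@cst_continuous R R 0))).
apply/cvgrPdist_le => e e0.
have L1 : 0 < `|L| + 1 by rewrite ltr_pwDr.
pose c := e / (8 * (`|L| + 1)).
have c0 : 0 < c by rewrite divr_gt0// mulr_gt0.
(* [n] is the half-length of the interval on which paths are compared, and [1 / (n + 1) <= c] pays
   for what lies outside. The Lipschitz cost is [(|L| + 1) * 2 * c = e / 4]. *)
have [n _ /(_ n (leqnn n)) /ltW /= nc] := near_infty_natSinv_lt (PosNum c0).
pose del := e / (8 * (2 * N + 1)).
have del0 : 0 < del by rewrite divr_gt0// mulr_gt0//; lra.
have delE : 2 * N * (1%:R * del) <= e / 8.
  rewrite mul1r /del mulrA ler_pdivrMr; last by lra.
  by nra.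
have [m [HX HZ]] := tight n c del c0 del0.
pose G (x : CR R) := g (interp_CR (nodes_of n m x)).
have gG d0 (T0 : measurableType d0) (Y : T0 -> CR R) (A : set T0) :
    (forall w, ~ A w -> modulus_le n m c (Y w)) ->
    forall w, `|g (Y w) - G (Y w)| <= e / 4 + 2 * N * \sum_(i < 1) \1_A w.
  move=> HA w; rewrite big_ord1 indicE.
  have [Aw|nAw] := pselect (A w).
    rewrite mem_set// mulr1 (@le_trans _ _ (2 * N))//; last by rewrite lerDr; lra.
    by rewrite (le_trans (ler_normB _ _))//; have := gN (Y w); have := gN (interp_CR (nodes_of n m (Y w))); rewrite /G; lra.
  rewrite memNset// mulr0 addr0 (le_trans (gL _ _))//.
  rewrite (@le_trans _ _ ((`|L| + 1) * (c + c)))//; last first.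
    by rewrite /c le_eqVlt; apply/orP; left; apply/eqP; field; rewrite gt_eqF.
  apply: (@le_trans _ _ ((`|L| + 1) * dCR (Y w) (interp_CR (nodes_of n m (Y w))))).
    by rewrite ler_wpM2r ?dCR_ge0// (le_trans (ler_norm _))// lerDl.
  rewrite ler_pM2l// (le_trans (dCR_interp_approx (HA w nAw) (ltW c0)))// lerD2l.
  exact: nc.
have bgX j : bounded_mfun (fun w => g (X j w)) by split => //; exists N.
have bgZ : bounded_mfun (fun w => g (Z w)) by split => //; exists N.
have cG := @continuous_lipschitz_interp n m g L gL.
have bGX j : bounded_mfun (fun w => G (X j w)).
  apply: (bounded_mfun_continuous_rV _ cG (fun=> gN _)) => i.
  by under eq_fun do rewrite mxE; exact: mX.
have bGZ : bounded_mfun (fun w => G (Z w)).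
  apply: (bounded_mfun_continuous_rV _ cG (fun=> gN _)) => i.
  by under eq_fun do rewrite mxE; exact: mZ.
have N2 : 0 <= 2 * N by rewrite mulr_ge0.
have eZ : `|\int[P']_w g (Z w) - \int[P']_w G (Z w)| <= e / 4 + 2 * N * (1%:R * del).
  have [A [mA PA HA]] := HZ.
  exact: (@norm_Rintegral_subr_le _ _ _ P' _ _ _ _ _ _ (fun=> A) bgZ bGZ N2 _ _ (gG _ _ Z A HA)).
have cGZ := fdd _ (fun i : 'I_(nnodes n m) => node n m i) _ _ cG (fun=> gN _).
near=> j.
have eX : `|\int[P]_w g (X j w) - \int[P]_w G (X j w)| <= e / 4 + 2 * N * (1%:R * del).
  have [A [mA PA HA]] : exists A : set T, [/\ measurable A, (P A <= del%:E)%E &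
       forall w, ~ A w -> modulus_le n m c (X j w)] by near: j.
  exact: (@norm_Rintegral_subr_le _ _ _ P _ _ _ _ _ _ (fun=> A) (bgX j) (bGX j) N2 _ _ (gG _ _ (X j) A HA)).
have eG : `|\int[P']_w G (Z w) - \int[P]_w G (X j w)| <= e / 8.
  by near: j; apply: cvgr_dist_le => //; lra.
move: (eX) (eZ) (eG) (delE); rewrite !ler_norml; lra.
Unshelve. all: by end_near. Qed.

End convergence_in_CR.

(** * The local limit *)

Section versions.
Context {R : realType} {d : measure_display} {T : measurableType d}
  (P : probability T R).

(** One set of computations then covers both the motion, a version of itself, and its continuous
    version. *)
Definition version_of (Y V : R -> T -> R) := forall t,
  measurable_fun setT (V t) /\ {ae P, forall w, V t w = Y t w}.

Lemma eq_ae_Rintegral (f g : T -> R) : measurable_fun setT f ->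
  measurable_fun setT g -> {ae P, forall w, f w = g w} ->
  (\int[P]_w f w = \int[P]_w g w)%R.
Proof.
move=> mf mg fg; rewrite /Rintegral; congr fine; apply: ae_eq_integral => //.
- exact/measurable_EFinP.
- exact/measurable_EFinP.
- by apply: filterS fg => w /= -> _.
Qed.

Section lf_motion_version.
Variables (a h : R) (alpha : R -> R) (I : (R -> R) -> {RV P >-> R}).
Hypotheses (a0 : 0 < a) (h01 : 0 < h < 1) (ma : measurable_fun setT alpha)
  (aal : forall x, a <= alpha x <= 2) (HI : multistable_integral alpha I).
Variable V : R -> T -> R.
Hypothesis YV : version_of (fun t w => lf_motion alpha h I t w) V.

Lemma version_cos_sin n (c t : 'I_n -> R) :
  ((\int[P]_w cos (\sum_(i < n) c i * V (t i) w) =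
     expR (- fine (\int[@lebesgue_measure R]_x
       (`|\sum_(i < n) c i * frac_incr (alpha x) h (t i) 0 x| `^ alpha x)%:E)%E))%R *
  (\int[P]_w sin (\sum_(i < n) c i * V (t i) w) = 0)%R)%type.
Proof.
have [Ec Es] := lf_motion_cos_sin c t a0 h01 ma aal HI.
have mV : measurable_fun setT (fun w => \sum_(i < n) c i * V (t i) w).
  by apply: measurable_sum => i; apply: measurable_funM => //; exact: (YV _).1.
have mY : measurable_fun setT (fun w => \sum_(i < n) c i * lf_motion alpha h I (t i) w).
  by apply: measurable_sum => i; exact: measurable_funM.
have E : {ae P, forall w, forall i : 'I_n, V (t i) w = lf_motion alpha h I (t i) w}.
  by apply: filter_forall => i; exact: (YV (t i)).2.
have E' : {ae P, forall w, \sum_(i < n) c i * V (t i) w =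
    \sum_(i < n) c i * lf_motion alpha h I (t i) w}.
  by apply: filterS E => w Ew; apply: eq_bigr => i _; rewrite Ew.
split; [apply: etrans Ec|apply: etrans Es]; apply: eq_ae_Rintegral.
- exact: (bounded_mfun_cos _).1.
- exact: (bounded_mfun_cos _).1.
- by apply: filterS E' => w ->.
- exact: (bounded_mfun_sin _).1.
- exact: (bounded_mfun_sin _).1.
- by apply: filterS E' => w ->.
Qed.

(** A combination of [n] increments is treated as a combination of [2 n] values with opposite
    coefficients; the reference point 0 of the kernels cancels in each pair. *)
Lemma version_increments_cos_sin n (c t s : 'I_n -> R) :
  ((\int[P]_w cos (\sum_(i < n) c i * (V (t i) w - V (s i) w)) =
     expR (- fine (\int[@lebesgue_measure R]_x
       (`|\sum_(i < n) c i * frac_incr (alpha x) h (t i) (s i) x| `^ alpha x)%:E)%E))%R *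
  (\int[P]_w sin (\sum_(i < n) c i * (V (t i) w - V (s i) w)) = 0)%R)%type.
Proof.
pose c' (k : 'I_(n + n)) := match fintype.split k with inl i => c i | inr i => - c i end.
pose t' (k : 'I_(n + n)) := match fintype.split k with inl i => t i | inr i => s i end.
have E (G : R -> R) : \sum_(k < n + n) c' k * G (t' k) = \sum_(i < n) c i * (G (t i) - G (s i)).
  rewrite big_split_ord/= -big_split/=; apply: eq_bigr => i _.
  by rewrite /c' /t' (unsplitK (inl i)) (unsplitK (inr i)) mulrBr mulNr.
have [Ec Es] := version_cos_sin c' t'.
have EY w : \sum_(i < n) c i * (V (t i) w - V (s i) w) = \sum_(k < n + n) c' k * V (t' k) w.
  exact/esym/(E (fun t => V t w)).
have EK x : \sum_(i < n) c i * frac_incr (alpha x) h (t i) (s i) x =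
    \sum_(k < n + n) c' k * frac_incr (alpha x) h (t' k) 0 x.
  rewrite (E (fun t => frac_incr (alpha x) h t 0 x)); apply: eq_bigr => i _.
  by congr (_ * _); rewrite /frac_incr; ring.
split.
  under eq_Rintegral do rewrite EY; rewrite Ec; congr (expR (- fine _)).
  by apply: eq_integral => x _; rewrite EK.
by under eq_Rintegral do rewrite EY.
Qed.

End lf_motion_version.
End versions.

(* The factor [c] is [r `^ (- h)] for the rescaled motion: self-similarity makes
   the tail bound of its increments independent of [r]. *)
Definition scaled_increments_tail {R : realType} (a h K : R) {d} {T : measurableType d}
    (P : probability T R) (V : R -> T -> R) : Prop :=
  forall c t s lam, 0 < lam -> 2 * (`|c| * `|t - s| `^ h) <= lam ->
  (P [set w | (lam < `|c * (V t w - V s w)|)%R] <=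
    (K * (`|c| * `|t - s| `^ h / lam) `^ a)%:E)%E.

Lemma lf_motion_tail {R : realType} (a h : R) : 0 < a -> 0 < h < 1 ->
  exists2 K : R, 0 <= K &
  forall d (T : measurableType d) (P : probability T R) (alpha : R -> R)
    (I : (R -> R) -> {RV P >-> R}) (V : R -> T -> R),
    measurable_fun setT alpha -> (forall x, a <= alpha x <= 2) ->
    multistable_integral alpha I ->
    version_of P (fun t w => lf_motion alpha h I t w) V ->
    scaled_increments_tail a h K P V /\
    forall t lam, 0 < lam -> 2 * `|t| `^ h <= lam ->
      (P [set w | (lam < `|V t w|)%R] <= (K * (`|t| `^ h / lam) `^ a)%:E)%E.
Proof.
move=> a0 h01; have [K K0 HK] := frac_incr_tail a0 h01.
exists K => // d T P alpha I V ma aal HI YV; split.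
  move=> c t s lam lam0 tslam; apply: (HK d T P _ alpha) => //.
    by apply: measurable_funM => //; apply: measurable_funB; exact: (YV _).1.
  move=> th.
  have [+ _] := version_increments_cos_sin a0 h01 ma aal HI YV
    (fun _ : 'I_1 => th * c) (fun=> t) (fun=> s).
  under eq_Rintegral do rewrite big_ord1 -mulrA.
  by under eq_integral do rewrite big_ord1.
move=> t lam lam0 tlam.
have tE : `|1 : R| * `|t - 0| `^ h = `|t| `^ h by rewrite normr1 mul1r subr0.
rewrite -tE in tlam *; apply: (HK d T P _ alpha) => //; first exact: (YV _).1.
move=> th.
have [+ _] := version_cos_sin a0 h01 ma aal HI YV (fun _ : 'I_1 => th * 1) (fun=> t).
under eq_Rintegral do rewrite big_ord1 mulr1.
by under eq_integral do rewrite big_ord1.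
Qed.

Lemma increments_tail_rescale {R : realType} (a h K u r : R) {d} {T : measurableType d}
    (P : probability T R) (V : R -> T -> R) : 0 < r ->
  scaled_increments_tail a h K P V ->
  increments_tail a h K P (fun t w => rescale h u r (V ^~ w) t).
Proof.
move=> r0 HV t s lam lam0.
have rE : `|r `^ (- h)| * `|(u + r * t) - (u + r * s)| `^ h = `|t - s| `^ h.
  rewrite opprD addrACA subrr add0r -mulrBr normrM (gtr0_norm r0) powRM ?(ltW r0)//.
  by rewrite (ger0_norm (powR_ge0 _ _)) mulrA powRN mulVf ?mul1r// gt_eqF// powR_gt0.
rewrite -rE => /(HV _ _ _ _ lam0); congr (_ <= _)%E; congr (P _).
apply/seteqP; split => w /=; rewrite (_ : rescale _ _ _ _ _ - _ =
  r `^ (- h) * (V (u + r * t) w - V (u + r * s) w))//; rewrite /rescale; ring.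
Qed.

Lemma increments_tail_scaled {R : realType} (a h K : R) {d} {T : measurableType d}
    (P : probability T R) (V : R -> T -> R) :
  scaled_increments_tail a h K P V -> increments_tail a h K P V.
Proof.
move=> HV t s lam lam0; have := HV 1 t s lam lam0; rewrite normr1 mul1r => H /H.
by under eq_set do rewrite mul1r.
Qed.

Lemma tail_threshold {R : realType} (a K m e : R) : 0 < a -> 0 <= K -> 0 <= m -> 0 < e ->
  exists2 lam : R, 0 < lam /\ 2 * m <= lam &
    forall q, 0 <= q <= m -> K * (q / lam) `^ a <= e.
Proof.
move=> a0 K0 m0 e0; have K1 : 0 < K + 1 by lra.
pose del := (e / (K + 1)) `^ a^-1.
have d0 : 0 < del by apply: powR_gt0; exact: divr_gt0.
have md0 : 0 <= m / del by rewrite divr_ge0 ?(ltW d0).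
(* The three summands make [lam] admissible for the tail bound, make [q / lam] at most [del], and
   make [lam] positive even when [m = 0]. *)
have lam0 : 0 < 2 * m + m / del + 1 by lra.
exists (2 * m + m / del + 1); first by split => //; lra.
move=> q /andP[q0 qm].
have qd : q / (2 * m + m / del + 1) <= del.
  rewrite ler_pdivrMr// mulrC -ler_pdivrMr// (@le_trans _ _ (m / del))//; last lra.
  by rewrite ler_pM2r// invr_gt0.
have : (q / (2 * m + m / del + 1)) `^ a <= e / (K + 1).
  rewrite (@le_trans _ _ (del `^ a))//.
    by apply: ler_powR_homo => //; [exact: ltW|rewrite divr_ge0// ltW].
  by rewrite /del -powRrM mulVf ?gt_eqF// powRr1// divr_ge0// ltW.
move=> h; rewrite (@le_trans _ _ (K * (e / (K + 1))))// ?ler_wpM2l//.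
by rewrite mulrCA ler_piMr ?(ltW e0)// ler_pdivrMr// mul1r; lra.
Qed.

(** A continuous path is its own limit along dyadic floors, so [chain_modulus] applies with [F]
    equal to [f]. The level [m] is independent of the process. *)
Lemma uniform_modulus {R : realType} (a h K : R) N (c e : R) :
  0 < a -> a^-1 < h -> 0 <= K -> 0 < c -> 0 < e -> exists m,
  forall d (T : measurableType d) (P : probability T R) (X : T -> CR R),
    (forall t, measurable_fun setT (fun w => eval_CR (X w) t)) ->
    increments_tail a h K P (fun t w => eval_CR (X w) t) ->
    exists A : set T, [/\ measurable A, (P A <= e%:E)%E &
      forall w, ~ A w -> modulus_le N m c (X w)].
Proof.
move=> a0 ha K0 c0 e0; have [r r01 Hr] := chain_good_event a0 ha K0.
have [n Hn] := Hr e N e0.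
have r01' : 0 <= r < 1 by case/andP: r01 => r0 ->; rewrite ltW.
have /cvgr0Pnorm_le/(_ c c0)[m0 _ /(_ (maxn m0 n))] := cvg_geometric_bound 3 r01'.
rewrite /= leq_maxl => /(_ isT) hm; exists (maxn m0 n) => d T P X mX HX.
have [A [mA PA HA]] := Hn _ _ _ _ mX HX; exists A; split => // w /HA gw t s tN sN ts.
have := chain_modulus (F := eval_CR (X w)) r01 gw _ (leq_maxr m0 n) tN sN ts.
move=> /(_ _)/le_trans; apply; last by rewrite mulrA (le_trans (ler_norm _)).
move=> t' _; apply: (@cvg_comp _ _ _ (fun m => dyad m (dfloor m t')) (eval_CR (X w))).
  exact: cvg_dfloor.
exact: (@cts_fun _ _ (X w : continuousType R R)).
Qed.

Section local_limit.
Context {R : realType} {d d' : measure_display} {T : measurableType d}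
  {T' : measurableType d'} (P : probability T R) (P' : probability T' R).
Variables (a h u : R) (alpha : R -> R) (I : (R -> R) -> {RV P >-> R})
  (I' : (R -> R) -> {RV P' >-> R}).
Hypotheses (a0 : 0 < a) (h01 : 0 < h < 1) (ca : continuous alpha)
  (aal : forall x, a <= alpha x <= 2) (HI : multistable_integral alpha I)
  (HI' : multistable_integral (cst (alpha u)) I').

Let ma : measurable_fun setT alpha. Proof. exact: continuous_measurable_fun. Qed.

Let ma' : measurable_fun setT (cst (alpha u) : R -> R).
Proof. exact: measurable_cst. Qed.

Let aal' x : a <= (cst (alpha u) : R -> R) x <= 2. Proof. exact: aal. Qed.

Variables (V : R -> T -> R) (W : R -> T' -> R).
Hypotheses (YV : version_of P (fun t w => lf_motion alpha h I t w) V)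
  (ZW : version_of P' (fun t w => lf_motion (cst (alpha u)) h I' t w) W).

Let mV t : measurable_fun setT (V t). Proof. exact: (YV t).1. Qed.

Let mW t : measurable_fun setT (W t). Proof. exact: (ZW t).1. Qed.

Let mresc r t : measurable_fun setT (fun w => rescale h u r (V ^~ w) t).
Proof. by apply: measurable_funM => //; exact: measurable_funB. Qed.

Lemma cvg_fdd_lf_motion n (t : 'I_n -> R) (f : 'rV[R]_n -> R) (M : R) :
  continuous f -> (forall x, `|f x| <= M) ->
  (\int[P]_w f (\row_i rescale h u r (V ^~ w) (t i)))%R @[r --> 0^'+] -->
  (\int[P']_w f (\row_i W (t i) w))%R.
Proof.
move=> cf fM.
have [K K0 HK] := lf_motion_tail a0 h01.
have [HV _] := HK _ _ _ _ _ _ ma aal HI YV.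
have [_ HW] := HK _ _ _ _ _ _ ma' aal' HI' ZW.
have EX (g : R -> R) th r : (\int[P]_w g (\sum_(i < n) th i * (\row_i rescale h u r (V ^~ w) (t i)) 0 i) =
    \int[P]_w g (\sum_(i < n) (th i * r `^ (- h)) * (V (u + r * t i) w - V u w)))%R.
  apply: eq_Rintegral => w _; congr g; apply: eq_bigr => i _.
  by rewrite mxE /rescale mulrA.
have EZ (g : R -> R) th : (\int[P']_w g (\sum_(i < n) th i * (\row_i W (t i) w) 0 i) =
    \int[P']_w g (\sum_(i < n) th i * W (t i) w))%R.
  by apply: eq_Rintegral => w _; congr g; apply: eq_bigr => i _; rewrite mxE.
apply: (@levy_continuity R _ _ T T' P P' R (0^'+) _ n
  (fun r w => \row_i rescale h u r (V ^~ w) (t i)) (fun w => \row_i W (t i) w) f M) => //.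
- by move=> r i; under eq_fun do rewrite mxE; exact: mresc.
- by move=> i; under eq_fun do rewrite mxE; exact: mW.
- move=> th; rewrite EZ (funext (EX _ th)) (version_cos_sin a0 h01 ma' aal' HI' ZW th t).1.
  under eq_fun do rewrite (version_increments_cos_sin a0 h01 ma aal HI YV _ _ _).1.
  apply: continuous_cvg; first exact: continuous_expR.
  by apply: cvgN; exact: (@cvg_frac_incr_integral R a h u n th t alpha a0 h01 aal ca).
- move=> th; rewrite EZ (funext (EX _ th)) (version_cos_sin a0 h01 ma' aal' HI' ZW th t).2.
  under eq_fun do rewrite (version_increments_cos_sin a0 h01 ma aal HI YV _ _ _).2.
  exact: cvg_cst.
move=> e e0; pose m := \sum_i `|t i| `^ h.
have m0 : 0 <= m by apply: sumr_ge0 => i _; exact: powR_ge0.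
have tm i : `|t i| `^ h <= m.
  by rewrite /m (bigD1 i)//= lerDl sumr_ge0// => j _; exact: powR_ge0.
have [lam [lam0 mlam] Hlam] := tail_threshold a0 K0 m0 e0.
exists lam => i; split.
  near=> r; have r0 : 0 < r by [].
  (* The rescaled motion vanishes at time 0, so the tail of its value at [t i] is that of an
     increment and is bounded uniformly in [r]. *)
  have -> : [set w | lam < `|(\row_i rescale h u r (V ^~ w) (t i)) 0 i|] =
      [set w | lam < `|rescale h u r (V ^~ w) (t i) - rescale h u r (V ^~ w) 0|].
    by apply/seteqP; split => w /=; rewrite mxE [X in _ - X]/rescale mulr0 addr0 subrr mulr0 subr0.
  have tlam : 2 * `|t i - 0| `^ h <= lam by rewrite subr0; have := tm i; lra.
  have /le_trans := increments_tail_rescale u r0 HV lam0 tlam; apply.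
  by rewrite lee_fin Hlam// powR_ge0 subr0 tm.
have -> : [set w | lam < `|(\row_i W (t i) w) 0 i|] = [set w | lam < `|W (t i) w|].
  by apply/seteqP; split => w /=; rewrite mxE.
have tlam : 2 * `|t i| `^ h <= lam by have := tm i; lra.
have /le_trans := HW (t i) lam lam0 tlam; apply.
by rewrite lee_fin Hlam// powR_ge0 tm.
Unshelve. all: by end_near. Qed.

End local_limit.

Section local_limit_CR.
Context {R : realType} {d d' : measure_display} {T : measurableType d}
  {T' : measurableType d'} (P : probability T R) (P' : probability T' R).
Variables (a h u : R) (alpha : R -> R) (I : (R -> R) -> {RV P >-> R})
  (I' : (R -> R) -> {RV P' >-> R}).
Hypotheses (a0 : 0 < a) (ah : a^-1 < h) (h1 : h < 1) (ca : continuous alpha)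
  (aal : forall x, a <= alpha x <= 2) (HI : multistable_integral alpha I)
  (HI' : multistable_integral (cst (alpha u)) I').

Lemma cvg_CR_lf_motion (Yc : T -> CR R) (Zc : T' -> CR R) (f : CR R -> R) (M : R) :
  continuous_version (lf_motion alpha h I) Yc ->
  continuous_version (lf_motion (cst (alpha u)) h I') Zc ->
  continuous f -> (forall x, `|f x| <= M) ->
  [/\ forall r, bounded_mfun (fun w => f (rescale_CR h u r (Yc w))),
      bounded_mfun (fun w => f (Zc w)) &
      (\int[P]_w f (rescale_CR h u r (Yc w)))%R @[r --> 0^'+] -->
      (\int[P']_w f (Zc w))%R].
Proof.
move=> YV ZW cf fM.
have h01 : 0 < h < 1 by rewrite h1 andbT (lt_trans _ ah)// invr_gt0.
have ma : measurable_fun setT alpha by exact: continuous_measurable_fun.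
have [K K0 HK] := lf_motion_tail a0 h01.
have [HV _] := HK _ _ _ _ _ (fun t w => eval_CR (Yc w) t) ma aal HI YV.
have [HW _] := HK _ _ _ _ _ (fun t w => eval_CR (Zc w) t)
  (measurable_cst _) (fun=> aal u) HI' ZW.
have mY r t : measurable_fun setT (fun w => eval_CR (rescale_CR h u r (Yc w)) t).
  by apply: measurable_funM => //; apply: measurable_funB; exact: (YV _).1.
have mZ t : measurable_fun setT (fun w => eval_CR (Zc w) t) by exact: (ZW t).1.
apply: (cvg_distr_CR (M := M)) => //.
- move=> n t g B cg gB.
  exact: (@cvg_fdd_lf_motion R d d' T T' P P' a h u alpha I I' a0 h01 ca aal HI HI'
    (fun t w => eval_CR (Yc w) t) (fun t w => eval_CR (Zc w) t) YV ZW n t g B cg gB).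
move=> N c e c0 e0; have [m Hm] := uniform_modulus N a0 ah K0 c0 e0.
exists m; split; last by apply: Hm => //; exact: increments_tail_scaled.
near=> r; apply: Hm => //; apply: (increments_tail_rescale u _ HV); by [].
Unshelve. all: by end_near. Qed.

End local_limit_CR.

Lemma localisable_lf_motion {R : realType} {d d'} {T : measurableType d}
    {T' : measurableType d'} (P : probability T R) (P' : probability T' R)
    (a h u : R) (alpha : R -> R) (I : (R -> R) -> {RV P >-> R})
    (I' : (R -> R) -> {RV P' >-> R}) :
  0 < a -> 0 < h < 1 -> continuous alpha -> (forall x, a <= alpha x <= 2) ->
  multistable_integral alpha I -> multistable_integral (cst (alpha u)) I' ->
  localisable h (lf_motion alpha h I) u (lf_motion (cst (alpha u)) h I').
Proof.
move=> a0 h01 ca aal HI HI'; split; last first.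
  apply: lf_motion_nontrivial HI' => //.
  by have /andP[au ->] := aal u; rewrite (lt_le_trans a0).
move=> n t f cf [M fM].
have YV : version_of P (fun t w => lf_motion alpha h I t w) (fun t w => lf_motion alpha h I t w).
  by move=> s; split => //; exact: nearW.
have ZW : version_of P' (fun t w => lf_motion (cst (alpha u)) h I' t w)
    (fun t w => lf_motion (cst (alpha u)) h I' t w).
  by move=> s; split => //; exact: nearW.
have bX r : bounded_mfun (fun w => f (\row_i rescale h u r (lf_motion alpha h I ^~ w) (t i))).
  apply: bounded_mfun_continuous_rV cf fM => i; under eq_fun do rewrite mxE.
  by apply: measurable_funM => //; exact: measurable_funB.
have bZ : bounded_mfun (fun w => f (\row_i lf_motion (cst (alpha u)) h I' (t i) w)).
  apply: bounded_mfun_continuous_rV cf fM => i; under eq_fun do rewrite mxE.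
  exact: measurable_funPT.
rewrite bounded_mfun_expectation//.
under eq_fun do rewrite bounded_mfun_expectation//.
apply: cvg_EFin; first exact: nearW.
exact: (@cvg_fdd_lf_motion R d d' T T' P P' a h u alpha I I' a0 h01 ca aal HI HI'
  _ _ YV ZW n t f M cf fM).
Qed.

Lemma lf_motion_continuous_version {R : realType} {d} {T : measurableType d}
    (P : probability T R) (a h : R) (alpha : R -> R) (I : (R -> R) -> {RV P >-> R}) :
  0 < a -> a^-1 < h < 1 -> measurable_fun setT alpha ->
  (forall x, a <= alpha x <= 2) -> multistable_integral alpha I ->
  exists Yc : T -> CR R, continuous_version (lf_motion alpha h I) Yc.
Proof.
move=> a0 /andP[ah h1] ma aal HI.
have h01 : 0 < h < 1 by rewrite h1 andbT (lt_trans _ ah)// invr_gt0.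
have [K K0 HK] := lf_motion_tail a0 h01.
have YV : version_of P (fun t w => lf_motion alpha h I t w) (fun t w => lf_motion alpha h I t w).
  by move=> s; split => //; exact: nearW.
have [HV _] := HK _ _ _ _ _ _ ma aal HI YV.
exact: (kolmogorov_continuous_version a0 ah K0 _ (increments_tail_scaled HV)).
Qed.

Theorem proposition4p3 (R : realType) (a b h : R) (alpha : R -> R)
    (a_gt0 : 0 < a) (le_ab : a <= b) (b_lt2 : b < 2)
    (alpha_ab : forall x, a <= alpha x <= b) (alpha_cont : continuous alpha)
    (d : measure_display) (T : measurableType d) (P : probability T R)
    (I : (R -> R) -> {RV P >-> R}) (I_alpha : multistable_integral alpha I) :
  (a^-1 - b^-1 < h < 1 + b^-1 - a^-1 ->
    forall (u : R) (d' : measure_display) (T' : measurableType d')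
      (P' : probability T' R) (I' : (R -> R) -> {RV P' >-> R}),
      multistable_integral (cst (alpha u)) I' ->
      localisable h (lf_motion alpha h I) u
        (lf_motion (cst (alpha u)) h I')) /\
  (a^-1 < h < 1 + b^-1 - a^-1 ->
    (exists Yc : T -> CR R, continuous_version (lf_motion alpha h I) Yc) /\
    forall (u : R) (d' : measure_display) (T' : measurableType d')
      (P' : probability T' R) (I' : (R -> R) -> {RV P' >-> R}),
      multistable_integral (cst (alpha u)) I' ->
      strongly_localisable h (lf_motion alpha h I) u
        (lf_motion (cst (alpha u)) h I')).
Proof.
have b0 : 0 < b by lra.
(* This places both ranges for [h] inside []0, 1[], the form in which the kernel estimates take
   it. *)
have ba : b^-1 <= a^-1 by rewrite lef_pV2.
have aal x : a <= alpha x <= 2.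
  by have /andP[-> /le_trans] := alpha_ab x; apply; exact: ltW.
have ma : measurable_fun setT alpha by exact: continuous_measurable_fun.
split=> /andP[h_gt h_lt].
  move=> u d' T' P' I' HI'; apply: (localisable_lf_motion a_gt0) => //.
  by apply/andP; split; lra.
have h01 : a^-1 < h < 1 by rewrite h_gt; lra.
split; first exact: (lf_motion_continuous_version a_gt0).
move=> u d' T' P' I' HI'; split.
  apply: (localisable_lf_motion a_gt0) => //.
  by rewrite (lt_trans _ h_gt) ?invr_gt0//; lra.
have [Yc YV] := lf_motion_continuous_version a_gt0 h01 ma aal I_alpha.
have [Zc ZW] := lf_motion_continuous_version a_gt0 h01
  (measurable_cst (alpha u)) (fun=> aal u) HI'.
exists Yc, Zc; split => // f cf [M fM].
have h1 : h < 1 by case/andP: h01.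
have [bX bZ c] := cvg_CR_lf_motion a_gt0 h_gt h1 alpha_cont aal I_alpha HI' YV ZW cf fM.
rewrite bounded_mfun_expectation//.
under eq_fun do rewrite bounded_mfun_expectation//.
by apply: cvg_EFin; [exact: nearW|exact: c].
Qed.
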